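(* For any dimension $n\ge 18$ there is a dense open set $U_n\subset\mathfrak{S}_n^3$ with the following property. Let $p\in U_n$ and let $\Phi$ be a smooth real-valued function on a neighborhood of the origin in $\mathbb{R}^n$ such that $\Phi(x)-p(x)$ vanishes to fourth order (or higher) at the origin. Then there exist a neighborhood $W$ of the origin and $\epsilon>0$ such that for every smooth real-valued $\psi$ compactly supported in $W$ there is a constant $C$ with $$\left|\int e^{i\lambda(\Phi(x)+\xi\cdot x)}\psi(x)\,dx\right|\le C\,|\lambda|^{-\frac n3}$$ for all $\xi\in\mathbb{R}^n$ with $|\xi|\le\epsilon$ and all real $\lambda\neq 0$.
   Context: $\mathfrak{S}_n^3$ is the real vector space of homogeneous cubic polynomials with real coefficients in $n$ variables, with its usual (finite-dimensional vector space) topology. A smooth function vanishes to fourth order (or higher) at the origin if all its partial derivatives of order at most $3$ vanish there. *)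

(* Defs.v *)
(* MathComp-Analysis, with cubic forms taken from multinomials and complex
   numbers from real-closed. The notations of multinomials clash with those of
   MathComp-Analysis, hence the import without notations; the import order lets
   the names of MathComp-Analysis (e.g. isMeasure) take precedence. *)
From HB Require Import structures.
From mathcomp Require Import all_boot all_order all_algebra.
From mathcomp Require Import -(notations) mpoly.
From mathcomp Require Import all_classical all_reals all_analysis.
From mathcomp Require complex.

Set Implicit Arguments.
Unset Strict Implicit.
Unset Printing Implicit Defensive.

Import Order.TTheory GRing.Theory Num.Theory.
Import numFieldNormedType.Exports.

Local Open Scope classical_set_scope.
Local Open Scope ring_scope.

Section CubicForms.
Variables (R : realType) (n : nat).

(* The coordinates of a cubic form: its coefficients at the monomials of degree
   at most 3 (those at degree at most 2 are 0). *)
Definition cubic_coefs (p : dhomog n R 3) :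
    'rV[R]_#|{: bmultinom n 4}| :=
  \row_i mcoeff (bmnm (enum_val i)) p.

(* [cubic_coefs] is linear and injective, so the topology it induces is the
   vector space topology of the space of cubic forms. *)
Definition cubic_form : Type := initial_topology cubic_coefs.

HB.instance Definition _ := Topological.on cubic_form.

Definition cubic_eval (p : cubic_form) (x : 'rV[R]_n) : R :=
  meval (fun i => x 0 i) (p : dhomog n R 3).

End CubicForms.

Section Smoothness.
Variables (R : realType) (n : nat).
Implicit Types (f : 'rV[R]_n -> R) (s : seq 'I_n).

Definition partial (i : 'I_n) f : 'rV[R]_n -> R := 'D_(delta_mx 0 i) f.

(* partials [:: i1; ..; ik] f = d_i1 (.. (d_ik f)) *)
Definition partials s f : 'rV[R]_n -> R := foldr partial f s.

(* V is meant to be open; the values of f outside V are then irrelevant. *)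
Definition smooth_on (V : set 'rV[R]_n) f : Prop :=
  forall s x, V x ->
    {for x, continuous (partials s f)} /\
    forall i, derivable (partials s f) x (delta_mx 0 i).

Definition vanishes_to_fourth_order f : Prop :=
  forall s, (size s <= 3)%N -> partials s f 0 = 0.

Definition support_closure f : set 'rV[R]_n := closure [set x | f x != 0].

Definition compactly_supported_in (W : set 'rV[R]_n) f : Prop :=
  compact (support_closure f) /\ support_closure f `<=` W.

Definition dotp (x y : 'rV[R]_n) : R := \sum_i x 0 i * y 0 i.

(* The norm that MathComp-Analysis puts on 'rV[R]_n is the sup norm. *)
Definition euclidean_norm (x : 'rV[R]_n) : R := Num.sqrt (dotp x x).

End Smoothness.

Section ConsMeasure.
Variables (R : realType) (n : nat).
Local Notation T := (measurableTypeR R).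
Variable mu : {sigma_finite_measure set (n.-tuple T) -> \bar R}.

Definition tuple_cons (x : T * n.-tuple T) : n.+1.-tuple T := [tuple of x.1 :: x.2].

Lemma measurable_tuple_cons : measurable_fun setT tuple_cons.
Proof. exact: measurable_cons. Qed.

Definition lebesgue_cons : set (n.+1.-tuple T) -> \bar R :=
  pushforward (lebesgue_measure \x mu)%E tuple_cons.

Let lebesgue_cons0 : lebesgue_cons set0 = 0%E.
Proof. by rewrite /lebesgue_cons /pushforward preimage_set0 measure0. Qed.

Let lebesgue_cons_ge0 A : (0 <= lebesgue_cons A)%E.
Proof. by rewrite /lebesgue_cons /pushforward. Qed.

Let lebesgue_cons_sigma_additive : semi_sigma_additive lebesgue_cons.
Proof.
move=> F mF tF mUF; rewrite /lebesgue_cons /pushforward preimage_bigcup.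
have mp A : measurable A -> measurable (tuple_cons @^-1` A).
  by move=> mA; rewrite -[X in measurable X]setTI; exact: measurable_tuple_cons.
apply: measure_semi_sigma_additive.
- by move=> k; exact: mp.
- apply/trivIsetP => /= i j _ _ ij; rewrite -preimage_setI.
  by move/trivIsetP : tF => /(_ _ _ _ _ ij) ->//; rewrite preimage_set0.
- by rewrite -preimage_bigcup; exact: mp.
Qed.

HB.instance Definition _ := isMeasure.Build _ _ _ lebesgue_cons
  lebesgue_cons0 lebesgue_cons_ge0 lebesgue_cons_sigma_additive.

Let lebesgue_cons_sigma_finite : sigma_finite setT lebesgue_cons.
Proof.
(* canonical inference does not find the product instance of sigma-finiteness *)
have [F TF Foo] : sigma_finite setT (lebesgue_measure \x mu)%E.
  have /sigma_finiteP[G [TG ndG Goo]] := sigma_finiteT (@lebesgue_measure R).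
  have /sigma_finiteP[H [TH ndH Hoo]] := sigma_finiteT mu.
  exists (fun k => G k `*` H k).
    rewrite -setXTT TG TH predeqE => -[x y]; split.
      move=> [/= [i _ Gix] [j _ Hjy]]; exists (maxn i j) => //; split.
      - by move: x Gix; exact/subsetPset/ndG/leq_maxl.
      - by move: y Hjy; exact/subsetPset/ndH/leq_maxr.
    by move=> [k _ []/= ? ?]; split; exists k.
  move=> k; have [? ?] := Goo k; have [? ?] := Hoo k.
  split; first exact: measurableX.
  by rewrite product_measure1E// lte_mul_pinfty// ge0_fin_numE.
pose u (t : n.+1.-tuple T) : T * n.-tuple T := (thead t, [tuple of behead t]).
have meas_u : measurable_fun setT u.
  by apply/measurable_fun_pair; [exact: measurable_tnth|exact: measurable_behead].
have consK : cancel tuple_cons u.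
  by move=> [x t]; congr pair; apply/val_inj.
exists (fun k => u @^-1` F k).
  by rewrite -preimage_bigcup -TF preimage_setT.
move=> k; have [mFk Fkoo] := Foo k; split.
  by rewrite -[X in measurable X]setTI; exact: meas_u.
rewrite /lebesgue_cons /pushforward (_ : _ @^-1` _ = F k)//.
by apply/seteqP; split=> x /=; rewrite /preimage/= consK.
Qed.

HB.instance Definition _ := Measure_isSigmaFinite.Build _ _ _ lebesgue_cons
  lebesgue_cons_sigma_finite.

End ConsMeasure.

(* n-dimensional Lebesgue measure: the n-fold product of lebesgue_measure. *)
Fixpoint lebesgue_tuple (R : realType) (n : nat) :
    {sigma_finite_measure set (n.-tuple (measurableTypeR R)) -> \bar R} :=
  match n with
  | 0 => \d_([tuple] : 0.-tuple (measurableTypeR R))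
  | m.+1 => lebesgue_cons (lebesgue_tuple R m)
  end.

Section OscillatoryIntegral.
Variables (R : realType) (n : nat).
Import complex.
Local Open Scope complex_scope.

Definition expi (t : R) : R[i] := cos t +i* sin t.

Definition integral_rV (f : 'rV[R]_n -> R) : R :=
  (\int[lebesgue_tuple R n]_t f (\row_i tnth t i))%R.

(* componentwise: MathComp-Analysis only integrates (extended) real functions *)
Definition cintegral_rV (f : 'rV[R]_n -> R[i]) : R[i] :=
  integral_rV (fun x => complex.Re (f x)) +i*
  integral_rV (fun x => complex.Im (f x)).

(* \int e^{i lambda (Phi(x) + xi.x)} psi(x) dx *)
Definition oscillatory_integral (lambda : R) (Phi psi : 'rV[R]_n -> R)
    (xi : 'rV[R]_n) : R[i] :=
  cintegral_rV (fun x => expi (lambda * (Phi x + dotp xi x)) * (psi x)%:C).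

End OscillatoryIntegral.

(* Main.v *)
(* U consists of the cubic forms p whose Hessian has rank at least m at every
   nonzero point, where m is the smallest integer above 2n/3. Compactness of the
   slices {x_i = 1, |x| <= 1} makes it open. It is dense because, near any form,
   the perturbations x_i Y(x, x) / 2 with Y symmetric have n(n+1)/2 parameters,
   while Y is a polynomial in x and in the Hessian at x: if the latter has rank
   at most r = m - 1, then Y lies in the union of finitely many polynomial images
   of spaces of dimension n - 1 + r(n-r) + r(r+1)/2, which is smaller than
   n(n+1)/2 when n >= 18, and such images miss a point of every fine grid.

   The estimate is uniform in xi since only the Hessian of the phase matters.
   With s = |lambda|^(-1/3), split psi dyadically into a piece of size s, which
   is trivially O(s^n), and pieces at the scales r = 2^j s. The rescaling x = r y
   turns the latter into integrals over an annulus with the large parameter 8^j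
   and a phase whose Hessian is close to that of p, hence nondegenerate in m
   directions. Averaging over shifts in these directions (van der Corput)
   and integrating by parts bound them by O(r^n 8^(-jm/2)) = O(s^n (2^n 8^(-m/2))^j),
   which is summable because 3m > 2n. *)
Require Import Defs.
From mathcomp Require Import all_boot all_order all_algebra.
From mathcomp Require Import -(notations) mpoly.
From mathcomp Require Import all_classical all_reals all_analysis.
From mathcomp Require Import measurable_realfun.
From mathcomp Require Import zify ring lra.
From mathcomp Require complex.

Set Implicit Arguments.
Unset Strict Implicit.
Unset Printing Implicit Defensive.

Import Order.TTheory GRing.Theory Num.Theory.
Import numFieldNormedType.Exports.

Local Open Scope classical_set_scope.
Local Open Scope ring_scope.

(** * Integrals of continuous functions with compact support *)

(** Stationary phase does not apply directly: the Hessian is only known to have rank at least m, its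
    good directions move with the point, and xi can put critical points anywhere. Squaring an
    average of translates replaces the phase by differences phi(x + v) - phi(x + v'), whose gradient
    is about (v - v') H. This is bounded below once v - v' lies in m good directions at a fixed
    centre, so that plain nonstationary phase suffices. Everything has to be uniform over cells,
    scales and xi. Hence the order of quantifiers in the estimates (the constant comes before the
    centre, the phase and the amplitude), the class [Cb] with explicit bounds on derivatives, and
    the lower bound [nondeg] in place of a rank. Complex integrals are replaced by integrals of
    cos(mu phi + theta) for arbitrary theta: sines, signs and integrations by parts merely change
    theta. For density, one perturbation must serve all points x of a slice at once; this is why x
    is counted among the parameters of the bad set. *)

Section RowNorm.
Variables (R : realType) (n : nat).
Implicit Types x y : 'rV[R]_n.

Lemma coord_le_norm x i : `|x 0 i| <= `|x|.
Proof.
rewrite [leRHS]mx_normrE.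
by apply: (le_bigmax _ (fun ij : 'I_1 * 'I_n => `|x ij.1 ij.2|) (0, i)).
Qed.

Lemma norm_rV_le x M : 0 <= M -> (`|x| <= M) <-> (forall i, `|x 0 i| <= M).
Proof.
move=> M0; split=> [xM i|xM]; first exact: le_trans (coord_le_norm x i) xM.
rewrite [leLHS]mx_normrE; apply: bigmax_le => // -[i j] _ /=.
by rewrite ord1.
Qed.

Lemma norm_rV_lt x M : 0 < M -> (`|x| < M) <-> (forall i, `|x 0 i| < M).
Proof.
move=> M0; split=> [xM i|xM]; first exact: le_lt_trans (coord_le_norm x i) xM.
rewrite [ltLHS]mx_normrE; apply/bigmax_ltP; split=> // -[i j] _ /=.
by rewrite ord1.
Qed.

End RowNorm.

Lemma continuous_at_dist (R : realType) (U V : normedModType R) (f : U -> V) x :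
  {for x, continuous f} <->
  forall e, 0 < e -> exists2 d, 0 < d & forall y, `|y - x| < d -> `|f y - f x| < e.
Proof.
split=> [/cvgrPdist_lt cf e e0|cf].
  have /nbhs_ballP[d /= d0 dP] := cf e e0; exists d => // y yx.
  by rewrite distrC; apply: dP; rewrite -ball_normE /= distrC.
apply/cvgrPdist_lt => e /cf[d d0 dP]; apply/nbhs_ballP; exists d => // y.
by rewrite -ball_normE /= distrC => /dP; rewrite distrC.
Qed.

Section Tuples.
Variable R : realType.
Local Notation T := (measurableTypeR R).

Definition rowt n (t : n.-tuple T) : 'rV[R]_n := \row_i tnth t i.

Definition consrv n (t : R) (y : 'rV[R]_n) : 'rV[R]_n.+1 :=
  \row_i oapp (fun j => y 0 j) t (unlift ord0 i).

Lemma consrv0 n t (y : 'rV[R]_n) : consrv t y 0 ord0 = t.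
Proof. by rewrite mxE unlift_none. Qed.

Lemma consrvS n t (y : 'rV[R]_n) j : consrv t y 0 (lift ord0 j) = y 0 j.
Proof. by rewrite mxE liftK. Qed.

Lemma rowt_cons n (x : T * n.-tuple T) :
  rowt (tuple_cons x) = consrv x.1 (rowt x.2).
Proof.
apply/rowP => i; case: (unliftP ord0 i) => [j|] ->.
  by rewrite consrvS !mxE /tuple_cons tnthS.
by rewrite consrv0 mxE tnth0.
Qed.

Lemma consrvD n t t' (y y' : 'rV[R]_n) :
  consrv t y + consrv t' y' = consrv (t + t') (y + y').
Proof.
by apply/rowP => i; case: (unliftP ord0 i) => [j|] ->;
  rewrite mxE ?consrvS ?consrv0 // mxE.
Qed.

Lemma consrvZ n r t (y : 'rV[R]_n) : r *: consrv t y = consrv (r * t) (r *: y).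
Proof.
by apply/rowP => i; case: (unliftP ord0 i) => [j|] ->;
  rewrite mxE ?consrvS ?consrv0 // mxE.
Qed.

Lemma consrv_eta n (x : 'rV[R]_n.+1) :
  x = consrv (x 0 ord0) (\row_j x 0 (lift ord0 j)).
Proof.
by apply/rowP => i; case: (unliftP ord0 i) => [j|] ->;
  rewrite ?consrvS ?consrv0 // mxE.
Qed.

Lemma norm_consrv n (t : R) (y : 'rV[R]_n) : `|consrv t y| = Num.max `|t| `|y|.
Proof.
apply/le_anti/andP; split.
  apply/norm_rV_le => [|i]; first by rewrite le_max normr_ge0.
  case: (unliftP ord0 i) => [j|] ->; rewrite ?consrvS ?consrv0 le_max ?lexx //.
  by rewrite (coord_le_norm y j) orbT.
rewrite ge_max; apply/andP; split.
  by have := coord_le_norm (consrv t y) ord0; rewrite consrv0.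
apply/norm_rV_le => // j.
by have := coord_le_norm (consrv t y) (lift ord0 j); rewrite consrvS.
Qed.

Lemma consrvB n t t' (y y' : 'rV[R]_n) :
  consrv t y - consrv t' y' = consrv (t - t') (y - y').
Proof.
by apply/rowP => i; case: (unliftP ord0 i) => [j|] ->;
  rewrite !mxE ?unlift_none ?liftK /= ?mxE.
Qed.

Lemma continuous_consrv n (f : 'rV[R]_n.+1 -> R) : continuous f ->
  (forall t, continuous (fun y => f (consrv t y))) *
  (forall y, continuous (fun t => f (consrv t y))).
Proof.
move=> cf; split=> [t y|y t]; apply: continuous_comp; try exact: cf.
  apply/continuous_at_dist => e e0; exists e => // z yz.
  by rewrite consrvB subrr norm_consrv normr0 gt_max e0.
apply/continuous_at_dist => e e0; exists e => // z yz.
by rewrite consrvB subrr norm_consrv normr0 gt_max e0 andbT.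
Qed.

(** For the sup norm a ball is a finite intersection of coordinate cylinders, which are measurable
    for the product structure on tuples. *)
Lemma measurable_rowt_ball n (z : 'rV[R]_n) (e : R) :
  measurable ((@rowt n) @^-1` (ball z e)).
Proof.
have [e0|e0] := ltP 0 e; last first.
  rewrite [X in measurable X](_ : _ = set0) //; apply/seteqP; split=> // t /=.
  by rewrite -ball_normE /= => /(le_lt_trans (normr_ge0 _)); rewrite ltNge e0.
rewrite [X in measurable X](_ : _ =
    \bigcap_(i in [set: 'I_n]) ((fun t => tnth t i) @^-1` (ball (z 0 i) e))).
  apply: fin_bigcap_measurable => // i _.
  rewrite -[X in measurable X]setTI; apply: measurable_tnth => //.
  by apply: open_measurable; exact: ball_open.
apply/seteqP; split=> t /=; rewrite -ball_normE /= => h.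
  move=> i _ /=; rewrite -ball_normE /=.
  by have /norm_rV_lt/(_ i) := h; rewrite !mxE; apply.
rewrite -ball_normE /=; apply/norm_rV_lt => // i; have := h i I.
by rewrite /ball_ /= !mxE.
Qed.

(** Balls with rational centre and radius 1/(k+1) form a countable base. This links the product
    sigma-algebra on tuples with the topology of row vectors. *)
Lemma measurable_rowt_open n (O : set 'rV[R]_n) : open O ->
  measurable ((@rowt n) @^-1` O).
Proof.
move=> oO.
pose D := {ffun 'I_n -> rat} * nat : Type.
pose c (d : {ffun 'I_n -> rat} * nat) : 'rV[R]_n := \row_i ratr (d.1 i).
pose B (d : {ffun 'I_n -> rat} * nat) : set 'rV[R]_n :=
  if pselect (ball (c d) d.2.+1%:R^-1 `<=` O) then ball (c d) d.2.+1%:R^-1 else set0.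
rewrite (_ : O = \bigcup_d B d); last first.
  apply/seteqP; split=> [x Ox|x [d _]]; last first.
    by rewrite /B; case: pselect => // h; exact: h.
  have [e e0 xO] : exists2 e : R, 0 < e & ball x e `<=` O.
    have /nbhs_ballP[e' /= e'0 eO] := open_nbhs_nbhs (conj oO Ox).
    by exists e'.
  have [k ke] : exists k : nat, k.+1%:R^-1 < e / 2.
    have e20 : 0 < e / 2 by rewrite divr_gt0.
    have [k _ /(_ k (leqnn _)) /=] := near_infty_natSinv_lt (PosNum e20).
    by exists k.
  have /choice[q qP] : forall i : 'I_n, exists q : rat, `|ratr q - x 0 i| < k.+1%:R^-1.
    move=> i; have : x 0 i - k.+1%:R^-1 < x 0 i + k.+1%:R^-1.
      by rewrite ltrD2l gt0_cp.
    move=> /rat_in_itvoo[q]; rewrite in_itv/= => /andP[h1 h2]; exists q.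
    by rewrite ltr_distl h1.
  have k0 : 0 < k.+1%:R^-1 :> R by rewrite invr_gt0.
  have xc : `|c ([ffun i => q i], k) - x| < k.+1%:R^-1.
    by apply/norm_rV_lt => // i; rewrite !mxE ffunE qP.
  exists ([ffun i => q i], k) => //; rewrite /B; case: (pselect _) => /= [_|]; last first.
    case=> y; rewrite -ball_normE /= => cy; apply: xO; rewrite -ball_normE /=.
    rewrite (_ : x - y = (c ([ffun i => q i], k) - y) - (c ([ffun i => q i], k) - x)).
      apply: le_lt_trans (ler_normB _ _) _.
      by rewrite [ltRHS]splitr ltrD // (lt_trans _ ke).
    by rewrite opprB [RHS]addrC addrA subrK.
  by rewrite -ball_normE.
rewrite preimage_bigcup; apply: countable_bigcupT_measurable => [|d].
  exact: countableP.
rewrite /B; case: (pselect _) => /= _; first exact: measurable_rowt_ball.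
by rewrite preimage_set0.
Unshelve. all: by end_near. Qed.

Lemma measurable_comp_rowt n (f : 'rV[R]_n -> R) : continuous f ->
  measurable_fun [set: n.-tuple T] (f \o @rowt n).
Proof.
move=> /continuousP cf.
apply: (measurability _ (RGenOpens.measurableE R)).
move=> _ [_ [a [b ->] <-]]; rewrite setTI.
rewrite comp_preimage; apply: measurable_rowt_open; apply: cf; exact: interval_open.
Qed.

(** This class is stable under slicing, products and affine changes of variables, and its members
    are integrable; Fubini and linearity therefore come without further side conditions. *)
Definition cc n (f : 'rV[R]_n -> R) : Prop :=
  continuous f /\ exists B, forall x, B < `|x| -> f x = 0.

Lemma continuous_bounded n (K : set 'rV[R]_n) (f : 'rV[R]_n -> R) :
  compact K -> (forall x, K x -> {for x, continuous f}) ->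
  exists2 M, 0 <= M & forall x, K x -> `|f x| <= M.
Proof.
move=> cK cf; have [[x0 Kx0]|/set0P/negP/negPn/eqP ->] := pselect (K !=set0).
  have [||c _ cM] := @EVT_max_rV R n (fun x => `|f x|) K _ cK.
  - by exists x0.
  - apply: continuous_in_subspaceT => x /set_mem Kx.
    by apply: continuous_comp; [exact: cf|exact: norm_continuous].
  - by exists `|f c| => // x Kx; apply: cM; exact/mem_set.
by exists 0.
Qed.

Lemma compact_norm_ball n (z : 'rV[R]_n) r : compact [set x : 'rV[R]_n | `|x - z| <= r].
Proof.
apply: bounded_closed_compact.
  exists (`|z| + r); split; first exact: num_real.
  move=> M zM x /= xr; apply: le_trans (ltW zM).
  by rewrite -[x](subrK z) (le_trans (ler_normD _ _)) // addrC lerD2l.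
rewrite (_ : [set x | _] = (fun x => `|x - z|) @^-1` [set y : R | y <= r]) //.
apply: closed_comp; last exact: closed_le.
by move=> x _; apply: continuous_comp; [apply: continuousB => //; exact: cst_continuous|
  exact: norm_continuous].
Qed.

Lemma cc_bounded n (f : 'rV[R]_n -> R) : cc f ->
  exists2 M, 0 <= M & forall x, `|f x| <= M.
Proof.
move=> [cf [B fB]]; have [|M M0 fM] := @continuous_bounded n [set x | `|x - 0| <= B] f _ (fun x _ => cf x).
  exact: compact_norm_ball.
exists M => // x; have [/fB ->|xB] := ltP B `|x|; first by rewrite normr0.
by apply: fM; rewrite /= subr0.
Qed.

Lemma measurable_box n B : measurable [set t : n.-tuple T | `|rowt t| <= B].
Proof.
rewrite (_ : [set _ | _] = ~` ((@rowt n) @^-1` [set x | B < `|x|])); last first.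
  by apply/seteqP; split=> t /=; rewrite leNgt => /negP.
apply: measurableC; apply: measurable_rowt_open.
rewrite (_ : [set x | _] = (fun x => `|x|) @^-1` [set y : R | B < y]) //.
apply: open_comp; last exact: open_gt.
move=> x _; apply/continuous_at_dist => e e0; exists e => // y.
exact/le_lt_trans/ler_dist_dist.
Qed.

Lemma itv_norm_le (B : R) : [set t : R | `|t| <= B] = `[- B, B]%classic.
Proof. by apply/seteqP; split=> t /=; rewrite in_itv /= ler_norml. Qed.

Lemma lebesgue_box_fin n B :
  (lebesgue_tuple R n [set t | (`|rowt t| <= B)%R] < +oo)%E.
Proof.
elim: n => [|n IH] /=.
  by rewrite (le_lt_trans (probability_le1 _ _)) ?ltry //; exact: measurable_box.
rewrite /lebesgue_cons /pushforward.
rewrite (_ : _ @^-1` _ = [set t : R | `|t| <= B] `*` [set t | `|rowt t| <= B]).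
  rewrite itv_norm_le product_measure1E //; last exact: measurable_box.
  rewrite lte_mul_pinfty //.
    by rewrite ge0_fin_numE //= lebesgue_measure_itv /=; case: ifP => //; rewrite ltry.
apply/seteqP; split=> -[t u] /=; rewrite rowt_cons norm_consrv ge_max; first by move/andP.
by case=> -> ->.
Qed.

Lemma cc_integrable n (f : 'rV[R]_n -> R) : cc f ->
  (lebesgue_tuple R n).-integrable setT (EFin \o (f \o @rowt n)).
Proof.
move=> ccf; have [M M0 fM] := cc_bounded ccf; case: ccf => cf [B fB].
have : (lebesgue_tuple R n).-integrable [set t | `|rowt t| <= B] (EFin \o (f \o @rowt n)).
  apply: measurable_bounded_integrable.
  - exact: measurable_box.
  - exact: lebesgue_box_fin.
  - exact: (measurable_funTS (measurable_comp_rowt cf)).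
  - exists M; split; first exact: num_real.
    by move=> y My t _ /=; exact: le_trans (fM _) (ltW My).
rewrite integrable_mkcond; last exact: measurable_box.
apply: eq_integrable => // t _.
rewrite patchE; case: ifPn => // /negP tB /=; rewrite fB // ltNge; apply/negP => h.
by apply: tB; apply/mem_set.
Qed.

Definition int1 (g : R -> R) : R := \int[lebesgue_measure]_t g t.

Definition cc1 (g : R -> R) : Prop :=
  continuous g /\ exists B, forall x, B < `|x| -> g x = 0.

Lemma cc_consrv n (f : 'rV[R]_n.+1 -> R) : cc f ->
  (forall t, cc (fun y => f (consrv t y))) * (forall y, cc1 (fun t => f (consrv t y))).
Proof.
move=> [cf [B fB]]; have [c1 c2] := continuous_consrv cf; split=> [t|y]; split => //.
  by exists B => y By; apply: fB; rewrite norm_consrv lt_max By orbT.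
by exists B => t By; apply: fB; rewrite norm_consrv lt_max By.
Qed.

Lemma integral_rVE n (f : 'rV[R]_n -> R) : cc f ->
  (integral_rV f)%:E = (\int[lebesgue_tuple R n]_t (f (rowt t))%:E)%E.
Proof.
move=> /cc_integrable fi.
by rewrite /integral_rV /Rintegral fineK //; exact: integrable_fin_num fi.
Qed.

Lemma int1_itv (g : R -> R) a b : (forall x, x \notin `[a, b] -> g x = 0) ->
  int1 g = \int[lebesgue_measure]_(t in `[a, b]) g t.
Proof.
move=> gB; rewrite [RHS]Rintegral_mkcond; apply: eq_Rintegral => t _.
rewrite patchE; case: ifPn => // /negP tB; apply: gB; apply/negP => h.
by apply: tB; apply/mem_set.
Qed.

Lemma cc1_integrable (g : R -> R) : cc1 g ->
  lebesgue_measure.-integrable setT (EFin \o g).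
Proof.
move=> [cg [B gB]].
have : lebesgue_measure.-integrable `[- B, B] (EFin \o g).
  apply: continuous_compact_integrable; first exact: segment_compact.
  exact: continuous_subspaceT.
rewrite integrable_mkcond //; apply: eq_integrable => // t _.
rewrite patchE; case: ifPn => // /negP tB /=; rewrite gB // ltNge; apply/negP => h.
by apply: tB; apply/mem_set; rewrite /= in_itv /= -ler_norml.
Qed.

Lemma int1E (g : R -> R) : cc1 g ->
  (int1 g)%:E = (\int[lebesgue_measure]_t (g t)%:E)%E.
Proof.
move=> /cc1_integrable gi.
by rewrite /int1 /Rintegral fineK //; exact: integrable_fin_num gi.
Qed.

(** [lebesgue_tuple] in dimension n.+1 is the push-forward of a product measure along [tuple_cons].
    Both orders are recorded because inductions on the dimension need the first coordinate sometimes
    outermost and sometimes innermost. *)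
Lemma fubini_rV n (f : 'rV[R]_n.+1 -> R) : cc f ->
  (integral_rV f = int1 (fun t => integral_rV (fun y => f (consrv t y)))) *
  (integral_rV f = integral_rV (fun y => int1 (fun t => f (consrv t y)))).
Proof.
move=> ccf; have [c1 c2] := cc_consrv ccf.
pose h (x : T * n.-tuple T) : \bar R := (f (consrv x.1 (rowt x.2)))%:E.
have [M M0 fM] := cc_bounded ccf; case: (ccf) => cf [B fB].
have mh : measurable_fun setT h.
  rewrite (_ : h = EFin \o ((f \o @rowt n.+1) \o @tuple_cons R n)); last first.
    by apply/funext => x; rewrite /h /= rowt_cons.
  apply/measurable_EFinP.
  exact: (measurableT_comp (measurable_comp_rowt cf) (@measurable_tuple_cons R n)).
have hi : (lebesgue_measure \x lebesgue_tuple R n)%E.-integrable setT h.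
  pose A := @tuple_cons R n @^-1` [set t | `|rowt t| <= B].
  have mA : measurable A.
    rewrite -[A]setTI; apply: (@measurable_tuple_cons R n) => //.
    exact: measurable_box.
  have : (lebesgue_measure \x lebesgue_tuple R n)%E.-integrable A h.
    apply: measurable_bounded_integrable => //.
    - exact: (lebesgue_box_fin n.+1 B).
    - by apply/measurable_EFinP; exact: measurable_funTS.
    - exists M; split; first exact: num_real.
      by move=> y My t _ /=; exact: le_trans (fM _) (ltW My).
  rewrite integrable_mkcond //; apply: eq_integrable => // t _.
  rewrite patchE; case: ifPn => // /negP tB; rewrite /h fB // ltNge; apply/negP => h0.
  by apply: tB; apply/mem_set; rewrite /A /= rowt_cons.
have E : (\int[lebesgue_tuple R n.+1]_t (f (rowt t))%:E =
          \int[lebesgue_measure \x lebesgue_tuple R n]_x h x)%E.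
  have hE : h = (fun t => (f (rowt t))%:E) \o @tuple_cons R n.
    by apply/funext => x; rewrite /h /= rowt_cons.
  rewrite hE; rewrite hE in hi.
  apply: (@integral_pushforward _ _ _ _ R (@tuple_cons R n) (@measurable_tuple_cons R n)
     (lebesgue_measure \x lebesgue_tuple R n)%E setT (fun t => (f (rowt t))%:E)) => //.
  by apply/measurable_EFinP; exact: measurable_comp_rowt.
split.
  rewrite {1}/integral_rV /Rintegral [X in fine X]E -integral12_prod_meas1 //.
  rewrite /int1 /Rintegral; congr fine; apply: eq_integral => t _.
  by rewrite integral_rVE.
rewrite {1}/integral_rV /Rintegral [X in fine X]E -integral21_prod_meas1 //.
rewrite /integral_rV /Rintegral; congr fine; apply: eq_integral => t _.
by rewrite int1E.
Qed.

Lemma int1_affine (g : R -> R) (r v : R) : cc1 g -> 0 < r ->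
  int1 (fun t => g (r * t + v)) = int1 (fun t => r^-1 * g t).
Proof.
move=> [cg [B gB]] r0; pose C := `|B| + 1.
have C0 : 0 < C by rewrite ltr_wpDl.
have gC x : x \notin `[- C, C] -> g x = 0.
  rewrite in_itv /= -ler_norml -ltNge => Cx; apply: gB; apply: lt_trans Cx.
  by rewrite /C (le_lt_trans (ler_norm _)) // ltrDl.
pose F (t : R) : R := r * t + v.
have dF (t : R) : is_derive t 1 F r by apply: is_derive_eq; rewrite addr0 [LHS]mulr1.
have F' : derive1 F = cst r by apply/funext => t; rewrite derive1E derive_val.
pose a := (- C - v) / r; pose b := (C - v) / r.
have Fa : F a = - C by rewrite /F /a mulrC divfK ?gt_eqF // subrK.
have Fb : F b = C by rewrite /F /b mulrC divfK ?gt_eqF // subrK.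
have ab : a < b by rewrite /a /b ltr_pM2r ?invr_gt0 // ltrD2r gtrN.
rewrite (@int1_itv _ a b); last first.
  move=> x xab; apply: gC; apply: contra xab; rewrite !in_itv /=.
  by rewrite /a /b ler_pdivrMr // ler_pdivlMr // lerBlDr lerBrDr mulrC.
rewrite (@int1_itv _ (- C) C); last by move=> x /gC ->; rewrite mulr0.
rewrite /Rintegral; congr fine.
rewrite -Fa -Fb (@integration_by_substitution_increasing _ F) //.
- apply: eq_integral => t _; congr EFin => /=.
  by rewrite F' /= -[RHS]mulrC mulVKf ?gt_eqF.
- exact: ltW.
- by move=> x y _ _ xy; rewrite /F ltrD2r ltr_pM2l.
- by move=> x _; rewrite F'; exact: cst_continuous.
- by rewrite F'; exact: is_cvg_cst.
- by rewrite F'; exact: is_cvg_cst.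
- have cF : continuous F.
    by move=> t; apply: differentiable_continuous; apply/derivable1_diffP; exact: ex_derive.
  split; first by move=> x _; exact: ex_derive.
  + by apply: cvg_at_right_filter; exact: cF.
  + by apply: cvg_at_left_filter; exact: cF.
- have cG : continuous (fun t : R => r^-1 * g t).
    by move=> t; apply: (continuous_comp (cg t)); exact: mulrl_continuous.
  exact: continuous_subspaceT.
Qed.

Lemma int1_derive0 (g : R -> R) : cc1 g -> (forall t, derivable g t 1) ->
  cc1 (derive1 g) -> int1 (derive1 g) = 0.
Proof.
move=> [cg [B gB]] dg [cg' [B' gB']].
pose C := Num.max (Num.max B B') 0 + 1.
have C0 : 0 < C by rewrite /C ltr_wpDl // le_max lexx orbT.
have CB : B < C by rewrite /C (@le_lt_trans _ _ (Num.max (Num.max B B') 0)) ?le_max ?lexx // ltrDl.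
have CB' : B' < C by rewrite /C (@le_lt_trans _ _ (Num.max (Num.max B B') 0)) ?le_max ?lexx ?orbT // ltrDl.
rewrite (@int1_itv _ (- C) C); last first.
  move=> x; rewrite in_itv /= -ler_norml -ltNge => Cx; apply: gB'; exact: lt_trans Cx.
have gC : g C = 0 by apply: gB; rewrite gtr0_norm.
have gNC : g (- C) = 0 by apply: gB; rewrite normrN gtr0_norm.
rewrite /Rintegral (continuous_FTC2 (F := g)).
- by rewrite gC gNC -EFinB subrr.
- by rewrite gtrN.
- exact: continuous_subspaceT.
- split; first by move=> x _; exact: dg.
  + by apply: cvg_at_right_filter; exact: cg.
  + by apply: cvg_at_left_filter; exact: cg.
- by [].
Qed.

(** The two difference quotients are the same function of h, so directional derivatives transfer
    without any total differentiability. *)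
Lemma derive_comp_affine (V W : normedModType R) (w : W -> R) (L : V -> W) v v' a :
  (forall h : R, L (h *: v + a) = h *: v' + L a) ->
  (derivable (w \o L) a v <-> derivable w (L a) v') *
  ('D_v (w \o L) a = 'D_v' w (L a)).
Proof.
move=> LE.
have E : (fun h : R => h^-1 *: ((w \o L) (h *: v + a) - (w \o L) a)) =
         (fun h : R => h^-1 *: (w (h *: v' + L a) - w (L a))).
  by apply/funext => h; rewrite /= LE.
split; first by rewrite /derivable E.
by rewrite /derive E.
Qed.

Lemma lipschitz_continuous (U V : normedModType R) (L : U -> V) K :
  (forall x y, `|L x - L y| <= K * `|x - y|) -> continuous L.
Proof.
move=> LK x; apply/continuous_at_dist => e e0; exists (e / (`|K| + 1)).
  by rewrite divr_gt0 // ltr_wpDl.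
move=> y; rewrite ltr_pdivlMr ?ltr_wpDl // => h; apply: le_lt_trans (LK _ _) _.
apply: le_lt_trans h; rewrite mulrC; apply: ler_wpM2l => //.
by rewrite (le_trans (ler_norm K)) // lerDl.
Qed.

Lemma affine_rV n (f : 'rV[R]_n -> R) (r : R) (v : 'rV[R]_n) : 0 < r -> cc f ->
  cc (fun x => f (r *: x + v)).
Proof.
move=> r0 [cf [B fB]]; split.
  have cL : continuous (fun x : 'rV[R]_n => r *: x + v : 'rV[R]_n).
    apply: (@lipschitz_continuous _ _ _ `|r|) => x y.
    by rewrite opprD addrACA subrr addr0 -scalerBr normrZ.
  by move=> x; apply: continuous_comp; [exact: cL|exact: cf].
exists ((`|B| + `|v|) / r) => x; rewrite ltr_pdivrMr // => h; apply: fB.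
have : `|r *: x| <= `|r *: x + v| + `|v|.
  by rewrite -{1}[r *: x](addrK v) ler_normB.
rewrite normrZ gtr0_norm // mulrC => h2.
have := lt_le_trans h h2; rewrite ltrD2r; apply: le_lt_trans; exact: ler_norm.
Qed.

Lemma cc_scale n (f : 'rV[R]_n -> R) c : cc f -> cc (fun x => c * f x).
Proof.
move=> [cf [B fB]]; split; last by exists B => x /fB ->; rewrite mulr0.
by move=> x; apply: continuousM; [exact: cst_continuous|exact: cf].
Qed.

(** Induction on the dimension: [int1_affine] rescales the first coordinate in the inner integral,
    the order of integration is exchanged, and the induction hypothesis rescales the other
    coordinates. *)
Lemma integral_rV_affine n (f : 'rV[R]_n -> R) r v : 0 < r -> cc f ->
  integral_rV (fun x => f (r *: x + v)) = integral_rV (fun x => r ^- n * f x).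
Proof.
move=> r0; elim: n => [|n IH] in f v *.
  move=> _; rewrite /integral_rV; apply: eq_Rintegral => t _.
  by rewrite expr0 invr1 mul1r; congr f; apply/rowP => -[].
move=> ccf.
rewrite (fubini_rV (affine_rV v r0 ccf)).2.
pose v' := \row_j v 0 (lift ord0 j).
transitivity (integral_rV (fun y => int1 (fun t => r^-1 * f (consrv t (r *: y + v'))))).
  congr integral_rV; apply/funext => y.
  rewrite -(@int1_affine (fun t => f (consrv t (r *: y + v'))) r (v 0 ord0)) //.
    by congr int1; apply/funext => t; rewrite consrvZ [in LHS](consrv_eta v) consrvD.
  exact: (cc_consrv ccf).2.
(* The intermediate integrand, with the first coordinate already rescaled and the others not yet. It
   is a function of the whole row so that Fubini can exchange the order. *)
pose f1 (x : 'rV[R]_n.+1) := r^-1 * f (consrv (x 0 ord0) (r *: (\row_j x 0 (lift ord0 j)) + v')).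
have f1E t y : f1 (consrv t y) = r^-1 * f (consrv t (r *: y + v')).
  rewrite /f1 consrv0; congr (_ * f (consrv _ (_ *: _ + _))).
  by apply/rowP => j; rewrite mxE consrvS.
have ccf1 : cc f1.
  apply: cc_scale; case: ccf => cf [B fB].
  pose p (x : 'rV[R]_n.+1) : 'rV[R]_n := \row_j x 0 (lift ord0 j).
  have pB x y : `|p x - p y| <= `|x - y|.
    apply/norm_rV_le => // j.
    by have := coord_le_norm (x - y) (lift ord0 j); rewrite !mxE.
  have cL : continuous (fun x : 'rV[R]_n.+1 => consrv (x 0 ord0) (r *: p x + v')).
    apply: (@lipschitz_continuous _ _ _ (1 + r)) => x y.
    rewrite consrvB norm_consrv opprD addrACA subrr addr0 -scalerBr normrZ (gtr0_norm r0).
    rewrite mulrDl mul1r ge_max; apply/andP; split.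
      rewrite ler_wpDr ?(mulr_ge0 (ltW r0)) //.
      by have := coord_le_norm (x - y) ord0; rewrite !mxE.
    by rewrite ler_wpDl // ler_wpM2l // ltW.
  split; first by move=> x; apply: continuous_comp; [exact: cL|exact: cf].
  exists (`|B| + (`|B| + `|v'|) / r) => x; rewrite {1}(consrv_eta x) norm_consrv lt_max.
  have q0 : 0 <= (`|B| + `|v'|) / r by rewrite divr_ge0 ?(ltW r0) ?addr_ge0.
  move=> /orP[h|h]; apply: fB; rewrite norm_consrv lt_max; apply/orP.
    left; apply: le_lt_trans h; rewrite ler_wpDr //; exact: ler_norm.
  right; have {}h : (`|B| + `|v'|) / r < `|p x|.
    by apply: le_lt_trans h; rewrite ler_wpDl.
  rewrite ltr_pdivrMr // in h.
  have h2 : `|r *: p x| <= `|r *: p x + v'| + `|v'|.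
    by rewrite -{1}[r *: p x](addrK v') ler_normB.
  rewrite normrZ gtr0_norm // mulrC in h2.
  have := lt_le_trans h h2; rewrite ltrD2r; apply: le_lt_trans; exact: ler_norm.
rewrite (_ : (fun y => _) = (fun y => int1 (fun t => f1 (consrv t y)))); last first.
  by apply/funext => y; congr int1; apply/funext => t; rewrite f1E.
rewrite -(fubini_rV ccf1).2 (fubini_rV ccf1).1 (fubini_rV (cc_scale (r ^- n.+1) ccf)).1.
congr int1; apply/funext => t.
under [in LHS]eq_fun do rewrite f1E.
rewrite (IH (fun y => r^-1 * f (consrv t y))); last first.
  exact: (cc_consrv (cc_scale r^-1 ccf)).1.
by congr integral_rV; apply/funext => y; rewrite mulrA exprS invfM [r^-1 * _]mulrC.
Qed.

(** When i is the first coordinate, integrating along it first gives 0 by the fundamental theorem of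
    calculus; otherwise each slice is covered by the induction hypothesis. *)
Lemma integral_rV_partial n (w : 'rV[R]_n -> R) i : cc w ->
  (forall x, derivable w x (delta_mx 0 i)) -> cc (partial i w) ->
  integral_rV (partial i w) = 0.
Proof.
elim: n => [|n IH] in w i *; first by case: i.
move=> ccw dw ccdw; case: (unliftP ord0 i) => [j|] ij; last first.
  rewrite (fubini_rV ccdw).2.
  rewrite (_ : (fun y => _) = fun y => 0).
    by rewrite /integral_rV /Rintegral; under eq_integral do []; rewrite integral0.
  apply/funext => y.
  have L (t h : R) : consrv (h *: 1 + t) y = h *: delta_mx 0 i + consrv t y.
    by apply/rowP => k; case: (unliftP ord0 k) => [l|] ->;
      rewrite !mxE ?unlift_none ?liftK ij /= ?mulr0 ?add0r // mulr1.
  have D t := @derive_comp_affine R^o _ w (fun t => consrv t y) 1 (delta_mx 0 i) t (L t).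
  have E : (fun t => partial i w (consrv t y)) = derive1 (fun t => w (consrv t y)).
    by apply/funext => t; rewrite derive1E; exact: esym (D t).2.
  rewrite E; apply: int1_derive0.
  - exact: (cc_consrv ccw).2.
  - by move=> t; apply/(D t).1; exact: dw.
  - by rewrite -E; exact: (cc_consrv ccdw).2.
rewrite (fubini_rV ccdw).1.
rewrite (_ : (fun t => _) = fun t => 0).
  by rewrite /int1 /Rintegral integral0.
apply/funext => t.
have L (y : 'rV[R]_n) (h : R) : consrv t (h *: delta_mx 0 j + y) = h *: delta_mx 0 i + consrv t y.
  apply/rowP => k; case: (unliftP ord0 k) => [l|] ->.
    by rewrite !mxE liftK ij /= !mxE (inj_eq (@lift_inj _ _)).
  by rewrite !mxE unlift_none ij /= mulr0 add0r.
have D y := derive_comp_affine w (L y).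
have E : (fun y => partial i w (consrv t y)) = partial j (fun y => w (consrv t y)).
  by apply/funext => y; exact: esym (D y).2.
rewrite E; apply: IH.
- exact: (cc_consrv ccw).1.
- by move=> y; apply/(D y).1; exact: dw.
- by rewrite -E; exact: (cc_consrv ccdw).1.
Qed.

Section Linearity.
Variable n : nat.
Implicit Types f g : 'rV[R]_n -> R.

Lemma ccD f g : cc f -> cc g -> cc (fun x => f x + g x).
Proof.
move=> [cf [B fB]] [cg [C gC]]; split.
  by move=> x; apply: continuousD; [exact: cf|exact: cg].
by exists (Num.max B C) => x; rewrite gt_max => /andP[/fB -> /gC ->]; rewrite addr0.
Qed.

Lemma cc_sum (I : Type) (s : seq I) (F : I -> 'rV[R]_n -> R) :
  (forall i, cc (F i)) -> cc (fun x => \sum_(i <- s) F i x).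
Proof.
move=> ccF; elim: s => [|i s IH].
  under eq_fun do rewrite big_nil; split; first exact: cst_continuous.
  by exists 0.
by under eq_fun do rewrite big_cons; exact: ccD.
Qed.

Lemma integral_rVD f g : cc f -> cc g ->
  integral_rV (fun x => f x + g x) = integral_rV f + integral_rV g.
Proof.
by move=> /cc_integrable fi /cc_integrable gi; rewrite /integral_rV RintegralD.
Qed.

Lemma integral_rVZ f c : cc f ->
  integral_rV (fun x => c * f x) = c * integral_rV f.
Proof. by move=> /cc_integrable fi; rewrite /integral_rV RintegralZl. Qed.

Lemma integral_rV_sum (I : Type) (s : seq I) (F : I -> 'rV[R]_n -> R) :
  (forall i, cc (F i)) ->
  integral_rV (fun x => \sum_(i <- s) F i x) = \sum_(i <- s) integral_rV (F i).
Proof.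
move=> ccF; elim: s => [|i s IH].
  under eq_fun do rewrite big_nil.
  by rewrite big_nil /integral_rV /Rintegral integral0.
under eq_fun do rewrite big_cons.
by rewrite big_cons -IH integral_rVD //; exact: cc_sum.
Qed.

Lemma le_integral_rV f g : cc f -> cc g -> (forall x, f x <= g x) ->
  integral_rV f <= integral_rV g.
Proof.
by move=> /cc_integrable fi /cc_integrable gi fg; apply: le_Rintegral.
Qed.

Lemma le_norm_integral_rV f g : cc f -> cc g -> (forall x, `|f x| <= g x) ->
  `|integral_rV f| <= integral_rV g.
Proof.
move=> ccf ccg fg; rewrite ler_norml; apply/andP; split.
  rewrite lerNl -mulN1r -integral_rVZ //; apply: le_integral_rV => // [|x].
    exact: cc_scale.
  by rewrite mulN1r (le_trans _ (fg x)) // -normrN ler_norm.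
by apply: le_integral_rV => // x; exact: le_trans (ler_norm _) (fg x).
Qed.

End Linearity.

End Tuples.

(** * Functions with bounded partial derivatives *)

Section Lines.
Variable R : realType.

(** Smoothness is given by directional derivatives. Restriction to a line makes them ordinary
    derivatives, to which the chain rule in one variable applies. *)
Lemma is_derive_line (V : normedModType R) (f : V -> R) (a v : V) (t : R) (d : R) :
  is_derive (t *: v + a) v f d <-> is_derive t 1 (fun t : R => f (t *: v + a)) d.
Proof.
have E : (fun h : R => h^-1 *: (f ((h *: (1 : R) + t) *: v + a) - f (t *: v + a))) =
    (fun h : R => h^-1 *: (f (h *: v + (t *: v + a)) - f (t *: v + a))).
  apply/funext => h; congr (_ *: (f _ - _)).
  by rewrite addrA -scalerDl; congr (_ *: _ + _); rewrite [h *: _]mulr1.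
split=> -[h1 h2]; split.
- by rewrite /derivable E.
- by rewrite -h2 /derive E.
- by move: h1; rewrite /derivable E.
- by rewrite -h2 /derive E.
Qed.

Lemma is_derive_comp1 (V : normedModType R) (g : R -> R) (f : V -> R) (a v : V) (c d : R) :
  is_derive (f a) 1 g c -> is_derive a v f d -> is_derive a v (g \o f) (c * d).
Proof.
move=> dg df; have := @is_derive_line V (g \o f) a v 0 (c * d).
rewrite scale0r add0r => ->.
have := @is_derive_line V f a v 0 d; rewrite scale0r add0r => -[/(_ df) df0 _].
change (is_derive (0 : R) (1 : R) (g \o (fun t : R => f (t *: v + a))) (c * d)).
by apply: is_derive1_comp; rewrite scale0r add0r.
Qed.

Lemma is_derive_scaled (V : normedModType R) (f : V -> R) (a v b : V) (r d : R) :
  is_derive (r *: a + b) v f d -> is_derive a v (fun x => f (r *: x + b)) (r * d).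
Proof.
move=> df; have := @is_derive_line V (fun x => f (r *: x + b)) a v 0 (r * d).
rewrite scale0r add0r => ->.
have -> : (fun t : R => f (r *: (t *: v + a) + b)) =
    (fun t : R => f (t *: v + (r *: a + b))) \o (fun t => r * t).
  by apply/funext => t /=; rewrite scalerDr scalerA addrA.
rewrite mulrC; apply: is_derive1_comp.
  by rewrite mulr0 -is_derive_line scale0r add0r.
by apply: is_derive_eq; rewrite ?scaler0 ?add0r [LHS]mulr1.
Qed.

Lemma is_derive_eqP (V : normedModType R) (f : V -> R) (a v : V) (d : R) :
  is_derive a v f d <-> derivable f a v /\ 'D_v f a = d.
Proof. by split=> -[]. Qed.

End Lines.

Section Class.
Variables (R : realType) (n : nat).
Implicit Types (f g : 'rV[R]_n -> R) (Q : set 'rV[R]_n).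
Local Notation e_ i := (delta_mx 0 i : 'rV[R]_n).

Lemma partial_local f g Q x i : open Q -> Q x -> (forall y, Q y -> f y = g y) ->
  (derivable f x (e_ i) -> derivable g x (e_ i)) * (partial i f x = partial i g x).
Proof.
move=> oQ Qx fg.
by split; [apply: near_eq_derivable|apply: near_eq_derive];
  apply: filterS (open_nbhs_nbhs (conj oQ Qx)) => y /fg.
Qed.

Lemma continuous_local f g Q x : open Q -> Q x -> (forall y, Q y -> f y = g y) ->
  {for x, continuous f} -> {for x, continuous g}.
Proof.
move=> oQ Qx fg /continuous_at_dist cf; apply/continuous_at_dist => e /cf[d d0 dP].
have /nbhs_ballP[d' /= d'0 d'Q] := open_nbhs_nbhs (conj oQ Qx).
exists (Num.min d d') => [|y]; first by rewrite lt_min d0.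
rewrite lt_min => /andP[yd yd']; rewrite -!fg //; first exact: dP.
by apply: d'Q; rewrite -ball_normE /= distrC.
Qed.

(** One bound M serves all iterated partial derivatives of order at most k, in any order of
    differentiation. Keeping M explicit lets later constants be fixed before the function. *)
Fixpoint Cb (k : nat) (M : R) Q f : Prop :=
  (forall x, Q x -> {for x, continuous f} /\ `|f x| <= M) /\
  if k is k'.+1 then
    forall i, (forall x, Q x -> derivable f x (e_ i)) /\ Cb k' M Q (partial i f)
  else True.

Lemma Cb0 k M Q f : Cb k M Q f -> Cb 0 M Q f.
Proof. by case: k => [|k] []. Qed.

Lemma Cb_norm k M Q f x : Cb k M Q f -> Q x -> `|f x| <= M.
Proof. by move=> /Cb0[h _] /h[]. Qed.

Lemma Cb_cts k M Q f x : Cb k M Q f -> Q x -> {for x, continuous f}.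
Proof. by move=> /Cb0[h _] /h[]. Qed.

Lemma Cb_ext k M Q f g : open Q -> (forall x, Q x -> f x = g x) -> Cb k M Q f -> Cb k M Q g.
Proof.
move=> oQ; elim: k f g => [|k IH] f g fg /= [h1 h2]; split=> //.
- move=> x Qx; have [cf fM] := h1 x Qx; rewrite -fg //; split=> //.
  exact: continuous_local oQ Qx fg cf.
- move=> x Qx; have [cf fM] := h1 x Qx; rewrite -fg //; split=> //.
  exact: continuous_local oQ Qx fg cf.
- move=> i; have [df cf] := h2 i; split.
    by move=> x Qx; apply: (partial_local i oQ Qx fg).1; exact: df.
  by apply: IH cf => x Qx; exact: (partial_local i oQ Qx fg).2.
Qed.

Lemma Cb_le k M M' Q f : M <= M' -> Cb k M Q f -> Cb k M' Q f.
Proof.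
move=> MM'; elim: k f => [|k IH] f /= [h1 h2]; split=> //.
- by move=> x /h1[? h]; split=> //; exact: le_trans MM'.
- by move=> x /h1[? h]; split=> //; exact: le_trans MM'.
- by move=> i; have [? ?] := h2 i; split=> //; exact: IH.
Qed.

Lemma Cb_sub k M Q Q' f : Q' `<=` Q -> Cb k M Q f -> Cb k M Q' f.
Proof.
move=> QQ'; elim: k f => [|k IH] f /= [h1 h2]; split=> //.
- by move=> x /QQ'/h1.
- by move=> x /QQ'/h1.
- by move=> i; have [d c] := h2 i; split; [move=> x /QQ'/d|exact: IH].
Qed.

Lemma CbS k M Q f : Cb k.+1 M Q f -> Cb k M Q f.
Proof.
elim: k f => [|k IH] f; first by case.
by move=> [h1 h2]; split=> // i; have [d c] := h2 i; split=> //; exact: IH.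
Qed.

Lemma Cb_union k M Q Q' f : Cb k M Q f -> Cb k M Q' f -> Cb k M (Q `|` Q') f.
Proof.
elim: k f => [|k IH] f /= [h1 h2] [h1' h2']; split=> //.
- by move=> x [/h1|/h1'].
- by move=> x [/h1|/h1'].
- move=> i; have [d c] := h2 i; have [d' c'] := h2' i.
  by split; [move=> x [/d|/d']|exact: IH].
Qed.

Lemma Cb_cst k Q c M : open Q -> `|c| <= M -> Cb k M Q (fun=> c).
Proof.
move=> oQ; elim: k c => [|k IH] c cM; (split=> [x Qx|//]; first by split=> //; exact: cst_continuous).
move=> i; split; first by move=> x _; exact: derivable_cst.
apply: (@Cb_ext _ _ _ (fun=> 0)) => //; last by apply: IH; rewrite normr0 (le_trans _ cM).
by move=> x _; rewrite /partial derive_cst.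
Qed.

Lemma Cb_add k M M' Q f g : open Q -> Cb k M Q f -> Cb k M' Q g ->
  Cb k (M + M') Q (fun x => f x + g x).
Proof.
move=> oQ; elim: k f g => [|k IH] f g [hf1 hf2] [hg1 hg2].
  split=> // x Qx; have [cf fM] := hf1 x Qx; have [cg gM] := hg1 x Qx.
  by split; [exact: continuousD|rewrite (le_trans (ler_normD _ _)) ?lerD].
split=> [x Qx|i].
  have [cf fM] := hf1 x Qx; have [cg gM] := hg1 x Qx.
  by split; [exact: continuousD|rewrite (le_trans (ler_normD _ _)) ?lerD].
have [df cf] := hf2 i; have [dg cg] := hg2 i; split.
  by move=> x Qx; apply: derivableD; [exact: df|exact: dg].
apply: Cb_ext (IH _ _ cf cg) => // x Qx.
by rewrite /partial -deriveD //; [exact: df|exact: dg].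
Qed.

Lemma Cb_mul k M M' Q f g : open Q -> Cb k M Q f -> Cb k M' Q g ->
  Cb k (2 ^+ k * (M * M')) Q (fun x => f x * g x).
Proof.
move=> oQ; elim: k f g => [|k IH] f g [hf1 hf2] [hg1 hg2].
  rewrite mul1r; split=> // x Qx; have [cf fM] := hf1 x Qx; have [cg gM] := hg1 x Qx.
  by split; [exact: continuousM|rewrite normrM ler_pM].
split=> [x Qx|i].
  have [cf fM] := hf1 x Qx; have [cg gM] := hg1 x Qx.
  split; [exact: continuousM|rewrite normrM].
  apply: le_trans (ler_pM _ _ fM gM) _ => //.
  rewrite ler_peMl ?mulr_ge0 ?(le_trans _ fM) ?(le_trans _ gM) //.
  by rewrite exprn_ege1 // ler1n.
have [df cf] := hf2 i; have [dg cg] := hg2 i; split.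
  by move=> x Qx; apply: derivableM; [exact: df|exact: dg].
have := Cb_add oQ (IH _ _ cf (CbS (conj hg1 hg2))) (IH _ _ (CbS (conj hf1 hf2)) cg).
rewrite -mulr2n -mulrnAl -[_ *+ 2]mulr_natl -exprS; apply: Cb_ext => // x Qx.
rewrite /partial deriveM; [|exact: df|exact: dg].
by change (partial i f x * g x + f x * partial i g x = f x * partial i g x + g x * partial i f x); ring.
Qed.

Lemma Cb_scale k M Q f c : open Q -> Cb k M Q f -> Cb k (`|c| * M) Q (fun x => c * f x).
Proof.
move=> oQ; elim: k f => [|k IH] f [h1 h2].
  split=> // x Qx; have [cf fM] := h1 x Qx.
  split; last by rewrite normrM ler_wpM2l.
  by apply: continuousM => //; exact: cst_continuous.
split=> [x Qx|i].
  have [cf fM] := h1 x Qx.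
  split; last by rewrite normrM ler_wpM2l.
  by apply: continuousM => //; exact: cst_continuous.
have [df cf] := h2 i; split.
  by move=> x Qx; apply: derivableM; [exact: derivable_cst|exact: df].
apply: Cb_ext (IH _ cf) => // x Qx.
by exact: esym (deriveZ c (df x Qx)).
Qed.

(** The induction rests on (1/f)' = - f' (1/f)^2. The constant depends on k, M and c only and
    precedes Q and f; the uniformity of [nonstationary] relies on this. *)
Lemma Cb_inv k M c : 0 < c -> exists2 C, 0 <= C & forall Q f, open Q -> Cb k M Q f ->
  (forall x, Q x -> c <= `|f x|) -> Cb k C Q (fun x => (f x)^-1).
Proof.
move=> c0; elim: k => [|k [C C0 IH]].
  exists c^-1; first by rewrite invr_ge0 ltW.
  move=> Q f oQ [h1 _] fc; split=> // x Qx; have [cf fM] := h1 x Qx.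
  have fx0 : f x != 0 by rewrite -normr_gt0 (lt_le_trans c0) ?fc.
  by split; [exact: continuousV|rewrite normfV lef_pV2 ?posrE ?normr_gt0 ?fc].
pose C' := 2 ^+ k * (`|M| * (2 ^+ k * (C * C))).
exists (C + C'); first by rewrite addr_ge0 ?mulr_ge0 ?exprn_ge0.
move=> Q f oQ hf fc; have hV := IH _ _ oQ (CbS hf) fc.
have C'0 : 0 <= C' by rewrite !mulr_ge0 ?exprn_ge0.
have fx0 x : Q x -> f x != 0 by move=> Qx; rewrite -normr_gt0 (lt_le_trans c0) ?fc.
split=> [x Qx|i].
  by split; [exact: Cb_cts hV Qx|rewrite (le_trans (Cb_norm hV Qx)) ?lerDl].
have [df cf] := hf.2 i; split.
  by move=> x Qx; apply: derivableV; [exact: fx0|exact: df].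
apply: (@Cb_ext _ _ _ (fun x => -1 * (partial i f x * ((f x)^-1 * (f x)^-1)))) => //.
  move=> x Qx; rewrite /partial deriveV; [|exact: fx0|exact: df].
  by change (-1 * ('D_(e_ i) f x * ((f x)^-1 * (f x)^-1)) = - (f x ^- 2) * 'D_(e_ i) f x);
    rewrite expr2 invfM; ring.
apply: (@Cb_le _ C'); first by rewrite lerDr.
apply: (@Cb_le _ (`|-1| * C')); first by rewrite normrN1 mul1r.
apply: Cb_scale => //.
apply: Cb_mul => //; last exact: Cb_mul.
by apply: Cb_le cf; exact: ler_norm.
Qed.

Lemma Cb_dilate k M Q f r b : open Q -> 0 <= M -> 0 <= r -> Cb k M Q f ->
  Cb k (Num.max 1 r ^+ k * M) [set x | Q (r *: x + b)] (fun x => f (r *: x + b)).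
Proof.
move=> oQ M0 r0.
have m1 : 1 <= Num.max 1 r by rewrite le_max lexx.
have cL : continuous (fun x : 'rV[R]_n => r *: x + b : 'rV[R]_n).
  apply: (@lipschitz_continuous _ _ _ _ `|r|) => x y.
  by rewrite opprD addrACA subrr addr0 -scalerBr normrZ.
have oQ' : open [set x | Q (r *: x + b)].
  by apply: (open_comp _ oQ) => x _; exact: cL.
elim: k f => [|k IH] f [h1 h2].
  split=> // x Qx; have [cf fM] := h1 _ Qx; rewrite expr0 mul1r.
  by split=> //; apply: continuous_comp; [exact: cL|exact: cf].
split=> [x Qx|i].
  have [cf fM] := h1 _ Qx.
  split; first by apply: continuous_comp; [exact: cL|exact: cf].
  by apply: le_trans fM _; rewrite ler_peMl // exprn_ege1.
have [df cf] := h2 i.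
have D x : Q (r *: x + b) -> is_derive x (e_ i) (fun x => f (r *: x + b)) (r * partial i f (r *: x + b)).
  by move=> Qx; apply: is_derive_scaled; apply: derivableP; exact: df.
split; first by move=> x Qx; have [] := D x Qx.
apply: (@Cb_ext _ _ _ (fun x => r * partial i f (r *: x + b))) => //.
  by move=> x Qx; have [_] := D x Qx.
apply: (@Cb_le _ (`|r| * (Num.max 1 r ^+ k * M))).
  rewrite ger0_norm // exprS -mulrA ler_wpM2r ?mulr_ge0 ?exprn_ge0 // ?le_max ?ler01 //.
  by rewrite lexx orbT.
by apply: Cb_scale => //; exact: IH.
Qed.

Lemma Cb_affine k M Q f r b : open Q -> 0 <= M -> 0 <= r <= 1 -> Cb k M Q f ->
  Cb k M [set x | Q (r *: x + b)] (fun x => f (r *: x + b)).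
Proof.
move=> oQ M0 /andP[r0 r1] /(Cb_dilate b oQ M0 r0).
by rewrite (max_idPl r1) expr1n mul1r.
Qed.

Definition box (z : 'rV[R]_n) r : set 'rV[R]_n := [set x : 'rV[R]_n | `|x - z| < r].

Lemma open_box (z : 'rV[R]_n) r : open (box z r).
Proof.
rewrite (_ : box z r = (fun x => `|x - z|) @^-1` [set y : R | y < r]) //.
apply: open_comp; last exact: open_lt.
move=> x _; apply/continuous_at_dist => e e0; exists e => // y yx.
apply: le_lt_trans (ler_dist_dist _ _) _.
by rewrite opprB addrA subrK.
Qed.

(** The path from y to x changes one coordinate at a time; for the sup norm this staircase stays in
    the ball, and each step is a mean value theorem in one variable. With a = 0 this is a Lipschitz
    bound; with a column of a Hessian for a, it compares the increment of a gradient with a linear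
    map. *)
Lemma mvt_coord f (z : 'rV[R]_n) r (a : 'I_n -> R) eps (x y : 'rV[R]_n) :
  (forall x : 'rV[R]_n, `|x - z| < r -> forall i, derivable f x (e_ i) /\ `|partial i f x - a i| <= eps) ->
  `|x - z| < r -> `|y - z| < r ->
  `|f x - f y - \sum_i a i * (x 0 i - y 0 i)| <= n%:R * eps * `|x - y|.
Proof.
move=> hf xz yz.
have r0 : 0 < r by exact: le_lt_trans xz.
pose p (k : nat) : 'rV[R]_n := \row_i (if (i < k)%N then x 0 i else y 0 i).
have pz k : `|p k - z| < r.
  apply/norm_rV_lt => // i; rewrite !mxE; case: ifP => _.
    by have := le_lt_trans (coord_le_norm (x - z) i) xz; rewrite !mxE.
  by have := le_lt_trans (coord_le_norm (y - z) i) yz; rewrite !mxE.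
have p0 : p 0%N = y by apply/rowP => i; rewrite mxE.
have pn : p n = x by apply/rowP => i; rewrite mxE ltn_ord.
have -> : f x - f y = \sum_(i < n) (f (p i.+1) - f (p i)).
  rewrite -(big_mkord xpredT (fun i => f (p i.+1) - f (p i))).
  by rewrite (telescope_sumr (fun i => f (p i))) // pn p0.
rewrite -sumrB -mulrA mulr_natl.
have -> : eps * `|x - y| *+ n = \sum_(i < n) (eps * `|x - y|).
  by rewrite sumr_const card_ord.
apply: le_trans (ler_norm_sum _ _ _) _; apply: ler_sum => i _.
have step (t : R) : 0 <= t <= 1 -> `|t *: ((x 0 i - y 0 i) *: e_ i) + p i - z| < r.
  move=> /andP[t0 t1]; apply/norm_rV_lt => // j; rewrite !mxE.
  have [ji|ji] := eqVneq j i; last first.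
    by rewrite mulr0 mulr0 add0r; have := le_lt_trans (coord_le_norm (p i - z) j) (pz i); rewrite !mxE.
  rewrite ji ltnn /= mulr1.
  have hx := le_lt_trans (coord_le_norm (x - z) i) xz.
  have hy := le_lt_trans (coord_le_norm (y - z) i) yz.
  rewrite !mxE in hx hy; rewrite (_ : _ - _ = t * (x 0 i - z 0 i) + (1 - t) * (y 0 i - z 0 i)); last by ring.
  apply: le_lt_trans (ler_normD _ _) _; rewrite !normrM.
  rewrite (ger0_norm t0) (@ger0_norm _ (1 - t)) ?subr_ge0 //.
  pose m := Num.max `|x 0 i - z 0 i| `|y 0 i - z 0 i|.
  have mr : m < r by rewrite gt_max hx.
  apply: le_lt_trans mr; rewrite (_ : m = t * m + (1 - t) * m); last by ring.
  by rewrite lerD // ler_wpM2l ?subr_ge0 // le_max lexx ?orbT.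
have -> : p i.+1 = 1 *: ((x 0 i - y 0 i) *: e_ i) + p i.
  apply/rowP => j; rewrite !mxE ltnS leq_eqVlt; have [->|ji] := eqVneq j i.
    by rewrite eqxx ltnn /= mulr1 mul1r subrK.
  by rewrite mulr0 mulr0 add0r -(inj_eq val_inj) in ji *; rewrite (negPf ji).
pose g (t : R) := f (t *: ((x 0 i - y 0 i) *: e_ i) + p i).
have dg (t : R) : 0 <= t <= 1 -> is_derive t 1 g
    ((x 0 i - y 0 i) * partial i f (t *: ((x 0 i - y 0 i) *: e_ i) + p i)).
  move=> t01; have [df _] := hf _ (step t t01) i; rewrite scalerA in df *.
  rewrite (_ : g = (fun s : R => f (s *: e_ i + p i)) \o (fun t => t * (x 0 i - y 0 i))); last first.
    by apply/funext => s; rewrite /g /= scalerA.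
  rewrite mulrC; apply: is_derive1_comp.
    apply: (@is_derive_line R _ f (p i) (e_ i) (t * (x 0 i - y 0 i)) _).1.
    exact: derivableP.
  by apply: is_derive_eq; rewrite ?scaler0 ?add0r [LHS]mulr1.
have [c c01 E] : exists2 c, c \in `[0, 1] & g 1 - g 0 =
    (x 0 i - y 0 i) * partial i f (c *: ((x 0 i - y 0 i) *: e_ i) + p i) * (1 - 0).
  apply: (@MVT_segment _ g (fun t => (x 0 i - y 0 i) * partial i f (t *: ((x 0 i - y 0 i) *: e_ i) + p i))) => //.
    by move=> t; rewrite in_itv /= => /andP[t0 t1]; apply: dg; rewrite !ltW.
  apply: continuous_in_subspaceT => t /set_mem /=; rewrite in_itv /= => t01.
  by apply: differentiable_continuous; apply/derivable1_diffP; have [] := dg t t01.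
have -> : f (p i) = g 0 by rewrite /g scale0r add0r.
rewrite -/(g 1) E subr0 mulr1 [_ * partial _ _ _]mulrC -mulrBl normrM.
rewrite in_itv /= in c01.
apply: ler_pM => //; first exact: (hf _ (step c c01) i).2.
by have := coord_le_norm (x - y) i; rewrite !mxE.
Qed.

(** The mean value theorem applies to every derivative of f, so the difference is of size |v - v'|
    with all its derivatives up to order k. Division by the size of the shift then preserves uniform
    bounds. The radius shrinks by d to keep both translates in the box. *)
Lemma Cb_shift_diff k M f (z : 'rV[R]_n) r d (v v' : 'rV[R]_n) : 0 <= M ->
  (forall x : 'rV[R]_n, `|x - z| < r -> {for x, continuous f} /\ forall i, derivable f x (e_ i)) ->
  (forall i, Cb k M (box z r) (partial i f)) ->
  `|v| <= d -> `|v'| <= d ->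
  Cb k (n%:R * M * `|v - v'|) (box z (r - d)) (fun x => f (x + v) - f (x + v')).
Proof.
move=> M0 + + vd v'd.
have sh (x w : 'rV[R]_n) : `|w| <= d -> `|x - z| < r - d -> `|x + w - z| < r.
  move=> wd xz; rewrite addrAC (le_lt_trans (ler_normD _ _)) //.
  by rewrite -(subrK d r) ltr_leD.
have cs (w : 'rV[R]_n) : continuous (fun x : 'rV[R]_n => x + w : 'rV[R]_n).
  by apply: (@lipschitz_continuous _ _ _ _ 1) => x y; rewrite opprD addrACA subrr addr0 mul1r.
have Z g : (forall x : 'rV[R]_n, `|x - z| < r -> {for x, continuous g} /\ forall i, derivable g x (e_ i)) ->
    (forall i, Cb 0 M (box z r) (partial i g)) ->
    forall x : 'rV[R]_n, `|x - z| < r - d -> {for x, continuous (fun x : 'rV[R]_n => g (x + v) - g (x + v'))} /\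
      `|g (x + v) - g (x + v')| <= n%:R * M * `|v - v'|.
  move=> h1 h2 x xz; split.
    apply: continuousB.
      by apply: continuous_comp; [exact: cs|exact: (h1 _ (sh _ _ vd xz)).1].
    by apply: continuous_comp; [exact: cs|exact: (h1 _ (sh _ _ v'd xz)).1].
  have := @mvt_coord g z r (fun=> 0) M (x + v) (x + v').
  rewrite big1; last by move=> i _; rewrite mul0r.
  rewrite subr0 (_ : x + v - (x + v') = v - v'); last by rewrite opprD addrACA subrr add0r.
  apply; [|exact: sh|exact: sh].
  by move=> y yz i; split; [exact: (h1 _ yz).2|rewrite subr0; exact: Cb_norm (h2 i) yz].
elim: k f => [|k IH] f h1 h2.
  by split=> // x xz; exact: Z.
split=> [x xz|i].
  by apply: Z => // i; exact: Cb0 (h2 i).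
have D (x w : 'rV[R]_n) : `|w| <= d -> `|x - z| < r - d -> is_derive x (e_ i) (fun x : 'rV[R]_n => f (x + w)) (partial i f (x + w)).
  move=> wd xz.
  have := @is_derive_scaled R _ f x (e_ i) w 1 (partial i f (x + w)).
  rewrite mul1r scale1r; under eq_fun do rewrite scale1r; apply.
  by apply: derivableP; exact: (h1 _ (sh _ _ wd xz)).2.
split=> [x xz|].
  by have [d1 _] := D x v vd xz; have [d2 _] := D x v' v'd xz; exact: derivableB.
apply: (@Cb_ext _ _ _ (fun x => partial i f (x + v) - partial i f (x + v'))).
- exact: open_box.
- move=> x xz; have [d1 e1] := D x v vd xz; have [d2 e2] := D x v' v'd xz.
  by rewrite /partial (deriveB d1 d2) e1 e2.
apply: IH.
  move=> x xz; split; first exact: Cb_cts (h2 i) xz.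
  by move=> j; exact: ((h2 i).2 j).1 xz.
by move=> j; exact: ((h2 i).2 j).2.
Qed.

End Class.

(** * Oscillatory integrals with a nondegenerate phase *)

Section Support.
Variables (R : realType) (n : nat).
Implicit Types (f g a : 'rV[R]_n -> R) (Q : set 'rV[R]_n) (z : 'rV[R]_n).
Local Notation e_ i := (delta_mx 0 i : 'rV[R]_n).

Definition zero_off z r a := forall x : 'rV[R]_n, r < `|x - z| -> a x = 0.

Lemma open_off z r : open [set x : 'rV[R]_n | r < `|x - z|].
Proof.
rewrite (_ : [set x | _] = (fun x => `|x - z|) @^-1` [set y : R | r < y]) //.
apply: open_comp; last exact: open_gt.
move=> x _; apply/continuous_at_dist => e e0; exists e => // y yx.
apply: le_lt_trans (ler_dist_dist _ _) _.
by rewrite opprB addrA subrK.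
Qed.

(** The phase factor is controlled on Q only; outside the closed ball the amplitude vanishes on an
    open set, and the product is locally 0. *)
Lemma continuous_mul_off z r Q f a : (forall x, `|x - z| <= r -> Q x) ->
  (forall x, Q x -> {for x, continuous f}) -> continuous a -> zero_off z r a ->
  continuous (fun x => f x * a x).
Proof.
move=> rQ cf ca a0 x; have [xr|xr] := leP `|x - z| r.
  by apply: continuousM; [exact/cf/rQ|exact: ca].
have := @continuous_local R n (fun=> 0) (fun x => f x * a x) _ x (@open_off z r) xr.
apply; last exact: cst_continuous.
by move=> y /a0 ->; rewrite mulr0.
Qed.

Lemma cc_off z r f : continuous f -> zero_off z r f -> cc f.
Proof.
move=> cf f0; split=> //; exists (`|z| + r) => x h; apply: f0.
rewrite -(ltrD2l `|z|); apply: lt_le_trans h _.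
by rewrite addrC -{1}[x](subrK z) ler_normD.
Qed.

Lemma Cb_mul_off k M M' z r Q f a : open Q -> (forall x, `|x - z| <= r -> Q x) ->
  0 <= M -> 0 <= M' -> Cb k M Q f -> Cb k M' setT a -> zero_off z r a ->
  Cb k (2 ^+ k * (M * M')) setT (fun x => f x * a x).
Proof.
move=> oQ rQ M0 M'0 hf ha a0.
have -> : setT = Q `|` [set x : 'rV[R]_n | r < `|x - z|].
  apply/seteqP; split=> // x _; have [xr|xr] := leP `|x - z| r; [left; exact: rQ|by right].
apply: Cb_union.
  by apply: Cb_mul => //; apply: Cb_sub ha.
apply: (@Cb_ext _ _ _ _ _ (fun=> 0)); first exact: open_off.
  by move=> x /a0 ->; rewrite mulr0.
by apply: Cb_cst; [exact: open_off|rewrite normr0 !mulr_ge0 ?exprn_ge0].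
Qed.

Lemma ccM f g : cc f -> cc g -> cc (fun x => f x * g x).
Proof.
move=> [cf [B fB]] [cg _]; split; last by exists B => x /fB ->; rewrite mul0r.
by move=> x; apply: continuousM; [exact: cf|exact: cg].
Qed.

Lemma integral_rV_shift f (v : 'rV[R]_n) : cc f ->
  integral_rV (fun x => f (x + v)) = integral_rV f.
Proof.
move=> ccf; have := @integral_rV_affine R n f 1 v ltr01 ccf.
rewrite expr1n invr1; under eq_fun do rewrite scale1r.
by under [in RHS]eq_fun do rewrite mul1r.
Qed.

Lemma cc_shift f (v : 'rV[R]_n) : cc f -> cc (fun x => f (x + v)).
Proof. by move=> /(affine_rV v ltr01); under eq_fun do rewrite scale1r. Qed.

(** A continuous majorant of the indicator of the closed ball, used instead of its volume: it lies
    in [cc], and its integral is independent of z by translation. *)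
Definition bump z r (x : 'rV[R]_n) : R := Num.max 0 (r + 1 - `|x - z|).

Lemma cc_bump z r : cc (bump z r).
Proof.
apply: (@cc_off z (r + 1)); last by move=> x h; apply/max_idPl; rewrite subr_le0 ltW.
apply: (@lipschitz_continuous _ _ _ _ 1) => x y; rewrite mul1r /bump.
have h : Num.norm (`|x - z| - `|y - z|) <= `|x - y|.
  by apply: le_trans (ler_dist_dist _ _) _; rewrite opprB addrA subrK.
move: h; move: `|x - z| `|y - z| `|x - y| => a b c.
rewrite !ler_norml /Num.max; case: ifP; case: ifP; lra.
Qed.

Lemma bump_ge0 z r x : 0 <= bump z r x.
Proof. by rewrite le_max lexx. Qed.

Lemma bump_ge1 z r x : `|x - z| <= r -> 1 <= bump z r x.
Proof. by move=> h; rewrite le_max addrAC lerDr subr_ge0 h orbT. Qed.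

Lemma integral_bump z r : integral_rV (bump z r) = integral_rV (bump 0 r).
Proof.
rewrite -(integral_rV_shift z (cc_bump z r)); congr integral_rV; apply/funext => x.
by rewrite /bump addrK subr0.
Qed.

Lemma norm_integral_off z r f A : continuous f -> zero_off z r f ->
  (forall x, `|f x| <= A) -> `|integral_rV f| <= A * integral_rV (bump 0 r).
Proof.
move=> cf f0 fA; have A0 : 0 <= A by exact: le_trans (fA 0).
rewrite -(integral_bump z) -integral_rVZ; last exact: cc_bump.
apply: le_norm_integral_rV; [exact: cc_off f0|by apply: cc_scale; exact: cc_bump|].
move=> x; have [xr|xr] := leP `|x - z| r.
  by apply: le_trans (fA x) _; rewrite ler_peMr // bump_ge1.
by rewrite f0 // normr0 mulr_ge0 // bump_ge0.
Qed.

(** Integrate 2 b u <= u^2 + b^2 over the support, then take b to be the integral of u divided by X,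
    the integral of the bump plus 1. The added 1 makes X positive. *)
Lemma cauchy_schwarz_off z r u : continuous u -> zero_off z r u ->
  integral_rV u ^+ 2 <= (integral_rV (bump 0 r) + 1) * integral_rV (fun x => u x ^+ 2).
Proof.
move=> cu u0.
have ccu : cc u by exact: cc_off u0.
have cu2 : cc (fun x => u x ^+ 2).
  apply: (@cc_off z r); last by move=> x /u0 ->; rewrite expr0n.
  by move=> x; apply: continuousM; exact: cu.
have X0 : 0 <= integral_rV (bump 0 r).
  by have := @norm_integral_off z r (fun=> 0) 1 (@cst_continuous _ _ 0);
    rewrite mul1r; move=> /(_ _ _)/(le_trans _); apply => // x; rewrite ?normr0.
set X := integral_rV (bump 0 r) + 1; have {}X0 : 0 < X by rewrite /X ltr_wpDl.
have key b : 2 * b * integral_rV u <= integral_rV (fun x => u x ^+ 2) + b ^+ 2 * X.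
  have le1 : 2 * b * integral_rV u <= integral_rV (fun x => u x ^+ 2) + b ^+ 2 * integral_rV (bump 0 r).
    have cb := cc_bump z r; have cb2 := cc_scale (b ^+ 2) cb.
    rewrite -(integral_bump z) -!integral_rVZ // -integral_rVD //.
    apply: le_integral_rV; [exact: cc_scale|exact: ccD|].
    move=> x; have [xr|xr] := leP `|x - z| r; last first.
      by rewrite u0 // mulr0 expr0n add0r mulr_ge0 ?sqr_ge0 ?bump_ge0.
    apply: (@le_trans _ _ (u x ^+ 2 + b ^+ 2)); last first.
      by rewrite lerD2l ler_peMr ?sqr_ge0 ?bump_ge1.
    rewrite -subr_ge0 (_ : _ - _ = (u x - b) ^+ 2) ?sqr_ge0 //; ring.
  by apply: le_trans le1 _; rewrite lerD2l ler_wpM2l ?sqr_ge0 // lerDl.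
have := key (integral_rV u / X).
set I := integral_rV u; set J := integral_rV _ => h.
rewrite mulrC -ler_pdivrMr //.
have E : 2 * (I / X) * I - (I / X) ^+ 2 * X = I ^+ 2 / X by field; rewrite gt_eqF.
by rewrite -E lerBlDr.
Qed.

End Support.

(** * Nonstationary phase and averaging over shifts *)

Section Oscillatory.
Variables (R : realType) (n : nat).
Implicit Types (a : 'rV[R]_n -> R) (Q : set 'rV[R]_n) (z : 'rV[R]_n).
Local Notation e_ i := (delta_mx 0 i : 'rV[R]_n).

Lemma continuous_cos_phase (G : 'rV[R]_n -> R) x mu theta :
  {for x, continuous G} -> {for x, continuous (fun x => cos (mu * G x + theta))}.
Proof.
move=> cG; apply: (@continuous_comp _ _ _ (fun x => mu * G x + theta) cos); last exact: continuous_cos.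
by apply: continuousD; [apply: continuousM => //|]; exact: cst_continuous.
Qed.

Lemma sin_cosB (t : R) : sin t = cos (t - pi / 2).
Proof. by rewrite cosBpihalf. Qed.

(** N integrations by parts in the coordinate j, each gaining 1 / mu and costing the amplitude one
    derivative. A step turns the cosine into a sine, that is, it shifts theta by pi / 2, so the
    induction is over all theta. *)
Lemma nonstationary N (M c A r : R) : 0 <= M -> 0 < c -> 0 <= A ->
  exists2 C, 0 <= C & forall z Q G a mu theta j, open Q ->
    (forall x, `|x - z| <= r -> Q x) ->
    (forall x, Q x -> {for x, continuous G} /\ derivable G x (e_ j)) ->
    Cb N M Q (partial j G) -> (forall x, Q x -> c <= `|partial j G x|) ->
    Cb N A setT a -> zero_off z r a -> 0 < mu ->
    `|integral_rV (fun x => cos (mu * G x + theta) * a x)| <= C / mu ^+ N.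
Proof.
move=> M0 c0; elim: N A => [|N IH] A A0.
  exists (A * integral_rV (bump (0 : 'rV[R]_n) r)).
    have := @norm_integral_off R n 0 r (fun=> 0) A (@cst_continuous _ _ 0).
    by move=> /(_ _ _)/(le_trans _); apply => // x; rewrite ?normr0.
  move=> z Q G a mu theta j oQ rQ hG _ _ ha a0 mu0; rewrite expr0 divr1.
  apply: (@norm_integral_off R n z).
  - apply: (continuous_mul_off rQ) a0.
      by move=> x Qx; apply: continuous_cos_phase; exact: (hG x Qx).1.
    by move=> x; exact: Cb_cts ha _.
  - by move=> x /a0 ->; rewrite mulr0.
  - move=> x; rewrite normrM (le_trans _ (Cb_norm ha (I : setT x))) // ler_piMl //.
    by rewrite ler_norml cos_geN1 cos_le1.
have [C1 C10 hC1] := @Cb_inv R n N.+1 M c c0.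
pose B := 2 ^+ N.+1 * (C1 * A).
have B0 : 0 <= B by rewrite !mulr_ge0 ?exprn_ge0.
have [C C0 hC] := IH B B0; exists C => //.
move=> z Q G a mu theta j oQ rQ hG hdG cG ha a0 mu0.
pose u x := (partial j G x)^-1 * a x.
have hu : Cb N.+1 B setT u.
  by apply: (Cb_mul_off oQ rQ) => //; exact: hC1.
have u0 : zero_off z r u by move=> x /a0; rewrite /u => ->; rewrite mulr0.
have du0 : zero_off z r (partial j u).
  move=> x xr; have := @partial_local R n u (fun=> 0) _ x j (@open_off R n z r) xr (fun y yr => u0 y yr).
  by move=> [_ ->]; rewrite /partial derive_cst.
have cu : continuous u by move=> x; exact: Cb_cts hu _.
have cdu : continuous (partial j u) by move=> x; exact: Cb_cts (hu.2 j).2 _.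
have ca : continuous a by move=> x; exact: Cb_cts ha _.
(* The derivative of [w] along j is [mu * F1 + F2]. Its integral vanishes, which expresses the
   integral of [F1] by that of [F2], whose amplitude is the derivative of [u]. *)
pose w x := cos (mu * G x + (theta - pi / 2)) * u x.
pose F1 x := cos (mu * G x + theta) * a x.
pose F2 x := cos (mu * G x + (theta - pi / 2)) * partial j u x.
have cct t b : continuous b -> zero_off z r b -> cc (fun x => cos (mu * G x + t) * b x).
  move=> cb b0; apply: (@cc_off _ _ z r); last by move=> x /b0 ->; rewrite mulr0.
  apply: (continuous_mul_off rQ) b0 => // x Qx.
  by apply: continuous_cos_phase; exact: (hG x Qx).1.
have dw x : is_derive x (e_ j) w (mu * F1 x + F2 x).
  have [xr|xr] := leP `|x - z| r; last first.
    have O := @open_off R n z r.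
    have w0 y : r < `|y - z| -> 0 = w y by move=> yr; rewrite /w u0 ?mulr0.
    rewrite /F1 /F2 a0 // du0 // !mulr0 addr0.
    have [D1 D2] := partial_local j O xr w0.
    split; first by apply: D1; exact: derivable_cst.
    by rewrite -/(partial j w x) -D2 /partial derive_cst.
  have Qx := rQ _ xr; have [cGx dGx] := hG x Qx.
  have dGj : partial j G x != 0 by rewrite -normr_gt0 (lt_le_trans c0) // cG.
  have d1 : is_derive x (e_ j) (fun x => mu * G x + (theta - pi / 2)) (mu * partial j G x).
    have dG := derivableP dGx.
    by apply: is_derive_eq; rewrite addr0.
  have d2 : is_derive x (e_ j) (fun x => cos (mu * G x + (theta - pi / 2)))
      (- sin (mu * G x + (theta - pi / 2)) * (mu * partial j G x)).
    exact: (@is_derive_comp1 R _ cos _ x (e_ j) _ _ (is_derive_cos _) d1).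
  have d3 : is_derive x (e_ j) u (partial j u x).
    by apply: derivableP; exact: (hu.2 j).1.
  apply: is_derive_eq; rewrite /F1 /F2 /u.
  have -> : cos (mu * G x + theta) = - sin (mu * G x + (theta - pi / 2)).
    by rewrite addrA sinBpihalf opprK.
  set X := mu * G x + _.
  change (cos X * partial j u x + ((partial j G x)^-1 * a x) * (- sin X * (mu * partial j G x))
     = mu * (- sin X * a x) + cos X * partial j u x).
  by field.
have int0 : integral_rV (fun x => mu * F1 x + F2 x) = 0.
  have E : (fun x => mu * F1 x + F2 x) = partial j w.
    by apply/funext => x; rewrite /partial; have [_ ->] := dw x.
  rewrite E; apply: integral_rV_partial.
  - exact: cct.
  - by move=> x; have [] := dw x.
  - by rewrite -E; apply: ccD; [apply: cc_scale; exact: cct|exact: cct].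
rewrite integral_rVD ?integral_rVZ in int0; [|exact: cct|by apply: cc_scale; exact: cct|exact: cct].
have {int0} E : integral_rV F1 = - mu^-1 * integral_rV F2.
  move/eqP: int0; rewrite addr_eq0 => /eqP h.
  by rewrite mulNr -mulrN -h mulKf ?gt_eqF.
rewrite -/F1 E normrM normrN normfV (gtr0_norm mu0) exprS invfM mulrCA ler_pM2l ?invr_gt0 //.
apply: (hC z Q G _ mu _ j) => //.
- exact: CbS.
- exact: (hu.2 j).2.
Qed.

(** The function x / (1 + |x|) has slope (1 + |x|)^-2, and twice its increment from l - k to l + 1 -
    k dominates the term at l. The sum telescopes, and the function has values in [-1, 1]: hence 2
    times 2. *)
Lemma sum_inv_sqr (k L : nat) :
  \sum_(l < L) (1 + `|k%:R - l%:R : R|) ^- 2 <= 4.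
Proof.
pose F (x : R) := x / (1 + `|x|).
have F1 x : `|F x| <= 1.
  by rewrite /F normrM normfV (@ger0_norm _ (1 + _)) ?addr_ge0 // ler_pdivrMr ?ltr_wpDr // mul1r lerDr.
have step (l : nat) : (1 + `|k%:R - l%:R : R|) ^- 2 <= 2 * (F (l.+1%:R - k%:R) - F (l%:R - k%:R)).
  have [kl|lk] := leqP k l.
    rewrite distrC -!natrB // ?leqW // subSn // /F !ger0_norm //.
    move: (l - k)%N => d.
    rewrite -subr_ge0 -(natr1 d).
    have -> : 2 * ((d%:R + 1) / (1 + (d%:R + 1)) - d%:R / (1 + d%:R)) - (1 + d%:R) ^- 2 =
      d%:R / ((1 + d%:R) ^+ 2 * (2 + d%:R)) :> R.
      have d0 : 0 <= d%:R :> R by []. 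
      by field; rewrite !gt_eqF // ?addrA; lra.
    by rewrite divr_ge0 // mulr_ge0 ?addr_ge0 ?exprn_ge0 // addr_ge0.
  rewrite -natrB 1?ltnW // (_ : l%:R - k%:R = - (k - l)%:R); last by rewrite natrB ?opprB // ltnW.
  rewrite (_ : l.+1%:R - k%:R = - (k - l.+1)%:R); last by rewrite natrB ?opprB.
  rewrite /F !normrN !ger0_norm // subnS.
  have : (0 < k - l)%N by rewrite subn_gt0.
  case: (k - l)%N => // d _ /=; rewrite -subr_ge0 -(natr1 d).
  have d0 : 0 <= d%:R :> R by [].
  have -> : 2 * (- d%:R / (1 + d%:R) - - (d%:R + 1) / (1 + (d%:R + 1))) - (1 + (d%:R + 1)) ^- 2
    = (3 + d%:R) / ((1 + d%:R) * (2 + d%:R) ^+ 2) :> R.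
    by field; rewrite !gt_eqF // ?addrA; lra.
  by rewrite divr_ge0 // ?mulr_ge0 ?addr_ge0 ?exprn_ge0 ?addr_ge0.
apply: (@le_trans _ _ (\sum_(l < L) 2 * (F (l.+1%:R - k%:R) - F (l%:R - k%:R)))).
  by apply: ler_sum => l _; exact: step.
rewrite -mulr_sumr -(big_mkord xpredT (fun l => F (l.+1%:R - k%:R) - F (l%:R - k%:R))).
rewrite (telescope_sumr (fun l => F (l%:R - k%:R))) //.
have := F1 (L%:R - k%:R); have := F1 (0%:R - k%:R); rewrite !ler_norml; lra.
Qed.

Lemma sum_inv_sqr_prod (m L : nat) (k : {ffun 'I_m -> 'I_L}) :
  \sum_(l : {ffun 'I_m -> 'I_L}) \prod_i (1 + `|(k i)%:R - (l i)%:R : R|) ^- 2 <= 4 ^+ m.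
Proof.
rewrite -(bigA_distr_bigA (fun i (l : 'I_L) => (1 + `|(k i)%:R - l%:R : R|) ^- 2)).
rewrite -[m in leRHS]card_ord -prodr_const; apply: ler_prod => i _.
by rewrite sum_inv_sqr andbT sumr_ge0 // => l _; rewrite invr_ge0 exprn_ge0 ?addr_ge0.
Qed.

(* Averaging over the shifts [v k] and Cauchy-Schwarz: the differenced phases
   no longer see the linear part of [phi]. *)
Lemma van_der_corput (K : finType) (v : K -> 'rV[R]_n) z d Q phi a (L theta : R) :
  (forall x, `|x - z| <= d -> Q x) -> (forall x, Q x -> {for x, continuous phi}) ->
  continuous a -> zero_off z d a -> (forall k, `|v k| <= d) ->
  (#|K|%:R * integral_rV (fun x => cos (L * phi x + theta) * a x)) ^+ 2 <=
  (integral_rV (bump (0 : 'rV[R]_n) (2 * d)) + 1) *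
  \sum_k \sum_l `|integral_rV (fun x =>
     cos (L * (phi (x + v k) - phi (x + v l))) * (a (x + v k) * a (x + v l)))|.
Proof.
move=> dQ cphi ca a0 vd.
pose F (t : R) (x : 'rV[R]_n) : R := cos (L * phi x + t) * a x.
have cF t : continuous (F t).
  apply: (continuous_mul_off dQ) a0 => // x Qx; apply: continuous_cos_phase; exact: cphi.
have F0 t : zero_off z d (F t) by move=> x /a0; rewrite /F => ->; rewrite mulr0.
have ccF t : cc (F t) by exact: cc_off (F0 t).
have ccFs t k : cc (fun x => F t (x + v k)) by exact: cc_shift.
have ccFF t k l : cc (fun x => F t (x + v k) * F t (x + v l)).
  exact: ccM.
pose u (t : R) (x : 'rV[R]_n) : R := \sum_k F t (x + v k).
have Iu t : integral_rV (u t) = #|K|%:R * integral_rV (F t).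
  rewrite integral_rV_sum //; under eq_bigr do rewrite integral_rV_shift //.
  by rewrite sumr_const [RHS]mulr_natl.
rewrite -/(F theta) -Iu.
have ccu t : cc (u t) by exact: cc_sum.
have u0 t : zero_off z (2 * d) (u t).
  move=> x h; rewrite /u big1 // => k _; apply: F0.
  have := vd k => vk; have : `|x - z| <= `|x + v k - z| + `|v k|.
    by rewrite -{1}[x](addrK (v k)) addrAC ler_normB.
  have aux (p q w : R) : 2 * d < p -> w <= d -> p <= q + w -> d < q by lra.
  exact: aux h vk.
apply: le_trans (cauchy_schwarz_off (ccu theta).1 (u0 theta)) _.
have X0 : 0 <= integral_rV (bump (0 : 'rV[R]_n) (2 * d)) + 1.
  rewrite addr_ge0 //.
  have := @norm_integral_off R n z (2 * d) (fun=> 0) 1 (@cst_continuous _ _ 0).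
  by rewrite mul1r; move=> /(_ _ _)/(le_trans _); apply => // x; rewrite ?normr0.
rewrite ler_wpM2l //.
have ccu2 t : cc (fun x => u t x ^+ 2).
  by under eq_fun do rewrite expr2; exact: ccM.
have u2E t x : u t x ^+ 2 = \sum_k \sum_l F t (x + v k) * F t (x + v l).
  by rewrite expr2 /u mulr_suml; apply: eq_bigr => k _; rewrite mulr_sumr.
(* Adding the square for the phase shifted by pi / 2 can only increase the bound, and it makes cos P
   cos P' + sin P sin P' = cos(P - P') appear, where theta cancels. *)
pose theta' := theta - pi / 2.
apply: (@le_trans _ _ (integral_rV (fun x => u theta x ^+ 2 + u theta' x ^+ 2))).
  apply: le_integral_rV => //; first exact: ccD.
  by move=> x; rewrite lerDl sqr_ge0.
have E : (fun x => u theta x ^+ 2 + u theta' x ^+ 2) = (fun x => \sum_k \sum_l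
    (F theta (x + v k) * F theta (x + v l) + F theta' (x + v k) * F theta' (x + v l))).
  apply/funext => x; rewrite !u2E -big_split; apply: eq_bigr => k _.
  by rewrite -big_split.
rewrite E integral_rV_sum; last by move=> k; apply: cc_sum => l; exact: ccD.
apply: ler_sum => k _; rewrite integral_rV_sum; last by move=> l; exact: ccD.
apply: ler_sum => l _; apply: le_trans (ler_norm _) _.
rewrite le_eqVlt; apply/orP; left; apply/eqP; congr (`|integral_rV _|); apply/funext => x.
rewrite /F /theta' !addrA !cosBpihalf.
set P := L * phi (x + v k) + theta; set P' := L * phi (x + v l) + theta.
have -> : L * (phi (x + v k) - phi (x + v l)) = P - P' by rewrite /P /P'; ring.
by rewrite cosB; ring.
Qed.

(** Divided by D = tau |g|, the differenced phase has gradient close to g E H / |g|, some coordinate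
    of which is at least c in absolute value. The variation of the Hessian is at most c / (2 n m)
    per entry and |v - v'| <= m D, so the error is at most n m c / (2 n m) = c / 2. Then
    [nonstationary] applies with mu = L D and 2 m integrations by parts. *)
Lemma pair_estimate (m : nat) (M A c d : R) : (0 < m)%N -> 0 <= M -> 0 < c -> 0 <= A -> 0 < d ->
  exists2 C, 0 <= C & forall z phi a (H : 'M[R]_n) (E : 'M[R]_(m, n)) (g : 'rV[R]_m)
     (v v' : 'rV[R]_n) (tau L : R), 0 < tau -> 0 < L ->
    (forall x, box z (4 * d) x -> {for x, continuous phi} /\ forall i,
      [/\ derivable phi x (e_ i), {for x, continuous (partial i phi)} &
          forall j, derivable (partial i phi) x (e_ j) /\
            `|partial j (partial i phi) x - H j i| * (2 * n%:R * m%:R) <= c]) ->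
    (forall i j, Cb (2 * m) M (box z (4 * d)) (partial j (partial i phi))) ->
    (forall g : 'rV[R]_m, `|g *m E| <= m%:R * `|g|) ->
    (forall h : 'rV[R]_m, c * `|h| <= `|h *m E *m H|) ->
    Cb (2 * m) A setT a -> zero_off z d a ->
    `|v| <= d -> `|v'| <= d -> v - v' = tau *: (g *m E) -> 0 < `|g| ->
    `|integral_rV (fun x => cos (L * (phi (x + v) - phi (x + v'))) * (a (x + v) * a (x + v')))| <=
     C / (L * (tau * `|g|)) ^+ (2 * m).
Proof.
move=> m0 M0 c0 A0 d0.
have m0R : 0 < m%:R :> R by rewrite ltr0n.
pose A2 := 2 ^+ (2 * m) * (A * A).
have A20 : 0 <= A2 by rewrite !mulr_ge0 ?exprn_ge0.
have nM0 : 0 <= n%:R * M * m%:R by rewrite !mulr_ge0.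
have [C C0 hC] := @nonstationary (2 * m) (n%:R * M * m%:R) (c / 2) A2 (2 * d) nM0 (divr_gt0 c0 (ltr0Sn R 1)) A20.
exists C => // z phi a H E g v v' tau L tau0 L0 hphi hM hE hH ha a0 vd v'd vv' g0.
pose D := tau * `|g|; have D0 : 0 < D by rewrite mulr_gt0.
have vD : `|v - v'| <= m%:R * D.
  by rewrite vv' normrZ gtr0_norm // /D mulrCA ler_pM2l.
(* The coordinate j is read off from the fixed matrix H, so the same direction of integration by
   parts serves on the whole box. *)
have [j hj] : exists j, c * `|g| <= `|(g *m E *m H) 0 j|.
  apply: contrapT => /forallNP hj; have := hH g; rewrite leNgt => /negP; apply.
  apply/norm_rV_lt; first by rewrite mulr_gt0.
  by move=> i; rewrite ltNge; apply/negP; exact: hj.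
have n0R : 0 < n%:R :> R by rewrite ltr0n (leq_ltn_trans _ (ltn_ord j)).
have sh (x w : 'rV[R]_n) : `|w| <= d -> box z (3 * d) x -> box z (4 * d) (x + w).
  move=> wd; rewrite /box /= => xz; rewrite addrAC (le_lt_trans (ler_normD _ _)) //.
  have aux (p q : R) : p < 3 * d -> q <= d -> p + q < 4 * d by lra.
  exact: aux.
have shift_der (f : 'rV[R]_n -> R) (w x : 'rV[R]_n) i : `|w| <= d -> box z (3 * d) x ->
    (forall x, box z (4 * d) x -> derivable f x (e_ i)) ->
    is_derive x (e_ i) (fun x : 'rV[R]_n => f (x + w)) (partial i f (x + w)).
  move=> wd xz df.
  have := @is_derive_scaled R _ f x (e_ i) w 1 (partial i f (x + w)).
  rewrite mul1r scale1r; under eq_fun do rewrite scale1r; apply.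
  by apply: derivableP; exact/df/sh.
pose G (x : 'rV[R]_n) : R := D^-1 * (phi (x + v) - phi (x + v')).
have dG x : box z (3 * d) x -> is_derive x (e_ j) G (D^-1 * (partial j phi (x + v) - partial j phi (x + v'))).
  move=> xz.
  have dphi y : box z (4 * d) y -> derivable phi y (e_ j) by move=> hy; have [_ /(_ j)[]] := hphi y hy.
  have d1 := shift_der phi v x j vd xz dphi; have d2 := shift_der phi v' x j v'd xz dphi.
  exact: is_deriveZ.
have e3 : 4 * d - d = 3 * d by ring.
have hdG : Cb (2 * m) (n%:R * M * m%:R) (box z (3 * d)) (partial j G).
  apply: (@Cb_ext _ _ _ _ _ (fun x => D^-1 * (partial j phi (x + v) - partial j phi (x + v')))).
  - exact: open_box.
  - by move=> x xz; rewrite /partial; have [_ ->] := dG x xz.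
  apply: (@Cb_le _ _ _ (`|D^-1| * (n%:R * M * `|v - v'|))).
    rewrite normfV gtr0_norm // mulrC ler_pdivrMr // -!mulrA; do 2! apply: ler_wpM2l => //.
  apply: Cb_scale; first exact: open_box.
  rewrite -e3; apply: Cb_shift_diff => //.
    move=> x xz; have [_ /(_ j)[_ h1 h2]] := hphi x xz; split=> [|i]; [exact: h1|exact: (h2 i).1].
have lowG x : box z (3 * d) x -> c / 2 <= `|partial j G x|.
  move=> xz; rewrite /partial; have [_ ->] := dG x xz.
  rewrite normrM normfV (gtr0_norm D0) ler_pdivlMl // [D * _]mulrC.
  have := @mvt_coord R n (partial j phi) z (4 * d) (fun i => H i j) (c / (2 * n%:R * m%:R)) (x + v) (x + v').
  rewrite (_ : x + v - (x + v') = v - v'); last by rewrite opprD addrACA subrr add0r.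
  have -> : \sum_i H i j * ((x + v) 0 i - (x + v') 0 i) = tau * (g *m E *m H) 0 j.
    rewrite mxE mulr_sumr; apply: eq_bigr => i _.
    have := congr1 (fun w : 'rV[R]_n => w 0 i) vv'; rewrite !mxE => vi.
    have -> : x 0 i + v 0 i - (x 0 i + v' 0 i) = v 0 i - v' 0 i by ring.
    by rewrite vi; ring.
  have hyp : forall x : 'rV[R]_n, `|x - z| < 4 * d -> forall i, derivable (partial j phi) x (e_ i) /\
      `|partial i (partial j phi) x - H i j| <= c / (2 * n%:R * m%:R).
    move=> y yz i; have [_ /(_ j)[_ _ /(_ i)[h1 h2]]] := hphi y yz.
    by split=> //; rewrite ler_pdivlMr // !mulr_gt0.
  move=> /(_ hyp (sh _ _ vd xz) (sh _ _ v'd xz)).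
  set P := _ - partial j phi _; set S := tau * _ => hP.
  have hS : c * D <= `|S|.
    by rewrite /S normrM (gtr0_norm tau0) /D mulrCA ler_pM2l.
  have hP2 : `|P - S| <= c / 2 * D.
    apply: le_trans hP _.
    apply: (@le_trans _ _ (n%:R * (c / (2 * n%:R * m%:R)) * (m%:R * D))).
      by rewrite ler_wpM2l // mulr_ge0 // divr_ge0 ?mulr_ge0 // ltW.
    rewrite le_eqVlt; apply/orP; left; apply/eqP; field.
    by rewrite !gt_eqF.
  have : `|S| <= `|P| + `|P - S| by rewrite -{1}[S](subKr P) ler_normB.
  move: hS hP2; move: `|P| `|S| `|P - S| => p s q.
  have -> : c / 2 * D = (c * D) / 2 by ring.
  move: (c * D) => t; lra.
have haa : Cb (2 * m) A2 setT (fun x : 'rV[R]_n => a (x + v) * a (x + v')).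
  have sa w : Cb (2 * m) A setT (fun x : 'rV[R]_n => a (x + w)).
    have := @Cb_affine R n (2 * m) A setT a 1 w openT A0; rewrite ler01 lexx => /(_ isT ha).
    by under [X in Cb _ _ _ X]eq_fun do rewrite scale1r.
  by apply: Cb_mul => //; exact: openT.
have aa0 : zero_off z (2 * d) (fun x : 'rV[R]_n => a (x + v) * a (x + v')).
  move=> x h; rewrite a0 ?mul0r //.
  have : `|x - z| <= `|x + v - z| + `|v| by rewrite -{1}[x](addrK v) addrAC ler_normB.
  have aux (p q w : R) : 2 * d < p -> w <= d -> p <= q + w -> d < q by lra.
  exact: aux h vd.
have muE : (fun x : 'rV[R]_n => cos (L * (phi (x + v) - phi (x + v'))) * (a (x + v) * a (x + v'))) =
    (fun x : 'rV[R]_n => cos ((L * D) * G x + 0) * (a (x + v) * a (x + v'))).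
  apply/funext => x; congr (cos _ * _); rewrite /G addr0 -mulrA; congr (_ * _).
  by rewrite mulrA mulfV ?gt_eqF // mul1r.
rewrite muE; apply: (hC z (box z (3 * d)) G _ (L * D) 0 j) => //.
- exact: open_box.
- by move=> x h; rewrite /box /=; apply: le_lt_trans h _; rewrite ltr_pM2r // ltr_nat.
- move=> x xz; split; last by have [] := dG x xz.
  have cs (w : 'rV[R]_n) : continuous (fun x : 'rV[R]_n => x + w : 'rV[R]_n).
    by apply: (@lipschitz_continuous _ _ _ _ 1) => y y'; rewrite opprD addrACA subrr addr0 mul1r.
  have cp w : `|w| <= d -> {for x, continuous (fun x : 'rV[R]_n => phi (x + w))}.
    by move=> wd; apply: continuous_comp; [exact: cs|exact: (hphi _ (sh _ _ wd xz)).1].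
  apply: continuousM; first exact: cst_continuous.
  by apply: continuousB; exact: cp.
- exact: mulr_gt0.
Qed.

(** The L^m shifts form a grid of step tau = d / (m L) in the m good directions. The pair (k, l)
    contributes at most a multiple of the product of the (1 + |k_s - l_s|)^-2, which is summable in
    l; this is why 2 m integrations by parts are made. The double sum is thus O(L^m), against L^(2m)
    in front of the squared integral. *)
Lemma cell_estimate (m : nat) (M A c d : R) : (0 < m)%N -> 0 <= M -> 0 < c -> 0 <= A -> 0 < d ->
  exists2 C, 0 <= C & forall z phi a (H : 'M[R]_n) (E : 'M[R]_(m, n)) (L : nat) theta,
    (0 < L)%N ->
    (forall x, box z (4 * d) x -> {for x, continuous phi} /\ forall i,
      [/\ derivable phi x (e_ i), {for x, continuous (partial i phi)} &
          forall j, derivable (partial i phi) x (e_ j) /\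
            `|partial j (partial i phi) x - H j i| * (2 * n%:R * m%:R) <= c]) ->
    (forall i j, Cb (2 * m) M (box z (4 * d)) (partial j (partial i phi))) ->
    (forall s i, `|E s i| <= 1) -> (forall h : 'rV[R]_m, c * `|h| <= `|h *m E *m H|) ->
    Cb (2 * m) A setT a -> zero_off z d a ->
    integral_rV (fun x => cos (L%:R * phi x + theta) * a x) ^+ 2 <= C / L%:R ^+ m.
Proof.
move=> m0 M0 c0 A0 d0.
have m0R : 0 < m%:R :> R by rewrite ltr0n.
have [C1 C10 hC1] := @pair_estimate m M A c d m0 M0 c0 A0 d0.
pose X := integral_rV (bump (0 : 'rV[R]_n) (2 * d)).
have X0 : 0 <= X.
  have := @norm_integral_off R n 0 (2 * d) (fun=> 0) 1 (@cst_continuous _ _ 0).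
  by rewrite mul1r; move=> /(_ _ _)/(le_trans _); apply => // x; rewrite ?normr0.
pose C2 := A * A * X + C1 * (m%:R / d * 2) ^+ (2 * m).
have md0 : 0 <= m%:R / d by rewrite divr_ge0 // ltW.
have C20 : 0 <= C2 by apply: addr_ge0; apply: mulr_ge0 => //; [exact: mulr_ge0|apply: exprn_ge0; exact: mulr_ge0].
exists ((X + 1) * C2 * 4 ^+ m); first by apply: mulr_ge0; [apply: mulr_ge0 => //; exact: addr_ge0|exact: exprn_ge0].
move=> z phi a H E L theta L0 hphi hM hE hH ha a0.
have L0R : 0 < L%:R :> R by rewrite ltr0n.
pose K : finType := {ffun 'I_m -> 'I_L}.
pose tau : R := d / (m%:R * L%:R).
have tau0 : 0 < tau by rewrite divr_gt0 ?mulr_gt0.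
pose h (k : K) : 'rV[R]_m := \row_s (k s)%:R.
pose v (k : K) : 'rV[R]_n := tau *: (h k *m E).
have hE_le (g : 'rV[R]_m) : `|g *m E| <= m%:R * `|g|.
  apply/norm_rV_le => [|i]; first by rewrite mulr_ge0.
  have -> : m%:R * `|g| = \sum_(s < m) `|g| by rewrite sumr_const card_ord mulr_natl.
  rewrite mxE.
  apply: le_trans (ler_norm_sum _ _ _) _; apply: ler_sum => s _.
  by rewrite normrM -[leRHS]mulr1 ler_pM // coord_le_norm.
have vd k : `|v k| <= d.
  rewrite /v normrZ gtr0_norm //.
  have hL : `|h k| <= L%:R.
    by apply/norm_rV_le => // s; rewrite mxE normr_nat ler_nat ltnW.
  apply: (@le_trans _ _ (tau * (m%:R * L%:R))); last by rewrite /tau divfK // mulf_neq0 ?gt_eqF.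
  rewrite ler_pM2l //; apply: le_trans (hE_le _) _; by rewrite ler_pM2l.
have vE k l : v k - v l = tau *: ((h k - h l) *m E) by rewrite /v -scalerBr mulmxBl.
have boxd r : r < 4 * d -> forall x : 'rV[R]_n, `|x - z| <= r -> box z (4 * d) x.
  by move=> r4 x h1; rewrite /box /=; apply: le_lt_trans r4.
have vdc := @van_der_corput K v z d (box z (4 * d)) phi a L%:R theta (boxd d _) (fun x hx => (hphi x hx).1) _ a0 vd.
have ca : continuous a by move=> x; exact: Cb_cts ha _.
have {}vdc := vdc _ ca.
have d4 : d < 4 * d by rewrite -{1}[d]mul1r ltr_pM2r // ltr1n.
have {}vdc := vdc d4.
pose T k l := integral_rV (fun x => cos (L%:R * (phi (x + v k) - phi (x + v l))) * (a (x + v k) * a (x + v l))).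
have key k l : `|T k l| <= C2 * \prod_s (1 + `|(k s)%:R - (l s)%:R : R|) ^- 2.
  pose g := h k - h l.
  have gE s : g 0 s = (k s)%:R - (l s)%:R by rewrite !mxE.
  (* On the diagonal there is no oscillation, and the size of the amplitude and of its support is
     all that counts. *)
  have [kl|kl] := eqVneq k l.
    rewrite kl big1 ?mulr1; last by move=> s _; rewrite subrr normr0 addr0 expr1n invr1.
    apply: (@le_trans _ _ (A * A * X)); last first.
      by rewrite /C2 lerDl; apply: mulr_ge0 => //; apply: exprn_ge0; exact: mulr_ge0.
    have cav w : continuous (fun x : 'rV[R]_n => a (x + w)).
      exact: (cc_shift w (cc_off ca a0)).1.
    apply: (@norm_integral_off R n z).
    - under eq_fun do rewrite subrr mulr0 cos0 mul1r.
      by move=> x; apply: continuousM; exact: cav.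
    - move=> x hx; rewrite [a (x + v l)]a0 ?mulr0 //.
      have := vd l => vl; have : `|x - z| <= `|x + v l - z| + `|v l|.
        by rewrite -{1}[x](addrK (v l)) addrAC ler_normB.
      have aux (p q w : R) : 2 * d < p -> w <= d -> p <= q + w -> d < q by lra.
      exact: aux hx vl.
    - move=> x; rewrite subrr mulr0 cos0 mul1r normrM.
      by rewrite ler_pM // (Cb_norm ha).
  have g1 : 1 <= `|g|.
    have [s ks] : exists s, k s != l s.
      apply: contrapT => /forallNP hs; move/eqP: kl; apply; apply/ffunP => s.
      by apply/eqP/negPn/negP; exact: hs.
    apply: le_trans (coord_le_norm g s); rewrite gE.
    have [lt|lt|e] := ltngtP (k s) (l s); last by rewrite (val_inj e) eqxx in ks.
      by rewrite distrC -natrB ?(ltnW lt) // normr_nat ler1n subn_gt0.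
    by rewrite -natrB ?(ltnW lt) // normr_nat ler1n subn_gt0.
  have g0 : 0 < `|g| by exact: lt_le_trans g1.
  apply: le_trans (hC1 z phi a H E g (v k) (v l) tau L%:R _ _ _ _ _ _ _ _ _ _ _ _) _ => //.
  (* L tau = d / m is free of L. The factor 2 prepares 1 + |k_s - l_s| <= 2 |g|, which holds because
     |g| >= 1. *)
  have -> : L%:R * (tau * `|g|) = (m%:R / d * 2)^-1 * (2 * `|g|).
    by rewrite /tau; field; rewrite !gt_eqF.
  rewrite exprMn invfM exprVn invrK mulrA.
  apply: (@le_trans _ _ (C1 * (m%:R / d * 2) ^+ (2 * m) * \prod_s (1 + `|(k s)%:R - (l s)%:R : R|) ^- 2)); last first.
    apply: ler_wpM2r; last by rewrite /C2 lerDr; apply: mulr_ge0 => //; exact: mulr_ge0.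
    by apply: prodr_ge0 => s _; rewrite invr_ge0 exprn_ge0 // addr_ge0.
  apply: ler_wpM2l; first by apply: mulr_ge0 => //; apply: exprn_ge0; exact: mulr_ge0.
  rewrite prodfV lef_pV2 ?posrE ?exprn_gt0 ?mulr_gt0 //; last first.
    by rewrite prodr_gt0 // => s _; rewrite exprn_gt0 // ltr_wpDr.
  have -> : (2 * `|g|) ^+ (2 * m) = \prod_(s < m) (2 * `|g|) ^+ 2.
    by rewrite prodr_const card_ord exprM.
  apply: ler_prod => s _.
  rewrite exprn_ge0 ?addr_ge0 //= lerXn2r ?nnegrE ?addr_ge0 ?mulr_ge0 //.
  have := coord_le_norm g s; rewrite gE; move: g1.
  by move: `|g| `|(k s)%:R - (l s)%:R : R| => p q; lra.
have cardK : #|K| = (L ^ m)%N by rewrite card_ffun !card_ord.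
rewrite exprMn cardK natrX in vdc.
have sumT : \sum_k \sum_l `|T k l| <= L%:R ^+ m * (C2 * 4 ^+ m).
  rewrite -natrX -cardK mulr_natl -sumr_const; apply: ler_sum => k _.
  apply: (@le_trans _ _ (\sum_(l : K) C2 * \prod_s (1 + `|(k s)%:R - (l s)%:R : R|) ^- 2)).
    by apply: ler_sum => l _; exact: key.
  by rewrite -mulr_sumr; apply: ler_wpM2l => //; exact: sum_inv_sqr_prod.
have Lm0 : 0 < L%:R ^+ m :> R by rewrite exprn_gt0.
rewrite ler_pdivlMr //.
rewrite -(ler_pM2l Lm0).
have h1 := le_trans vdc (ler_wpM2l (addr_ge0 X0 ler01) sumT).
set I := integral_rV _ in h1 *.
have -> : L%:R ^+ m * (I ^+ 2 * L%:R ^+ m) = (L%:R ^+ m) ^+ 2 * I ^+ 2 by ring.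
apply: le_trans h1 _; rewrite le_eqVlt; apply/orP; left; apply/eqP; rewrite -/X; ring.
Qed.

End Oscillatory.

(** * Polynomial images and symmetric matrices of low rank *)

Section Grid.
Variable R : realType.

Local Notation msize p := (@mmeasure _ _ mdeg p).

(** Every exponent of a monomial of degree below k is itself below k. This crude count has the
    growth in k that the grid argument needs. *)
Lemma card_bmultinom_le (a k : nat) : (#|{: bmultinom a k}| <= k ^ a)%N.
Proof.
case: k => [|k].
  by rewrite (@eq_card0 _ {: bmultinom a 0}) // => m; have := bmdeg m.
pose f (m : bmultinom a k.+1) : {ffun 'I_a -> 'I_k.+1} := [ffun i => inord (bmnm m i)].
have f_inj : injective f.
  move=> m1 m2 e; apply/val_inj; apply/mnmP => i.
  have := congr1 (fun h : {ffun 'I_a -> 'I_k.+1} => val (h i)) e.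
  have lt (m : bmultinom a k.+1) : (bmnm m i < k.+1)%N.
    apply: leq_ltn_trans (bmdeg m); rewrite mdegE.
    by rewrite (bigD1 i) //= leq_addr.
  by rewrite /= !ffunE !inordK.
by have := leq_card f f_inj; rewrite card_ffun !card_ord.
Qed.

Lemma msize_prod_le (a d : nat) (I : Type) (r : seq I) (P : pred I) (F : I -> mpoly a R) :
  (forall i, (msize (F i) <= d)%N) ->
  (msize (\prod_(i <- r | P i) F i) <= size r * d.+1 + 1)%N.
Proof.
move=> hF; elim: r => [|i r IH]; first by rewrite big_nil msize1.
rewrite big_cons; case: (P i).
  apply: leq_trans (msizeM_le _ _) _; rewrite /= mulSn -addnA -addSn.
  exact: leq_add (hF i) IH.
by apply: leq_trans IH _; rewrite /= mulSn -addnA leq_addl.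
Qed.

Lemma size_index_enum_card (T : finType) : size (index_enum T) = #|T|.
Proof.
rewrite -(card_uniqP (index_enum_uniq T)); apply: eq_card => x.
by rewrite mem_index_enum.
Qed.

Lemma wide_matrix_kernel (N C : nat) (W : 'M[R]_(N, C)) : (C < N)%N ->
  exists2 w : 'rV[R]_N, w != 0 & w *m W = 0.
Proof.
move=> CN; apply: contrapT => h.
have : row_free W.
  apply: inj_row_free => w wW; apply/eqP/negPn/negP => w0; apply: h.
  by exists w.
by move=> /eqP rW; have := rank_leq_col W; rewrite rW leqNgt CN.
Qed.

(* Otherwise every point of a fine grid is a value of one of the maps; the
   polynomials obtained by composing the Lagrange basis of the grid with these
   maps are then independent, but there are too many of them. *)
Lemma grid_avoids_images (a : nat) (J ch : finType) (P : ch -> J -> mpoly a R) (eps : R) :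
  (a < #|J|)%N -> 0 < eps ->
  exists2 y : J -> R, (forall j, `|y j| < eps) &
    forall (c : ch) (t : 'I_a -> R), exists j, meval t (P c j) != y j.
Proof.
move=> aJ eps0; apply: contrapT => /forall2NP H.
pose d := (\max_c \max_j (msize (P c j))).+1.
have dP c j : (msize (P c j) <= d)%N.
  apply: leqW; apply: leq_trans (leq_bigmax c); exact: (leq_bigmax (F := fun j => msize (P c j))).
pose D := (#|J| * (d + 3) + 1)%N.
(* [D] is such that the polynomials [Q] below have size at most L D. The maps together then give at
   most [#|ch|] (L D)^a coefficients, and this L makes that number smaller than L^(a+1), hence than
   the number of grid points. *)
pose L := (#|ch| * D ^ a).+1.
pose g (l : 'I_L) : R := eps * l%:R / L%:R.
have L0 : 0 < L%:R :> R by rewrite ltr0n.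
have g_inj : injective g.
  move=> l l' /(congr1 (fun x => x * L%:R)); rewrite /g !divfK ?gt_eqF //.
  by move=> /mulfI; rewrite gt_eqF // => /(_ isT)/eqP; rewrite eqr_nat => /eqP/val_inj.
have g_small l : `|g l| < eps.
  rewrite /g ger0_norm ?divr_ge0 ?mulr_ge0 ?(ltW eps0) //.
  by rewrite ltr_pdivrMr // ltr_pM2l // ltr_nat.
pose K : finType := {ffun J -> 'I_L}.
have /choice[ct ctP] : forall k : K, exists ct : ch * ('I_a -> R), forall j, meval ct.2 (P ct.1 j) = g (k j).
  move=> k; have [|] := H (fun j => g (k j)); first by move=> h; case: h => j.
  move=> /existsNP[c /existsNP[t /forallNP h]]; exists (c, t) => j /=.
  by apply/eqP/negPn/negP; exact: h.
(* The Lagrange polynomial of the grid point k composed with the map c; at the parameters that reach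
   k' it equals 1 if k = k' and 0 otherwise. *)
pose Q c (k : K) : mpoly a R :=
  \prod_j \prod_(l | l != k j) ((g (k j) - g l)^-1 *: (P c j - mpolyC a (g l))).
have Qeval k k' : meval (ct k').2 (Q (ct k').1 k) = (k == k')%:R.
  rewrite /Q rmorph_prod; have [->|kk'] := eqVneq k k'.
    rewrite big1 // => j _; rewrite rmorph_prod big1 // => l lk.
    rewrite /= mevalZ mevalB mevalC ctP mulVf // subr_eq0; apply: contra lk.
    by move=> /eqP/g_inj ->.
  have [j kj] : exists j, k' j != k j.
    apply: contrapT => /forallNP h; move/eqP: kk'; apply; apply/ffunP => j.
    by apply/esym/eqP/negPn/negP; exact: h.
  rewrite (bigD1 j) //= rmorph_prod (bigD1 (k' j)) //=.
  by rewrite /= mevalZ mevalB mevalC ctP subrr mulr0 !mul0r.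
have Qsize c k : (msize (Q c k) <= L * D)%N.
  have h1 (j : J) (l : 'I_L) : (msize ((g (k j) - g l)^-1 *: (P c j - mpolyC a (g l))) <= d)%N.
    apply: leq_trans (msizeZ_le _ _) _; apply: leq_trans (mmeasureD_le _ _ _) _.
    by rewrite geq_max dP mmeasureN mmeasureC; case: (_ != 0).
  have h2 (j : J) : (msize (\prod_(l | l != k j) ((g (k j) - g l)^-1 *: (P c j - mpolyC a (g l))))
       <= L * d.+1 + 1)%N.
    by have := @msize_prod_le a d _ (index_enum 'I_L) (fun l => l != k j) _ (h1 j);
      rewrite size_index_enum_card card_ord.
  have := @msize_prod_le a _ _ (index_enum J) xpredT _ h2.
  rewrite size_index_enum_card => /leq_trans; apply.
  rewrite /D; nia.
pose C : finType := (ch * bmultinom a (L * D))%type.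
have cardC : (#|C| < #|K|)%N.
  rewrite card_prod card_ffun card_ord.
  apply: (@leq_ltn_trans (L ^ a * (#|ch| * D ^ a))).
    by rewrite mulnCA -expnMn leq_mul2l card_bmultinom_le orbT.
  apply: (@leq_trans (L ^ a.+1)); last by rewrite leq_pexp2l.
  by rewrite expnSr ltn_pmul2l ?expn_gt0.
pose W : 'M[R]_(#|K|, #|C|) := \matrix_(k, e)
  mcoeff (bmnm (enum_val e).2) (Q (enum_val e).1 (enum_val k)).
have [w w0 wW] := wide_matrix_kernel W cardC.
(* The same w gives a linear relation for every map c, so the relation can be evaluated in whichever
   map reaches a given grid point. *)
have lin c : \sum_(k : K) w 0 (enum_rank k) *: Q c k = 0.
  apply/mpolyP => m; rewrite mcoeff0 raddf_sum /=.
  have [mD|mD] := ltnP (mdeg m) (L * D); last first.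
    rewrite big1 // => k _; rewrite mcoeffZ memN_msupp_eq0 ?mulr0 //.
    by apply: msize_mdeg_ge; apply: leq_trans mD.
  have := congr1 (fun M : 'rV_#|C| => M 0 (enum_rank (c, BMultinom mD))) wW.
  rewrite !mxE (reindex (@enum_rank K)) /=; last by apply: onW_bij; exact: enum_rank_bij.
  move=> h; rewrite -[RHS]h; apply: eq_bigr => k _.
  by rewrite mcoeffZ mxE !enum_rankK.
move/negP: w0; apply; apply/eqP/rowP => i; rewrite mxE.
have := congr1 (meval (ct (enum_val i)).2) (lin (ct (enum_val i)).1).
rewrite meval0 raddf_sum /= (bigD1 (enum_val i)) //= big1 => [|k ki].
  by rewrite mevalZ Qeval eqxx mulr1 addr0 enum_valK.
by rewrite mevalZ Qeval (negPf ki) mulr0.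
Qed.

End Grid.

(** * Charts for symmetric matrices of low rank *)

Section SymmetricRank.

(* The identity in the columns [f s], [A] in the columns [g b]: up to a
   permutation of the columns, the echelon form of a matrix of full row rank. *)
Definition chart_mx (T : pzRingType) (n r c : nat) (f : {ffun 'I_r -> 'I_n})
    (g : {ffun 'I_c -> 'I_n}) (A : 'M[T]_(r, c)) : 'M[T]_(r, n) :=
  \matrix_(s, j) ((f s == j)%:R + \sum_b (g b == j)%:R * A s b).

(** The first r rows of [row_ebase H] span a space containing the rows of H, also when the rank is
    below r. Normalised to the identity on r columns they form M with H = Z M. If E selects these
    columns, then M E = 1, and symmetry gives Z = H E = M^T (Z^T E); hence S = Z^T E. *)
Lemma symmetric_rank_factor (F : fieldType) (n r c : nat) (H : 'M[F]_n) :
  n = (r + c)%N -> H^T = H -> (\rank H <= r)%N ->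
  exists f : {ffun 'I_r -> 'I_n}, exists g : {ffun 'I_c -> 'I_n},
  exists A : 'M[F]_(r, c), exists2 S : 'M[F]_r, S^T = S &
    H = (chart_mx f g A)^T *m S *m chart_mx f g A.
Proof.
move=> nrc Hsym rH.
have rn : (r <= n)%N by rewrite nrc leq_addr.
pose W : 'M[F]_(r, n) := pid_mx r *m row_ebase H.
pose X : 'M[F]_(n, r) := col_ebase H *m pid_mx (\rank H).
have HXW : H = X *m W.
  rewrite /X /W mulmxA -(mulmxA (col_ebase H)) mul_pid_mx.
  by rewrite (minn_idPl rH) (minn_idPr rH) mulmx_ebase.
have rW : \rank W = r.
  by rewrite /W mxrankMfree ?row_free_unit ?row_ebase_unit // rank_pid_mx.
have fW : row_full W^T by rewrite /row_full mxrank_tr rW.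
pose f := fullrankfun fW.
have f_inj : injective f by exact: fullrankfun_inj.
pose D : 'M[F]_r := (rowsub f W^T)^T.
have Du : D \in unitmx by rewrite unitmx_tr fullrowsub_unit.
pose M := invmx D *m W.
pose E : 'M[F]_(n, r) := \matrix_(j, s) (f s == j)%:R.
have mulE p (B : 'M[F]_(p, n)) i s : (B *m E) i s = B i (f s).
  rewrite mxE (bigD1 (f s)) //= mxE eqxx mulr1 big1 ?addr0 // => j js.
  by rewrite mxE eq_sym (negPf js) mulr0.
have ME : M *m E = 1%:M.
  rewrite -mulmxA (_ : W *m E = D) ?mulVmx //.
  by apply/matrixP => i s; rewrite mulE !mxE.
pose Z := X *m D.
have HZM : H = Z *m M by rewrite /Z /M mulmxA mulmxK.
pose S := Z^T *m E.
have ZS : Z = M^T *m S.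
  rewrite -[LHS]mulmx1 -ME mulmxA -HZM -Hsym HZM trmx_mul -mulmxA.
  by [].
have HS : H = M^T *m S *m M by rewrite -ZS.
have Ssym : S^T = S.
  have ES : S = E^T *m H *m E.
    rewrite [in RHS]HS (_ : _ *m E = (E^T *m M^T) *m S *m (M *m E)); last by rewrite !mulmxA.
    by rewrite -trmx_mul ME trmx1 mul1mx mulmx1.
  by rewrite ES !trmx_mul trmxK Hsym mulmxA.
pose nf : pred 'I_n := [predC codom f].
have cardC : #|nf| = c.
  have h := cardC [in codom f]; rewrite (card_codom f_inj) !card_ord in h.
  have /addnI <- : (r + #|[predC [in codom f]]|)%N = (r + c)%N by rewrite h.
  exact: eq_card.
pose g : {ffun 'I_c -> 'I_n} := [ffun b => enum_val (cast_ord (esym cardC) b)].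
have g_inj : injective g.
  by move=> b b'; rewrite !ffunE => /enum_val_inj/cast_ord_inj.
have gf b s : (g b == f s) = false.
  apply/negP => /eqP h.
  have : g b \notin codom f by rewrite ffunE; exact: enum_valP (cast_ord (esym cardC) b).
  by rewrite h codom_f.
exists f, g, (\matrix_(s, b) M s (g b)), S => //.
rewrite (_ : chart_mx _ _ _ = M) //; apply/matrixP => s j; rewrite mxE.
have [/codomP[s' ->]|jf] := boolP (j \in codom f).
  rewrite big1 => [|b _]; last by rewrite gf mul0r.
  have <- : (M *m E) s s' = M s (f s') by exact: mulE.
  by rewrite (inj_eq f_inj) addr0 ME mxE.
have [b ->] : exists b, j = g b.
  have jC : j \in nf by rewrite inE.
  exists (cast_ord cardC (enum_rank_in jC j)).
  by rewrite ffunE cast_ordK enum_rankK_in.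
rewrite eq_sym gf add0r (bigD1 b) //= eqxx mul1r mxE big1 ?addr0 // => b' b'b.
by rewrite (inj_eq g_inj) (negPf b'b) mul0r.
Qed.

Lemma card_leq_pairs m : #|{: {p : 'I_m * 'I_m | (p.1 <= p.2)%N}}| = 'C(m.+1, 2).
Proof.
rewrite card_sig -sum1_card /=.
rewrite (eq_bigl (fun p : 'I_m * 'I_m => true && (p.1 <= p.2)%N)) //.
rewrite -(pair_big_dep xpredT (fun i j : 'I_m => (i <= j)%N) (fun _ _ => 1%N)) /=.
rewrite (exchange_big_dep xpredT) //=.
rewrite -bin2_sum big_nat_recl // add0n big_mkord; apply: eq_bigr => j _.
by have /= <- := @big_ord_widen nat 0%N addn j.+1 m (fun=> 1%N) (ltn_ord j);
  rewrite sum1_card card_ord.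
Qed.

End SymmetricRank.

(** * A family of perturbations determined by its Hessians *)

Section CubicFamily.
Variables (R : realType) (n : nat) (i : 'I_n).

(* The Hessian at [x] of the cubic form [X_i * (1/2) sum_jk Y_jk X_j X_k]. *)
Definition hess_family (T : pzRingType) (Y : 'M[T]_n) (x : 'rV[T]_n) : 'M[T]_n :=
  let w := x *m Y in
  x 0 i *: Y + (delta_mx 0 i)^T *m w + w^T *m delta_mx 0 i.

(* On symmetric [Y], and when [x 0 i = 1], this recovers [Y] from its Hessian
   polynomially; [half] and [third] are arguments so that it also makes sense
   over a ring of polynomials. *)
Definition hess_family_inv (T : pzRingType) (half third : T) (K : 'M[T]_n) (x : 'rV[T]_n) : 'M[T]_n :=
  let u := x *m K in
  let w := half *: (u - (third * (u *m x^T) 0 0) *: delta_mx 0 i) in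
  K - (delta_mx 0 i)^T *m w - w^T *m delta_mx 0 i.

(** Let e be the i-th unit row, w = x Y and q = w x^T. As x_i = 1, the Hessian K satisfies x K = 2 w
    + q e and x K x^T = 3 q, from which q, then w, then Y are recovered. This is where one half and
    one third come from. *)
Lemma hess_familyK (Y : 'M[R]_n) (x : 'rV[R]_n) : x 0 i = 1 -> Y^T = Y ->
  hess_family_inv 2^-1 3^-1 (hess_family Y x) x = Y.
Proof.
move=> xi Ysym; rewrite /hess_family_inv /hess_family.
set e := delta_mx 0 i; set w := x *m Y; rewrite xi scale1r.
have xe : x *m e^T = 1%:M.
  by apply/rowP => j; rewrite ord1 trmx_delta -colE !mxE xi.
have ex : e *m x^T = 1%:M by rewrite -[LHS]trmxK trmx_mul trmxK xe trmx1.
have xw : x *m w^T = (w *m x^T)^T by rewrite [RHS]trmx_mul trmxK.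
set q := (w *m x^T) 0 0.
have wx : w *m x^T = q%:M by rewrite [LHS]mx11_scalar.
have uE : x *m (Y + e^T *m w + w^T *m e) = 2 *: w + q *: e.
  rewrite !mulmxDr !mulmxA xe mul1mx xw wx tr_scalar_mx mul_scalar_mx -/w.
  by rewrite scaler_nat mulr2n.
rewrite uE mulmxDl -!scalemxAl wx ex.
have -> : (2 *: q%:M + q *: 1%:M : 'M[R]_1) 0 0 = 3 * q.
  by rewrite !mxE eqxx /= !mulr1n; ring.
rewrite mulKf ?pnatr_eq0 // addrK scalerA mulVf ?pnatr_eq0 // scale1r.
by rewrite [_ + _ - e^T *m w]addrAC addrK addrK.
Qed.

Definition linear_mx (T : pzRingType) (t : 'I_n -> 'I_n -> 'I_n -> T) (x : 'rV[T]_n) : 'M[T]_n :=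
  \matrix_(j, k) \sum_l t j k l * x 0 l.

Definition leq_pair m := {p : 'I_m * 'I_m | (p.1 <= p.2)%N}.

(** The entries on and above the diagonal are the coordinates in which dimensions are counted. The
    default 0 is never reached, since one of (s, s') and (s', s) is ordered. *)
Definition sym_mx (T : pzRingType) m (v : leq_pair m -> T) : 'M[T]_m :=
  \matrix_(s, s') oapp v (oapp v 0 (insub (s', s))) (insub (s, s')).

Lemma sym_mxE (T : pzRingType) m (v : leq_pair m -> T) (p : leq_pair m) :
  sym_mx v (val p).1 (val p).2 = v p.
Proof. by rewrite mxE -surjective_pairing valK. Qed.

Lemma sym_mx_tr (T : pzRingType) m (v : leq_pair m -> T) : (sym_mx v)^T = sym_mx v.
Proof.
apply/matrixP => s s'; rewrite !mxE.
case: insubP => [u hu eu|]; case: insubP => [u' hu' eu'|] //=.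
  have ss' : s = s'.
    by apply/val_inj/eqP; rewrite eqn_leq; move: hu hu' => /= -> ->.
  by congr v; apply/val_inj; rewrite eu eu' ss'.
Qed.

Lemma sym_mxK (T : pzRingType) m (S : 'M[T]_m) : S^T = S ->
  sym_mx (fun p : leq_pair m => S (val p).1 (val p).2) = S.
Proof.
move=> Ssym; apply/matrixP => s s'; rewrite mxE.
have [ss'|ss'] := leqP s s'.
  by rewrite (insubT (fun p : 'I_m * 'I_m => (p.1 <= p.2)%N) (x := (s, s')) ss').
rewrite [X in oapp _ _ X]insubN /= -?ltnNge //.
rewrite (insubT (fun p : 'I_m * 'I_m => (p.1 <= p.2)%N) (x := (s', s)) (ltnW ss')) /=.
by rewrite -{1}Ssym mxE.
Qed.

Lemma map_sym_mx (T T' : pzRingType) (h : {rmorphism T -> T'}) m (v : leq_pair m -> T) :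
  map_mx h (sym_mx v) = sym_mx (h \o v).
Proof.
apply/matrixP => s s'; rewrite !mxE.
case: (insub (s, s') : option (leq_pair m)) => [u|] //=.
by case: (insub (s', s) : option (leq_pair m)) => [u|] //=; rewrite rmorph0.
Qed.

(* Symmetric matrices of rank at most [r] have [r c + r (r + 1) / 2] parameters
   in each chart; with the [n - 1] coordinates of [x] these are fewer than the
   entries of [Y]. *)
Lemma avoid_low_rank (r c : nat) (t : 'I_n -> 'I_n -> 'I_n -> R) (eps : R) :
  n = (r + c)%N -> (n <= 'C(c.+1, 2))%N -> (forall j k l, t j k l = t k j l) -> 0 < eps ->
  exists Y : 'M[R]_n, [/\ Y^T = Y, forall j k, `|Y j k| < eps &
    forall x : 'rV[R]_n, x 0 i = 1 -> (r < \rank (linear_mx t x + hess_family Y x)%R)%N].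
Proof.
move=> nrc nc tsym eps0.
pose Param : finType := ({l : 'I_n | l != i} + ('I_r * 'I_c) + leq_pair r)%type.
pose J : finType := leq_pair n.
pose ch : finType := ({ffun 'I_r -> 'I_n} * {ffun 'I_c -> 'I_n})%type.
pose a := #|Param|.
(* Since n = r + c, n(n+1)/2 = r(r+1)/2 + r c + c(c+1)/2, and the inequality becomes n - 1 <
   c(c+1)/2. *)
have aJ : (a < #|J|)%N.
  rewrite /a !card_sum card_prod !card_ord !card_leq_pairs card_sig.
  have -> : #|[pred l : 'I_n | l != i]| = n.-1.
    by have := cardC1 i; rewrite card_ord => <-; apply: eq_card => l; rewrite !inE.
  have n0 : (0 < n)%N by exact: leq_ltn_trans (ltn_ord i).
  rewrite {2}nrc.
  have h2 m : (2 * 'C(m.+1, 2) = m * m.+1)%N by rewrite -mul_bin_diag bin1 mulnC.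
  have := h2 c; have := h2 r; have := h2 (r + c)%N; nia.
pose X (p : Param) : mpoly a R := mpolyX R (mnm1 (enum_rank p)).
(* The same matrix formulas, read over the ring of polynomials in the parameters, give the maps [FP]
   whose images are to be avoided. The coordinate i of [xP] is the constant 1. *)
pose xP : 'rV[mpoly a R]_n := \row_l oapp (fun u => X (inl (inl u))) 1 (insub l).
pose AP : 'M[mpoly a R]_(r, c) := \matrix_(s, b) X (inl (inr (s, b))).
pose SP : 'M[mpoly a R]_r := sym_mx (fun p => X (inr p)).
pose MP (e : ch) : 'M[mpoly a R]_(r, n) := chart_mx e.1 e.2 AP.
pose FP (e : ch) : 'M[mpoly a R]_n := hess_family_inv (mpolyC a 2^-1) (mpolyC a 3^-1)
  ((MP e)^T *m SP *m MP e - linear_mx (fun j k l => mpolyC a (t j k l)) xP) xP.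
have [y yeps yP] := grid_avoids_images (fun e (p : J) => FP e (val p).1 (val p).2) aJ eps0.
exists (sym_mx y); split; first exact: sym_mx_tr.
  move=> j k; rewrite mxE.
  case: (insub (j, k) : option (leq_pair n)) => [u|] /=; first exact: yeps.
  by case: (insub (k, j) : option (leq_pair n)) => [u|] /=; [exact: yeps|rewrite normr0].
move=> x xi; rewrite ltnNge; apply/negP => hrank.
set Y := sym_mx y in hrank; have Ysym : Y^T = Y by exact: sym_mx_tr.
pose H : 'M[R]_n := linear_mx t x + hess_family Y x.
have {}hrank : (\rank H <= r)%N by exact: hrank.
have Hsym : H^T = H.
  rewrite /H /hess_family /linear_mx !linearD /= linearZ /= !trmx_mul !trmxK Ysym; congr (_ + _).
    by apply/matrixP => j k; rewrite !mxE; apply: eq_bigr => l _; rewrite tsym.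
  by rewrite -!addrA; congr (_ + _); rewrite addrC.
(* Low rank at x puts the Hessian in a chart, and [hess_familyK] then exhibits Y as a value of
   [FP (f, g)], against the choice of y. *)
have [f [g [A [S Ssym HE]]]] := symmetric_rank_factor nrc Hsym hrank.
pose v (p : Param) : R := match p with
  | inl (inl u) => x 0 (val u) | inl (inr q) => A q.1 q.2 | inr q => S (val q).1 (val q).2 end.
pose tt (k : 'I_a) : R := v (enum_val k).
have Xv p : meval tt (X p) = v p by rewrite /X mevalXU /tt enum_rankK.
have [p] := yP (f, g) tt; case/eqP.
rewrite -[RHS](sym_mxE y) -/Y.
have mapx : map_mx (meval tt) xP = x.
  apply/rowP => l; rewrite !mxE; case: insubP => [u _ <-|] /=; first by rewrite Xv.
  by rewrite negbK => /eqP ->; rewrite rmorph1.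
have mapA : map_mx (meval tt) AP = A by apply/matrixP => s b; rewrite !mxE Xv.
have mapS : map_mx (meval tt) SP = S.
  rewrite -(sym_mxK Ssym) /SP map_sym_mx; congr sym_mx; apply/funext => q /=.
  by rewrite Xv.
have mapM : map_mx (meval tt) (MP (f, g)) = chart_mx f g A.
  apply/matrixP => s j; rewrite !mxE rmorphD rmorph_sum rmorph_nat /=; congr (_ + _).
  by apply: eq_bigr => b _; rewrite -mapA rmorphM rmorph_nat [in RHS]mxE.
have mapL : map_mx (meval tt) (linear_mx (fun j k l => mpolyC a (t j k l)) xP) = linear_mx t x.
  apply/matrixP => j k; rewrite !mxE rmorph_sum; apply: eq_bigr => l _ /=.
  by rewrite mevalM mevalC -mapx [in RHS]mxE.
have mapF : map_mx (meval tt) (FP (f, g)) = Y.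
  rewrite -[RHS](hess_familyK xi Ysym).
  rewrite /FP /hess_family_inv; set KP := _ - linear_mx _ _.
  have mapK : map_mx (meval tt) KP = hess_family Y x.
    rewrite /KP map_mxB !map_mxM -map_trmx mapM mapS mapL -HE /H addrC addKr.
    by [].
  clearbody KP.
  rewrite !map_mxB !map_mxM -!map_trmx map_delta_mx !map_mxZ !map_mxB !map_mxZ map_delta_mx.
  rewrite map_mxM mapK mapx /= mevalM !mevalC.
  have -> : meval tt ((xP *m KP *m xP^T) 0 0) = (x *m hess_family Y x *m x^T) 0 0.
    by rewrite -mapK -[in RHS]mapx map_trmx -!map_mxM [in RHS]mxE.
  by [].
by rewrite -mapF [RHS]mxE.
Qed.

End CubicFamily.

(** * Cubic forms with nondegenerate Hessian *)

Section Nondegenerate.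
Variables (R : realType) (n : nat).

(* A quantitative form of [m <= \rank H]. *)
Definition nondeg m (c : R) (H : 'M[R]_n) : Prop :=
  exists2 E : 'M[R]_(m, n), (forall s i, `|E s i| <= 1) &
    forall h : 'rV[R]_m, c * `|h| <= `|h *m E *m H|.

Lemma norm_mulmx_le m k (h : 'rV[R]_m) (A : 'M[R]_(m, k)) a : 0 <= a ->
  (forall s i, `|A s i| <= a) -> `|h *m A| <= m%:R * a * `|h|.
Proof.
move=> a0 hA; apply/norm_rV_le => [|i]; first by rewrite !mulr_ge0.
rewrite mxE; apply: le_trans (ler_norm_sum _ _ _) _.
have -> : m%:R * a * `|h| = \sum_(j < m) `|h| * a.
  by rewrite sumr_const card_ord -[RHS]mulr_natl [`|h| * a]mulrC mulrA.
by apply: ler_sum => j _; rewrite normrM ler_pM // coord_le_norm.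
Qed.

(** The same directions E are kept; as |h E| <= m |h|, the perturbation moves h E H by at most n m d
    |h|. *)
Lemma nondeg_perturb m c d (H H' : 'M[R]_n) : 0 <= d -> nondeg m c H ->
  (forall j k, `|H' j k - H j k| <= d) -> nondeg m (c - n%:R * m%:R * d) H'.
Proof.
move=> d0 [E E1 EH] HH'; exists E => // h.
have hE : `|h *m E| <= m%:R * `|h| by have := norm_mulmx_le h ler01 E1; rewrite mulr1.
have hd : `|h *m E *m (H' - H)| <= n%:R * m%:R * d * `|h|.
  apply: le_trans (norm_mulmx_le _ d0 _) _ => [s i|]; first by rewrite !mxE.
  by rewrite -!mulrA ler_wpM2l // [leRHS]mulrCA ler_wpM2l.
rewrite mulrBl lerBlDr; apply: le_trans (EH h) _.
have -> : h *m E *m H = h *m E *m H' - h *m E *m (H' - H).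
  by rewrite mulmxBr opprB addrC subrK.
by apply: le_trans (ler_normB _ _) _; rewrite lerD2l.
Qed.

Lemma nondeg_le m c c' H : c' <= c -> nondeg m c H -> nondeg m c' H.
Proof.
move=> cc' [E E1 EH]; exists E => // h; apply: le_trans (EH h).
by rewrite ler_wpM2r.
Qed.

Lemma nondeg_scale m c a H : nondeg m c H -> nondeg m (`|a| * c) (a *: H).
Proof.
move=> [E E1 EH]; exists E => // h.
by rewrite -scalemxAr normrZ -mulrA ler_wpM2l.
Qed.

(** The normal form of H under row and column operations gives E0 H B = 1, so |h| = |h E0 H B| is
    bounded by a multiple of |h E0 H|. Dividing E0 by a bound on its entries normalises it. *)
Lemma nondeg_rank m (H : 'M[R]_n) : (m <= \rank H)%N ->
  exists2 c, 0 < c & nondeg m c H.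
Proof.
move=> mH.
pose E0 : 'M[R]_(m, n) := pid_mx m *m invmx (col_ebase H).
pose B : 'M[R]_(n, m) := invmx (row_ebase H) *m pid_mx m.
have EHB : E0 *m H *m B = 1%:M.
  rewrite -[in LHS](mulmx_ebase H) /E0 /B !mulmxA mulmxKV ?col_ebase_unit //.
  rewrite mulmxK ?row_ebase_unit // !mul_pid_mx.
  have mn : (m <= n)%N := leq_trans mH (rank_leq_row H).
  by rewrite -pid_mx_1; congr pid_mx; lia.
clearbody E0 B.
pose bE := 1 + \sum_s \sum_i `|E0 s i|.
pose bB := 1 + \sum_s \sum_i `|B s i|.
have sum_ge (p q : nat) (A : 'M[R]_(p, q)) s i : `|A s i| <= 1 + \sum_s \sum_i `|A s i|.
  have h1 : \sum_i `|A s i| <= \sum_s \sum_i `|A s i|.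
    by rewrite [leRHS](bigD1 s) //= lerDl sumr_ge0 // => j _; rewrite sumr_ge0.
  have h2 : `|A s i| <= \sum_i `|A s i| by rewrite [leRHS](bigD1 i) //= lerDl sumr_ge0.
  by rewrite (le_trans h2) // (le_trans h1) // lerDr.
have bE0 : 0 < bE by rewrite ltr_wpDr // sumr_ge0 // => s _; rewrite sumr_ge0.
have bB0 : 0 < bB by rewrite ltr_wpDr // sumr_ge0 // => s _; rewrite sumr_ge0.
exists ((1 + n%:R * bB) * bE)^-1.
  by rewrite invr_gt0 mulr_gt0 // ltr_wpDr // mulr_ge0 // ltW.
exists (bE^-1 *: E0) => [s i|h].
  rewrite mxE normrM ger0_norm ?invr_ge0 ?(ltW bE0) // mulrC ler_pdivrMr // mul1r.
  exact: sum_ge.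
rewrite -scalemxAr -scalemxAl normrZ ger0_norm ?invr_ge0 ?(ltW bE0) //.
rewrite invfM mulrAC [leLHS]mulrC ler_pM2l ?invr_gt0 //.
have b1 : 0 < 1 + n%:R * bB by rewrite ltr_wpDr // mulr_ge0 // ltW.
rewrite mulrC ler_pdivrMr // mulrC.
have {1}-> : h = h *m E0 *m H *m B by rewrite -!mulmxA (mulmxA E0) EHB mulmx1.
apply: le_trans (norm_mulmx_le _ (ltW bB0) (sum_ge _ _ B)) _.
by rewrite ler_wpM2r // lerDr.
Qed.

End Nondegenerate.

(** * Hessians of cubic forms *)

Section CubicHessian.
Variables (R : realType) (n : nat).
Implicit Types (p : mpoly n R) (x : 'rV[R]_n).

Definition hessp p x : 'M[R]_n :=
  \matrix_(j, k) meval (fun l => x 0 l) (mderiv j (mderiv k p)).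

(** For a cubic form these are its third partial derivatives, which are constants. *)
Definition third_coef p (j k l : 'I_n) : R := mcoeff (mnm1 l) (mderiv j (mderiv k p)).

Lemma third_coef_sym p j k l : third_coef p j k l = third_coef p k j l.
Proof. by rewrite /third_coef mderiv_comm. Qed.

Definition homog d p := forall m : multinom n, mdeg m != d -> mcoeff m p = 0.

Lemma homog_mderiv d i p : homog d.+1 p -> homog d (mderiv i p).
Proof.
move=> hp m md; rewrite mcoeff_deriv hp ?mul0rn //.
by rewrite mdegD mdeg1 addn1 eqSS.
Qed.

Lemma homog_dhomog d (p : dhomog n R d) : homog d p.
Proof. by move=> m md; apply: (dhomog_nemf_coeff (dhomog_is_dhomog p)). Qed.

Lemma meval_homog1 (v : 'I_n -> R) p : homog 1 p ->
  meval v p = \sum_l mcoeff (mnm1 l) p * v l.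
Proof.
move=> hp.
have lin1 l : mcoeff (mnm1 l) (\sum_k mcoeff (mnm1 k) p *: mpolyX R (mnm1 k)) = mcoeff (mnm1 l) p.
  rewrite raddf_sum /= (bigD1 l) //= mcoeffZ mcoeffX eqxx mulr1 big1 ?addr0 // => k kl.
  by rewrite mcoeffZ mcoeffXU (negPf kl) mulr0.
have -> : p = \sum_l mcoeff (mnm1 l) p *: mpolyX R (mnm1 l).
  apply/mpolyP => m; rewrite raddf_sum /=.
  have [/mdeg1P[l /eqP ->]|md] := boolP (mdeg m == 1%N).
    by have := lin1 l; rewrite raddf_sum => ->.
  rewrite hp // big1 // => l _; rewrite mcoeffZ mcoeffX.
  by have [e|] := eqVneq; rewrite ?mulr0 //; move: md; rewrite -e mdeg1.
rewrite raddf_sum /=; apply: eq_bigr => l _; rewrite mevalZ mevalXU.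
by congr (_ * _); have /esym := lin1 l.
Qed.

Lemma hessp_linear p x : homog 3 p -> hessp p x = linear_mx (third_coef p) x.
Proof.
move=> hp; apply/matrixP => j k; rewrite !mxE.
by rewrite (meval_homog1 _ (homog_mderiv j (homog_mderiv k hp))).
Qed.

Lemma hesspD p q x : hessp (p + q) x = hessp p x + hessp q x.
Proof. by apply/matrixP => j k; rewrite !mxE !mderivD mevalD. Qed.

Lemma hesspZ p a x : homog 3 p -> hessp p (a *: x) = a *: hessp p x.
Proof.
move=> hp; rewrite !hessp_linear //; apply/matrixP => j k; rewrite !mxE mulr_sumr.
by apply: eq_bigr => l _; rewrite mxE mulrCA.
Qed.

Lemma hesspBr p x y : homog 3 p -> hessp p (x - y) = hessp p x - hessp p y.
Proof.
move=> hp; rewrite !hessp_linear //; apply/matrixP => j k; rewrite !mxE -sumrB.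
by apply: eq_bigr => l _; rewrite !mxE mulrBr.
Qed.

Lemma hessp_le p x a : homog 3 p -> (forall j k l, `|third_coef p j k l| <= a) ->
  forall j k, `|hessp p x j k| <= n%:R * a * `|x|.
Proof.
move=> hp pa j k; rewrite hessp_linear // mxE; apply: le_trans (ler_norm_sum _ _ _) _.
have -> : n%:R * a * `|x| = \sum_(l < n) a * `|x|.
  by rewrite sumr_const card_ord -[RHS]mulr_natl mulrA.
by apply: ler_sum => l _; rewrite normrM ler_pM // coord_le_norm.
Qed.

Lemma hessp_lipschitz p : homog 3 p -> exists2 K, 0 <= K &
  forall x y j k, `|hessp p x j k - hessp p y j k| <= K * `|x - y|.
Proof.
move=> hp; pose a := \sum_j \sum_k \sum_l `|third_coef p j k l|.
have a0 : 0 <= a by do 3!(apply: sumr_ge0 => ? _).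
have ha j k l : `|third_coef p j k l| <= a.
  rewrite /a (bigD1 j) //= (bigD1 k) //= (bigD1 l) //= -!addrA lerDl.
  by do 2?(apply: addr_ge0); do ?(apply: sumr_ge0 => ? _).
exists (n%:R * a) => [|x y j k]; first by rewrite mulr_ge0.
have := hessp_le (x - y) hp ha j k; rewrite hesspBr // !mxE.
by [].
Qed.

Definition hessian_form (i : 'I_n) (Y : 'M[R]_n) : mpoly n R :=
  \sum_j \sum_k (Y j k / 2) *: mpolyX R (mnm_add (mnm1 i) (mnm_add (mnm1 j) (mnm1 k))).

Lemma homog_hessian_form i Y : homog 3 (hessian_form i Y).
Proof.
move=> m md; rewrite raddf_sum /= big1 // => j _; rewrite raddf_sum /= big1 // => k _.
rewrite mcoeffZ mcoeffX; have [e|] := eqVneq; last by rewrite mulr0.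
by move: md; rewrite -e !mdegD !mdeg1.
Qed.

Lemma coef_hessian_form i (Y : 'M[R]_n) m e : (forall j k, `|Y j k| <= e) ->
  `|mcoeff m (hessian_form i Y)| <= n%:R ^+ 2 * e.
Proof.
move=> Ye; rewrite raddf_sum /=; apply: le_trans (ler_norm_sum _ _ _) _.
have -> : n%:R ^+ 2 * e = \sum_(j < n) \sum_(k < n) e.
  rewrite sumr_const sumr_const card_ord.
  by rewrite -[in RHS]mulr_natl -[(e *+ n)]mulr_natl mulrA expr2.
apply: ler_sum => j _; rewrite raddf_sum /=; apply: le_trans (ler_norm_sum _ _ _) _.
apply: ler_sum => k _; rewrite mcoeffZ mcoeffX.
have e0 : 0 <= e by apply: le_trans (Ye j k).
case: eqVneq => _; last by rewrite mulr0 normr0.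
rewrite mulr1 normrM; have -> : `|2^-1| = 2^-1 :> R by rewrite ger0_norm ?invr_ge0.
by rewrite ler_pdivrMr //; apply: le_trans (Ye j k) _; rewrite ler_peMr // ler1n.
Qed.

Lemma mderivXU (i j : 'I_n) : mderiv i (mpolyX R (mnm1 j)) = mpolyC n (i == j)%:R.
Proof.
rewrite mderivX mnm1E eq_sym; have [->|] := eqVneq i j; last by rewrite scale0r mpolyC0.
by rewrite scale1r (_ : mnm_sub _ _ = mnm0) ?mpolyX0 //; apply/mnmP => k; rewrite mnmBE subnn mnm0E.
Qed.

Lemma hessp_hessian_form i Y x : Y^T = Y -> hessp (hessian_form i Y) x = hess_family i Y x.
Proof.
move=> Ysym.
pose X j := mpolyX R (mnm1 j : multinom n).
pose q : mpoly n R := \sum_j \sum_k (Y j k / 2) *: (X j * X k).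
pose w k : mpoly n R := \sum_j Y j k *: X j.
have -> : hessian_form i Y = X i * q.
  rewrite /q mulr_sumr; apply: eq_bigr => j _; rewrite mulr_sumr; apply: eq_bigr => k _.
  by rewrite -scalerAr !mpolyXD.
have dw a k : mderiv a (w k) = mpolyC n (Y a k).
  rewrite /w raddf_sum /= (bigD1 a) //= big1 => [|j ja].
    by rewrite mderivZ mderivXU eqxx addr0 -mul_mpolyC -mpolyCM mulr1.
  by rewrite mderivZ mderivXU eq_sym (negPf ja) mpolyC0 scaler0.
have dq k : mderiv k q = w k.
  rewrite /q raddf_sum /=.
  under eq_bigr do rewrite raddf_sum /=.
  under eq_bigr do under eq_bigr do rewrite mderivZ mderivM !mderivXU scalerDr.
  under eq_bigr do rewrite big_split /=.
  rewrite big_split /= exchange_big /= -big_split /=; apply: eq_bigr => j _.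
  rewrite (bigD1 k) //= big1 => [|l lk]; last by rewrite eq_sym (negPf lk) mpolyC0 mul0r scaler0.
  rewrite (bigD1 k) //= big1 => [|l lk]; last by rewrite eq_sym (negPf lk) mpolyC0 mulr0 scaler0.
  rewrite eqxx !addr0 mul1r mulr1 -scalerDl; congr (_ *: _).
  rewrite -{1}Ysym mxE -mulrDl -mulr2n -[_ *+ 2]mulr_natr mulfK ?pnatr_eq0 //.
have wv k : meval (fun l => x 0 l) (w k) = (x *m Y) 0 k.
  rewrite raddf_sum mxE; apply: eq_bigr => j _ /=.
  by rewrite mevalZ mevalXU mulrC.
apply/matrixP => j k; rewrite !mxE.
rewrite mderivM dq mderivXU mderivD !mderivM mderivXU mderivC mul0r add0r dq dw.
rewrite !mevalD !mevalM !mevalC mevalXU !wv !big_ord1 !mxE eqxx /=.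
rewrite ![_ == i]eq_sym; ring.
Qed.

End CubicHessian.

(** * Openness and density of the nondegenerate forms *)

Section GenericForms.
Variables (R : realType) (n : nat).

(** For the sup norm, each nonzero point is a multiple of one with x_i = 1 and |x| <= 1 for some i.
    Fixing x_i = 1 is also what makes the perturbation recoverable from its Hessian in
    [hess_familyK]. *)
Definition slice_nondeg m (i : 'I_n) : set (cubic_form R n) := [set p | exists2 c, 0 < c &
  forall x : 'rV[R]_n, x 0 i = 1 -> `|x| <= 1 -> nondeg m c (hessp (p : dhomog n R 3) x)].

Lemma cubic_coefsE (p : dhomog n R 3) m (hm : (mdeg m < 4)%N) :
  mcoeff m p = cubic_coefs p 0 (enum_rank (BMultinom hm)).
Proof. by rewrite mxE enum_rankK. Qed.

(** Differentiating a monomial of degree 3 twice multiplies its coefficient by at most 3 times 2. *)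
Lemma third_coef_close (p q : dhomog n R 3) d j k l :
  `|cubic_coefs q - cubic_coefs p| <= d ->
  `|third_coef q j k l - third_coef p j k l| <= 6 * d.
Proof.
move=> pq; rewrite /third_coef !mcoeff_deriv -!mulrnA -mulrnBl normrMn -[leLHS]mulr_natl.
set m := (X in mcoeff X q); have hm : (mdeg m < 4)%N by rewrite /m !mdegD !mdeg1.
have d0 : 0 <= d by apply: le_trans pq.
apply: ler_pM => //.
  rewrite ler_nat; apply: (@leq_mul _ _ 3 2); rewrite ?ltnS !mnmE.
    by case: eqP => _; case: eqP => _.
  by case: eqP.
apply: le_trans pq; rewrite !(cubic_coefsE _ hm).
by have := coord_le_norm (cubic_coefs q - cubic_coefs p) (enum_rank (BMultinom hm)); rewrite !mxE.
Qed.

Lemma hessp_close (p q : dhomog n R 3) d (x : 'rV[R]_n) j k :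
  `|cubic_coefs q - cubic_coefs p| <= d -> `|x| <= 1 ->
  `|hessp q x j k - hessp p x j k| <= n%:R * (6 * d).
Proof.
move=> pq x1; rewrite !hessp_linear; try exact: homog_dhomog.
have d0 : 0 <= d by apply: le_trans pq.
rewrite !mxE -sumrB; apply: le_trans (ler_norm_sum _ _ _) _.
have -> : n%:R * (6 * d) = \sum_(l < n) 6 * d by rewrite sumr_const card_ord -[RHS]mulr_natl.
apply: ler_sum => l _; rewrite -mulrBl normrM -[leRHS]mulr1; apply: ler_pM => //.
  exact: third_coef_close.
by apply: le_trans x1; exact: coord_le_norm.
Qed.

Lemma nbhs_cubic (p : cubic_form R n) (d : R) : 0 < d ->
  nbhs p [set q : cubic_form R n | `|cubic_coefs q - cubic_coefs p| < d].
Proof.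
move=> d0; have /= := @initial_continuous (dhomog n R 3) _ (@cubic_coefs R n) p.
move=> /(_ [set v | `|v - cubic_coefs p| < d]); apply.
apply/nbhs_ballP; exists d => // v /=; rewrite -ball_normE /= => h.
by rewrite distrC.
Qed.

Lemma open_slice_nondeg m i : open (slice_nondeg m i).
Proof.
rewrite openE => p [c c0 hp].
(* The factor by which an error on the coefficients enters [nondeg_perturb], plus 1 to keep it
   positive: an error c / 2 / N costs at most c / 2. *)
pose N := n%:R * m%:R * (n%:R * 6) + 1 : R.
have N0 : 0 < N by rewrite ltr_wpDl // !mulr_ge0.
apply: filterS (nbhs_cubic p (d := c / 2 / N) _); last by rewrite !divr_gt0.
move=> q /ltW pq; exists (c / 2); first by rewrite divr_gt0.
move=> x xi x1; have d0 : 0 <= n%:R * (6 * (c / 2 / N)).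
  by rewrite !mulr_ge0 // ?invr_ge0 ltW.
apply: nondeg_le (nondeg_perturb d0 (hp x xi x1) _); last first.
  by move=> j k; apply: hessp_close.
have -> : n%:R * m%:R * (n%:R * (6 * (c / 2 / N))) = (N - 1) / N * (c / 2).
  by rewrite /N; field; apply/eqP => h; move: N0; rewrite /N h ltxx.
have : (N - 1) / N <= 1 by rewrite ler_pdivrMr // mul1r lerBlDr lerDl.
move: ((N - 1) / N) => y y1; have : y * (c / 2) <= 1 * (c / 2) by rewrite ler_wpM2r // divr_ge0 // ltW.
by rewrite mul1r => h; rewrite [X in _ <= X - _](splitr c) lerBrDr lerD2l.
Qed.

(* Compactness makes the nondegeneracy of the Hessian uniform on the slice. *)
Lemma slice_nondeg_rank m i (p : cubic_form R n) :
  (forall x : 'rV[R]_n, x 0 i = 1 -> (m <= \rank (hessp (p : dhomog n R 3) x))%N) ->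
  slice_nondeg m i p.
Proof.
move=> hr; pose K := [set x : 'rV[R]_n | x 0 i = 1 /\ `|x| <= 1].
have hom := @homog_dhomog R n 3 p.
have cK : compact K.
  apply: (@subclosed_compact _ _ [set x : 'rV[R]_n | `|x - 0| <= 1]).
  - rewrite (_ : K = [set x : 'rV[R]_n | x 0 i = 1] `&` [set x : 'rV[R]_n | `|x - 0| <= 1]).
      apply: closedI.
        apply: (@closed_comp _ _ (fun x : 'rV[R]_n => x 0 i) [set 1]); last exact: closed_eq.
        by move=> x _; exact: coord_continuous.
      by apply: compact_closed; [exact: norm_hausdorff|exact: compact_norm_ball].
    by apply/seteqP; split => x /=; rewrite subr0.
  - exact: compact_norm_ball.
  - by move=> x [_ /=]; rewrite subr0.
have [L L0 lip] := hessp_lipschitz hom.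
pose P (c : R) (x : 'rV[R]_n) := nondeg m c (hessp (p : dhomog n R 3) x).
have hP : forall x, K x -> \forall x' \near x & c \near 0^'+, P c x'.
  move=> x [xi x1]; have [c c0 hc] := nondeg_rank (hr x xi).
  pose N := n%:R * m%:R * L + 1.
  have N0 : 0 < N by rewrite ltr_wpDl // !mulr_ge0.
  exists ([set x' : 'rV[R]_n | `|x' - x| < c / 2 / N], [set c' : R | c' <= c / 2]).
    split => /=.
      apply/nbhs_ballP; exists (c / 2 / N); first by rewrite /= !divr_gt0.
      by move=> y; rewrite -ball_normE /= distrC.
    by near=> c'; apply/ltW; near: c'; apply: nbhs_right_lt; rewrite divr_gt0.
  move=> [x' c'] [/= /ltW xx' cc']; apply: nondeg_le (nondeg_perturb _ hc (d := L * (c / 2 / N)) _).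
  - apply: le_trans cc' _.
    have -> : n%:R * m%:R * (L * (c / 2 / N)) = (N - 1) / N * (c / 2).
      by rewrite /N; field; apply/eqP => h; move: N0; rewrite /N h ltxx.
    have : (N - 1) / N <= 1 by rewrite ler_pdivrMr // mul1r lerBlDr lerDl.
    move: ((N - 1) / N) => y y1; have : y * (c / 2) <= 1 * (c / 2) by rewrite ler_wpM2r // divr_ge0 // ltW.
    by rewrite mul1r => h; rewrite [X in _ <= X - _](splitr c) lerBrDr lerD2l.
  - by rewrite !mulr_ge0 // ?invr_ge0 ltW.
  - by move=> j k; apply: le_trans (lip _ _ _ _) _; rewrite ler_wpM2l.
have /compact_near_coveringP/(_ R (0^'+) P _ hP) := cK.
move=> near_c; near (0 : R)^'+ => c; exists c => // x xi x1.
have : K `<=` P c by near: c; exact: near_c.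
by apply.
Unshelve. all: by end_near. Qed.

(** The perturbation is [hessian_form i Y] with Y from [avoid_low_rank]. Up to n^2 of its terms may
    fall on the same monomial, hence the bound e / 2 / n^2 on the entries of Y. *)
Lemma dense_slice_nondeg r c (i : 'I_n) : n = (r + c)%N -> (n <= 'C(c.+1, 2))%N ->
  dense (slice_nondeg r.+1 i).
Proof.
move=> nrc nc O; case=> p Op; case=> O' openO' OO'.
have [e e0 he] : exists2 e, 0 < e & forall q : dhomog n R 3, `|cubic_coefs q - cubic_coefs (p : dhomog n R 3)| < e -> O q.
  have : nbhs (cubic_coefs (p : dhomog n R 3)) O'.
    by apply: open_nbhs_nbhs; split => //; move: Op; rewrite -OO'.
  move=> /nbhs_ballP[e /= e0 he]; exists e => // q hq; rewrite -OO' /=; apply: he.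
  by rewrite -ball_normE /= distrC.
have n0 : (0 < n)%N := leq_ltn_trans (leq0n _) (ltn_ord i).
have e'0 : 0 < e / 2 / n%:R ^+ 2 by rewrite !divr_gt0 // exprn_gt0 // ltr0n.
have [Y [Ysym Ye hY]] := @avoid_low_rank R n i r c (third_coef (p : dhomog n R 3)) _ nrc nc
  (third_coef_sym _) e'0.
have hq : hessian_form i Y \is ishomog1 3 mdeg.
  apply/dhomogP => m; rewrite mcoeff_msupp => h; apply/eqP/negPn/negP => md.
  by move/eqP: h; apply; exact: homog_hessian_form.
pose q : dhomog n R 3 := (p : dhomog n R 3) + DHomog hq.
exists q; split.
  apply: he; apply: (@le_lt_trans _ _ (e / 2)); last by rewrite gtr_pMr // invf_lt1 // ltr1n.
  apply/norm_rV_le => [|l]; first by rewrite divr_ge0 // ltW.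
  rewrite !mxE /= mcoeffD addrAC subrr add0r.
  apply: le_trans (coef_hessian_form i _ (fun j k => ltW (Ye j k))) _.
  by rewrite mulrC divfK // expf_neq0 // pnatr_eq0 -lt0n.
apply: slice_nondeg_rank => x xi.
have -> : hessp q x = linear_mx (third_coef (p : dhomog n R 3)) x + hess_family i Y x.
  by rewrite hesspD hessp_hessian_form // hessp_linear //; exact: homog_dhomog.
exact: hY.
Qed.

Definition nondeg_forms m : set (cubic_form R n) := \bigcap_(i in [set: 'I_n]) slice_nondeg m i.

(** If the coordinate i realises |x|, the Hessian at x is x_i times the Hessian at x / x_i, a point
    of the slice i. The smallest of the constants of the slices works for all x. *)
Lemma nondeg_formsP m (p : cubic_form R n) : nondeg_forms m p ->
  exists2 c, 0 < c & forall x, nondeg m (c * `|x|) (hessp (p : dhomog n R 3) x).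
Proof.
move=> hp; have /choice[c hc] : forall i, exists c, 0 < c /\ forall x : 'rV[R]_n, x 0 i = 1 ->
    `|x| <= 1 -> nondeg m c (hessp (p : dhomog n R 3) x).
  by move=> i; have [c c0 h] := hp i I; exists c.
exists (\big[Num.min/1]_i c i).
  by apply: (big_ind (fun y => 0 < y)) => // [x y x0 y0|i _]; [rewrite lt_min x0|case: (hc i)].
move=> x; have [->|x0] := eqVneq x 0.
  rewrite normr0 mulr0; exists 0 => [s i|h]; first by rewrite mxE normr0.
  by rewrite mul0r normr_ge0.
have [i xi] : exists i, `|x 0 i| = `|x|.
  apply: contrapT => /forallNP h; have : `|x| < `|x|; last by rewrite ltxx.
  apply/norm_rV_lt => [|i]; first by rewrite normr_gt0.
  by rewrite lt_neqAle coord_le_norm andbT; apply/eqP; exact: h.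
have xi0 : x 0 i != 0 by rewrite -normr_eq0 xi normr_eq0.
have -> : x = x 0 i *: ((x 0 i)^-1 *: x) by rewrite scalerA mulfV // scale1r.
rewrite hesspZ; last exact: homog_dhomog.
have [ci0 hci] := hc i.
have h1 : ((x 0 i)^-1 *: x) 0 i = 1 by rewrite mxE mulVf.
have h2 : `|(x 0 i)^-1 *: x| <= 1.
  by rewrite normrZ normrV ?unitfE // xi mulVf ?normr_eq0.
apply: nondeg_le (nondeg_scale (x 0 i) (hci _ h1 h2)); rewrite xi; rewrite scalerA mulfV // scale1r mulrC ler_wpM2l //.
exact: bigmin_le_cond.
Qed.

Lemma open_dense_bigcap (T : topologicalType) (I : finType) (F : I -> set T) :
  (forall i, open (F i)) -> (forall i, dense (F i)) ->
  open (\bigcap_(i in [set: I]) F i) /\ dense (\bigcap_(i in [set: I]) F i).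
Proof.
move=> oF dF.
have h (s : seq I) : open (\bigcap_(i in [set` s]) F i) /\ dense (\bigcap_(i in [set` s]) F i).
  elim: s => [|i s [os ds]].
    by rewrite set_nil bigcap_set0; split; [exact: openT|move=> O O0 _; rewrite setIT].
  have -> : \bigcap_(j in [set` i :: s]) F j = F i `&` \bigcap_(j in [set` s]) F j.
    apply/seteqP; split => [x h|x [h1 h2] j /=].
      by split => [|j js]; apply: h; rewrite /= inE ?eqxx // (js : j \in s) orbT.
    by rewrite inE => /orP[/eqP->|] //; exact: h2.
  split; first exact: openI.
  exact: denseI.
have := h (enum I); rewrite (_ : [set` enum I] = setT) //.
by apply/seteqP; split => // i _ /=; rewrite mem_enum.
Qed.

End GenericForms.

(** * The rescaled phase *)

Section Polynomials.
Variables (R : realType) (n : nat).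
Local Notation e_ i := (delta_mx 0 i : 'rV[R]_n).

Lemma is_derive_coord (i j : 'I_n) (x : 'rV[R]_n) :
  is_derive x (e_ i) (fun y : 'rV[R]_n => y 0 j) (i == j)%:R.
Proof.
rewrite -[x]add0r -[X in X + x](scale0r (e_ i)) is_derive_line.
have -> : (fun t : R => (t *: e_ i + x) 0 j) = (fun t : R => t * (i == j)%:R + x 0 j).
  by apply/funext => t; rewrite !mxE eqxx [j == i]eq_sym.
by apply: is_derive_eq; rewrite scaler0 add0r addr0 [LHS]mulr1.
Qed.

Lemma meval_smooth (p : mpoly n R) :
  continuous (fun x : 'rV[R]_n => meval (fun l => x 0 l) p) /\
  forall (x : 'rV[R]_n) i, is_derive x (e_ i) (fun x : 'rV[R]_n => meval (fun l => x 0 l) p)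
    (meval (fun l => x 0 l) (mderiv i p)).
Proof.
pose P q := continuous (fun x : 'rV[R]_n => meval (fun l => x 0 l) q) /\
  forall (x : 'rV[R]_n) i, is_derive x (e_ i) (fun x : 'rV[R]_n => meval (fun l => x 0 l) q)
    (meval (fun l => x 0 l) (mderiv i q)).
have PD q q' : P q -> P q' -> P (q + q').
  move=> [cq dq] [cq' dq']; rewrite /P.
  have -> : (fun x : 'rV[R]_n => meval (fun l => x 0 l) (q + q')) =
    (fun x : 'rV[R]_n => meval (fun l => x 0 l) q) + (fun x : 'rV[R]_n => meval (fun l => x 0 l) q').
    by apply/funext => x; rewrite mevalD.
  split=> [x|x i]; first by apply: continuousD; [exact: cq|exact: cq'].
  by rewrite mderivD mevalD; exact: is_deriveD.
have PM q q' : P q -> P q' -> P (q * q').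
  move=> [cq dq] [cq' dq']; rewrite /P.
  have -> : (fun x : 'rV[R]_n => meval (fun l => x 0 l) (q * q')) =
    (fun x : 'rV[R]_n => meval (fun l => x 0 l) q) * (fun x : 'rV[R]_n => meval (fun l => x 0 l) q').
    by apply/funext => x; rewrite mevalM.
  split=> [x|x i]; first by apply: continuousM; [exact: cq|exact: cq'].
  rewrite mderivM mevalD !mevalM.
  have := is_deriveM (dq x i) (dq' x i).
  by move=> h; apply: is_derive_eq h _; rewrite /GRing.scale /= addrC [X in X + _]mulrC.
have PC a : P (mpolyC n a).
  rewrite /P.
  have -> : (fun x : 'rV[R]_n => meval (fun l => x 0 l) (mpolyC n a)) = cst a.
    by apply/funext => x; rewrite mevalC.
  split=> [x|x i]; first exact: cst_continuous.
  by rewrite mderivC meval0; exact: is_derive_cst.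
have PX j : P (mpolyX R (mnm1 j)).
  rewrite /P.
  have -> : (fun x : 'rV[R]_n => meval (fun l => x 0 l) (mpolyX R (mnm1 j))) = (fun x : 'rV[R]_n => x 0 j).
    by apply/funext => x; rewrite mevalXU.
  split=> [x|x i]; first exact: coord_continuous.
  by rewrite mderivXU mevalC; exact: is_derive_coord.
have PXm m : P (mpolyX R m).
  rewrite mpolyXE_id; apply: big_ind => [|q q'|j _]; [exact: (PC 1)|exact: PM|].
  by elim: (m j) => [|k IH]; [rewrite expr0; exact: (PC 1)|rewrite exprS; exact: PM].
apply: (mpolyind (P := P)) => [|a m q _ _ Pq]; first exact: (PC 0).
by apply: PD => //; rewrite -mul_mpolyC; exact: PM.
Qed.

Lemma partial_meval (p : mpoly n R) i :
  partial i (fun x : 'rV[R]_n => meval (fun l => x 0 l) p) =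
  fun x : 'rV[R]_n => meval (fun l => x 0 l) (mderiv i p).
Proof. by apply/funext => x; have [_] := (meval_smooth p).2 x i. Qed.

Lemma partials_meval (p : mpoly n R) s :
  partials s (fun x : 'rV[R]_n => meval (fun l => x 0 l) p) =
  fun x : 'rV[R]_n => meval (fun l => x 0 l) (foldr (@mderiv n R) p s).
Proof. by elim: s => //= i s; rewrite /partials /= => ->; rewrite partial_meval. Qed.

Lemma smooth_cubic_eval (p : cubic_form R n) V : smooth_on V (cubic_eval p).
Proof.
move=> s x _; rewrite /cubic_eval partials_meval; have [c d] := meval_smooth (foldr (@mderiv n R) p s).
by split=> [|i]; [exact: c|have [] := d x i].
Qed.

Lemma is_derive_dotp (xi x : 'rV[R]_n) i : is_derive x (e_ i) (dotp xi) (xi 0 i).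
Proof.
pose p : mpoly n R := \sum_j xi 0 j *: mpolyX R (mnm1 j).
have E : dotp xi = fun x : 'rV[R]_n => meval (fun l => x 0 l) p.
  by apply/funext => y; rewrite raddf_sum; apply: eq_bigr => j _ /=; rewrite mevalZ mevalXU.
have -> : xi 0 i = meval (fun l => x 0 l) (mderiv i p).
  rewrite [mderiv i p]raddf_sum /= (bigD1 i) //= big1 => [|j ji]; last first.
    by rewrite mderivZ mderivXU eq_sym (negPf ji) mpolyC0 scaler0.
  by rewrite mderivZ mderivXU eqxx addr0 mevalZ mevalC mulr1.
by rewrite E; exact: (meval_smooth p).2.
Qed.

Lemma continuous_dotp (xi : 'rV[R]_n) : continuous (dotp xi).
Proof.
pose p : mpoly n R := \sum_j xi 0 j *: mpolyX R (mnm1 j).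
have -> : dotp xi = fun x : 'rV[R]_n => meval (fun l => x 0 l) p.
  by apply/funext => y; rewrite raddf_sum; apply: eq_bigr => j _ /=; rewrite mevalZ mevalXU.
exact: (meval_smooth p).1.
Qed.

End Polynomials.

(** * The phase near the origin and its rescaling *)

Section Smooth.
Variables (R : realType) (n : nat).
Implicit Types (f g : 'rV[R]_n -> R) (V Q : set 'rV[R]_n).
Local Notation e_ i := (delta_mx 0 i : 'rV[R]_n).

Lemma smooth_on_Cb k V f (K : set 'rV[R]_n) Q : compact K -> K `<=` V -> Q `<=` K ->
  smooth_on V f -> exists2 M, 0 <= M & Cb k M Q f.
Proof.
move=> cK KV QK sf.
have bound s : exists2 M, 0 <= M & forall x, K x -> `|partials s f x| <= M.
  by apply: continuous_bounded => // x /KV Vx; have [] := sf s x Vx.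
suff h s : exists2 M, 0 <= M & Cb k M Q (partials s f) by exact: (h [::]).
elim: k s => [|k IH] s; have [M M0 hM] := bound s.
  exists M => //; split=> // x Qx; split; last exact: (hM x (QK _ Qx)).
  by have [] := sf s x (KV _ (QK _ Qx)).
have /choice[N hN] : forall i, exists N, 0 <= N /\ Cb k N Q (partials (i :: s) f).
  by move=> i; have [N N0 h] := IH (i :: s); exists N.
have N0 : 0 <= \sum_i N i by apply: sumr_ge0 => i _; have [] := hN i.
exists (M + \sum_i N i); first by rewrite addr_ge0.
split=> [x Qx|i].
  have [c _] := sf s x (KV _ (QK _ Qx)); split=> //.
  by rewrite (le_trans (hM x (QK _ Qx))) // lerDl.
split=> [x Qx|]; first by have [_] := sf s x (KV _ (QK _ Qx)).
apply: Cb_le (hN i).2; apply: (@le_trans _ _ (\sum_i N i)); last by rewrite lerDr.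
by rewrite (bigD1 i) //= lerDl sumr_ge0 // => j _; have [] := hN j.
Qed.

Lemma smooth_onB V f g : open V -> smooth_on V f -> smooth_on V g ->
  smooth_on V (fun x => f x - g x) /\
  forall s x, V x -> partials s (fun x => f x - g x) x = partials s f x - partials s g x.
Proof.
move=> oV sf sg.
have D s : (forall x, V x -> partials s (fun x => f x - g x) x = partials s f x - partials s g x).
  elim: s => //= i s IH x Vx; rewrite /partials /=.
  rewrite (partial_local i oV Vx IH).2.
  have [[_ /(_ i)df] [_ /(_ i)dg]] := (sf s x Vx, sg s x Vx).
  exact: deriveB.
split; last exact: D.
move=> s x Vx.
have E y : V y -> partials s f y - partials s g y = partials s (fun x => f x - g x) y.
  by move=> /D.
have [[cf df] [cg dg]] := (sf s x Vx, sg s x Vx).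
split=> [|i].
  by apply: (continuous_local oV Vx E); apply: continuousB.
by apply: (partial_local i oV Vx E).1; exact: derivableB.
Qed.

Lemma mvt_origin f e rho (x : 'rV[R]_n) : f 0 = 0 ->
  (forall y : 'rV[R]_n, `|y| < rho -> forall l, derivable f y (e_ l) /\ `|partial l f y| <= e) ->
  `|x| < rho -> `|f x| <= n%:R * e * `|x|.
Proof.
move=> f0 hf xr; have rho0 : 0 < rho by apply: le_lt_trans xr.
have := @mvt_coord R n f 0 rho (fun=> 0) e x 0.
rewrite !subr0 normr0 => /(_ _ xr rho0).
rewrite [X in _ - _ - X]big1 => [|l _]; last by rewrite mul0r.
by rewrite !subr0 f0 subr0; apply=> y; rewrite subr0 => yr l; rewrite subr0; exact: hf.
Qed.

(** The third derivatives of Phi - p are continuous and vanish at 0, hence are small nearby; the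
    mean value theorem from 0, where the second derivatives vanish too, produces the factor |x|.
    This factor absorbs the r^-1 that the rescaling x = r y puts in front of second derivatives. *)
Lemma hessian_at_origin (p : cubic_form R n) V (Phi : 'rV[R]_n -> R) eps :
  open V -> V 0 -> smooth_on V Phi ->
  vanishes_to_fourth_order (fun x => Phi x - cubic_eval p x) -> 0 < eps ->
  exists2 rho, 0 < rho & forall x : 'rV[R]_n, `|x| < rho -> V x /\
    forall i j, `|partial j (partial i Phi) x - hessp (p : dhomog n R 3) x j i| <= eps * `|x|.
Proof.
move=> oV V0 sPhi van eps0.
have [sg Dg] := smooth_onB oV sPhi (@smooth_cubic_eval _ _ p V).
set g := (fun x => Phi x - cubic_eval p x) in van sg Dg.
pose e' := eps / (n%:R + 1).
have e'0 : 0 < e' by rewrite divr_gt0 // ltr_wpDl.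
have near0 : nbhs (0 : 'rV[R]_n) [set x : 'rV[R]_n | V x /\ forall i j l, `|partials [:: l; j; i] g x| <= e'].
  apply: filterS2 (open_nbhs_nbhs (conj oV V0)) _ => [x Vx h|]; first by split=> //; exact: h.
  suff h i j l : nbhs (0 : 'rV[R]_n) [set x : 'rV[R]_n | `|partials [:: l; j; i] g x| <= e'].
    pose A i j l := [set x : 'rV[R]_n | `|partials [:: l; j; i] g x| <= e'].
    have := @filter_forall _ _ (fun i => [set x | forall j l, A i j l x]) (nbhs (0 : 'rV[R]_n)) _.
    apply => i; have := @filter_forall _ _ (fun j => [set x | forall l, A i j l x]) (nbhs (0 : 'rV[R]_n)) _.
    apply => j; have := @filter_forall _ _ (A i j) (nbhs (0 : 'rV[R]_n)) _.
    by apply => l; exact: h.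
  have [/continuous_at_dist/(_ _ e'0)[d d0 hd] _] := sg [:: l; j; i] 0 V0.
  apply/nbhs_ballP; exists d => // x; rewrite -ball_normE /= sub0r normrN => xd.
  have := hd x; rewrite subr0 => /(_ xd); rewrite van // subr0; exact: ltW.
have /nbhs_ballP[rho /= rho0 hrho] := near0.
have {}hrho (x : 'rV[R]_n) : `|x| < rho -> V x /\ forall i j l, `|partials [:: l; j; i] g x| <= e'.
  by move=> xr; apply: hrho; rewrite -ball_normE /= sub0r normrN.
exists rho => // x xr; have [Vx _] := hrho x xr; split=> // i j.
have := Dg [:: j; i] x Vx; rewrite /partials /= /cubic_eval !partial_meval mxE => <-.
have h : `|partials [:: j; i] g x| <= n%:R * e' * `|x|.
  apply: (@mvt_origin _ _ rho) => //; first exact: van.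
  move=> y yr l; have [Vy hy] := hrho y yr.
  by split; [have [_] := sg [:: j; i] y Vy|exact: hy].
apply: le_trans h _.
rewrite ler_wpM2r // /e' mulrA ler_pdivrMr ?ltr_wpDl // mulrC ler_wpM2l ?(ltW eps0) //.
by rewrite lerDl.
Qed.

(* [x = r y] turns the phase into one whose Hessian is almost that of the cubic form. *)
Definition phase (Phi : 'rV[R]_n -> R) (xi : 'rV[R]_n) (r : R) (y : 'rV[R]_n) : R :=
  r ^- 3 * (Phi (r *: y) + dotp xi (r *: y)).

Section Phase.
Variables (V : set 'rV[R]_n) (Phi : 'rV[R]_n -> R) (rho : R).
Hypotheses (sPhi : smooth_on V Phi) (VB : forall x : 'rV[R]_n, `|x| < rho -> V x).
Variables (xi : 'rV[R]_n) (r : R).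
Hypothesis r0 : 0 < r.
Let Q := [set y : 'rV[R]_n | `|r *: y| < rho].

Let continuous_scale f y : {for r *: y, continuous f} -> {for y, continuous (fun y : 'rV[R]_n => f (r *: y))}.
Proof.
have cL : continuous (fun y : 'rV[R]_n => r *: y : 'rV[R]_n) by exact: scaler_continuous.
by move=> cf; apply: continuous_comp; [exact: cL|exact: cf].
Qed.

Let oQ : open Q.
Proof.
rewrite /Q (_ : mkset _ = ( *:%R r) @^-1` box 0 rho); last first.
  by apply/seteqP; split=> y; rewrite /box /= subr0.
by apply: open_comp; [move=> x _; exact: scaler_continuous|exact: open_box].
Qed.

Lemma continuous_phase y : Q y -> {for y, continuous (phase Phi xi r)}.
Proof.
move=> Qy; apply: continuousM; first exact: cst_continuous.
apply: (@continuous_scale (fun x => Phi x + dotp xi x)); apply: continuousD.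
  by have [] := sPhi [::] (VB Qy).
exact: continuous_dotp.
Qed.

Lemma is_derive_phase y i : Q y ->
  is_derive y (e_ i) (phase Phi xi r) (r ^- 2 * (partial i Phi (r *: y) + xi 0 i)).
Proof.
move=> Qy; have [_ /(_ i)/derivableP d] := sPhi [::] (VB Qy).
have h := is_deriveD d (is_derive_dotp xi (r *: y) i).
have h' : is_derive (r *: y + 0) (e_ i) (Phi + dotp xi) (partial i Phi (r *: y) + xi 0 i).
  by rewrite addr0.
have := is_deriveZ (r ^- 3) (is_derive_scaled h').
set F := (X in is_derive _ _ X _); have -> : F = phase Phi xi r.
  by apply/funext => x; rewrite /F /= addr0.
move=> h2; apply: is_derive_eq h2 _; rewrite [LHS]mulrA; congr (_ * _).
by field; rewrite gt_eqF.
Qed.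

Lemma partial_phase y i : Q y ->
  partial i (phase Phi xi r) y = r ^- 2 * (partial i Phi (r *: y) + xi 0 i).
Proof. by move=> Qy; have [_] := is_derive_phase i Qy. Qed.

Lemma continuous_partial_phase y i : Q y -> {for y, continuous (partial i (phase Phi xi r))}.
Proof.
move=> Qy; apply: (@continuous_local _ _ (fun y => r ^- 2 * (partial i Phi (r *: y) + xi 0 i)) _ Q) => //.
  by move=> x Qx; rewrite partial_phase.
apply: continuousM; first exact: cst_continuous.
apply: continuousD; last exact: cst_continuous.
by apply: continuous_scale; have [] := sPhi [:: i] (VB Qy).
Qed.

Lemma is_derive_partial_phase y i j : Q y ->
  is_derive y (e_ j) (partial i (phase Phi xi r)) (r^-1 * partial j (partial i Phi) (r *: y)).
Proof.
move=> Qy; have [_ /(_ j)/derivableP d] := sPhi [:: i] (VB Qy).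
have h := is_deriveD d (is_derive_cst (xi 0 i) (r *: y) (e_ j)).
have h' : is_derive (r *: y + 0) (e_ j) (partial i Phi + cst (xi 0 i)) (partial j (partial i Phi) (r *: y) + 0).
  by rewrite addr0.
have := is_deriveZ (r ^- 2) (is_derive_scaled h').
set F := (X in is_derive _ _ X _).
have E x : Q x -> F x = partial i (phase Phi xi r) x.
  by move=> Qx; rewrite partial_phase // /F /= addr0.
move=> [dd DD]; apply/is_derive_eqP; split; first exact: ((partial_local j oQ Qy E).1 dd).
have -> : 'D_(e_ j) (partial i (phase Phi xi r)) y = partial j (partial i (phase Phi xi r)) y by [].
rewrite -(partial_local j oQ Qy E).2 /partial DD addr0 [LHS]mulrA; congr (_ * _).
by field; rewrite gt_eqF.
Qed.

Lemma partial2_phase y i j : Q y ->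
  partial j (partial i (phase Phi xi r)) y = r^-1 * partial j (partial i Phi) (r *: y).
Proof. by move=> Qy; have [_] := is_derive_partial_phase i j Qy. Qed.

(** The factor r^-1 on second derivatives is compensated by their bound K |x| for Phi; each further
    derivative brings a factor r, and r <= 1. The bounds are thus uniform in r, and also in xi,
    which two derivatives remove. *)
Lemma Cb_partial2_phase k M K B i j (Q' : set 'rV[R]_n) : r <= 1 -> 0 <= M -> 0 <= K -> 0 <= B ->
  open Q' -> Q' `<=` Q -> (forall y : 'rV[R]_n, Q' y -> `|y| <= B) ->
  Cb k M (box 0 rho) (partial j (partial i Phi)) -> (forall l, Cb k M (box 0 rho) (partial l (partial j (partial i Phi)))) ->
  (forall x : 'rV[R]_n, `|x| < rho -> `|partial j (partial i Phi) x| <= K * `|x|) ->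
  Cb k (M + K * B) Q' (partial j (partial i (phase Phi xi r))).
Proof.
move=> r1 M0 K0 B0 oQ' Q'Q Q'B h0 hM hK; set f := partial j (partial i Phi) in h0 hM hK.
have KB0 : 0 <= K * B by rewrite mulr_ge0.
apply: (@Cb_ext _ _ _ _ _ (fun y : 'rV[R]_n => r^-1 * f (r *: y))) => //.
  by move=> y Q'y; rewrite partial2_phase //; exact: Q'Q.
have val y : Q' y -> {for y, continuous (fun y : 'rV[R]_n => r^-1 * f (r *: y))} /\ `|r^-1 * f (r *: y)| <= M + K * B.
  move=> Q'y; have Qy := Q'Q y Q'y; split.
    apply: continuousM; first exact: cst_continuous.
    by apply: continuous_scale; have [] := sPhi [:: j; i] (VB Qy).
  rewrite normrM ger0_norm ?invr_ge0 ?(ltW r0) // mulrC ler_pdivrMr //.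
  apply: le_trans (hK _ Qy) _; rewrite normrZ ger0_norm ?(ltW r0) // mulrCA.
  rewrite [leRHS]mulrC ler_wpM2l ?(ltW r0) //.
  by apply: (@le_trans _ _ (K * B)); rewrite ?lerDr // ler_wpM2l // Q'B.
case: k h0 hM => [|k] h0 hM; first by split.
split=> // l.
have D y : Q' y -> is_derive y (e_ l) (fun y : 'rV[R]_n => r^-1 * f (r *: y)) (partial l f (r *: y)).
  move=> Q'y; have Qy := Q'Q y Q'y.
  have [_ /(_ l)/derivableP d] := sPhi [:: j; i] (VB Qy).
  have h' : is_derive (r *: y + 0) (e_ l) f (partial l f (r *: y)) by rewrite addr0.
  rewrite (_ : (fun y => _) = r^-1 \*: (fun x : 'rV[R]_n => f (r *: x + 0))); last first.
    by apply/funext => x; rewrite /= addr0.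
  by apply: is_derive_eq (is_deriveZ (r^-1) (is_derive_scaled h')) _; rewrite [LHS]mulrA mulVf ?mul1r // gt_eqF.
split=> [y Q'y|]; first by have [] := D y Q'y.
apply: (@Cb_ext _ _ k _ _ (fun y : 'rV[R]_n => partial l f (r *: y)) _ oQ').
  by move=> y Q'y; have [_] := D y Q'y.
apply: (@Cb_le _ _ _ M); first by rewrite lerDl.
apply: (@Cb_sub _ _ _ _ [set y | box 0 rho (r *: y + 0)]).
  by move=> y /Q'Q; rewrite /box /= addr0 subr0.
have r01 : 0 <= r <= 1 by rewrite ltW.
have -> : (fun y : 'rV[R]_n => partial l f (r *: y)) = (fun y : 'rV[R]_n => partial l f (r *: y + 0)).
  by apply/funext => y; rewrite addr0.
exact: (@Cb_affine _ _ k M _ _ r 0 (@open_box _ _ 0 rho) M0 r01 (CbS (hM l))).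
Qed.

End Phase.
End Smooth.

(** * Cut-off functions *)

Section Step.
Variable R : realType.

(** This treats the square of the positive part at 0 as at any other point, without one-sided
    derivatives. *)
Lemma is_derive_quadratic (f : R -> R) (t d K : R) :
  (forall h, `|f (t + h) - f t - d * h| <= K * h ^+ 2) -> is_derive t 1 f d.
Proof.
move=> hf; apply/is_derive_eqP.
have K0 : 0 <= K by have := le_trans (normr_ge0 _) (hf 1); rewrite expr1n mulr1.
have C : (fun h : R => h^-1 *: (f (h *: (1 : R) + t) - f t)) @ (0 : R)^' --> d.
  apply/cvgrPdist_le => e e0; near=> h.
  have h0 : h != 0 by near: h; exact: nbhs_dnbhs_neq.
  have hh : `|h| <= e / (K + 1).
    near: h; apply: dnbhs0_le; rewrite divr_gt0 // ltr_wpDl //.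
  have := hf h; rewrite [h *: 1]mulr1 [h + t]addrC; set D := f (t + h) - f t => hD.
  have -> : d - h^-1 *: D = - (h^-1 * (D - d * h)) by rewrite /GRing.scale /=; field.
  rewrite normrN normrM normfV ler_pdivrMl ?normr_gt0 //.
  apply: le_trans hD _; rewrite -real_normK ?num_real // expr2 mulrA mulrC ler_wpM2l //.
  apply: le_trans (ler_wpM2l K0 hh) _; rewrite mulrA ler_pdivrMr ?ltr_wpDl //.
  by rewrite mulrC ler_wpM2l ?(ltW e0) // lerDl.
by split; [apply/cvg_ex; exists d|apply: cvg_lim].
Unshelve. all: by end_near. Qed.

(** A power of the positive part is of class C^(p-1). The estimates use finitely many derivatives of
    the cut-offs, so steps built from such powers can replace the smooth ones built from
    exp(-1/t). *)
Definition tpow p (t : R) : R := Num.max t 0 ^+ p.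

Lemma tpow_ge0 p t : 0 <= tpow p t.
Proof. by rewrite exprn_ge0 // le_max lexx orbT. Qed.

Lemma continuous_tpow p : continuous (tpow p).
Proof.
move=> t; apply: (@continuous_comp _ _ _ (fun t : R => Num.max t 0) (fun t => t ^+ p)); last first.
  exact: exprn_continuous.
by apply: continuous_max => //; exact: cst_continuous.
Qed.

Lemma is_derive_tpow (p : nat) (t : R) : is_derive t (1 : R) (tpow p.+2) (p.+2%:R * tpow p.+1 t).
Proof.
elim: p t => [|p IH] t.
  apply: (@is_derive_quadratic _ _ _ 1) => h; rewrite /tpow expr1 mul1r.
  by case: (leP t 0) => t0; case: (leP (t + h) 0) => th0; rewrite ler_norml; apply/andP; split; nra.
have tpowS q : tpow q.+2 = id * tpow q.+1 :> (R -> R).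
  apply/funext => u; rewrite -[RHS]/(u * Num.max u 0 ^+ q.+1) /tpow [LHS]exprS.
  by case: (leP u 0) => // u0; rewrite exprS !mul0r mulr0.
rewrite tpowS; have := is_deriveM (is_derive_id t 1) (IH t).
move=> h; apply: is_derive_eq h _.
rewrite [X in X + _ = _]mulrCA -[X in _ * X + _](congr1 (fun F : R -> R => F t) (tpowS p)).
have -> : p.+3%:R = p.+2%:R + 1 :> R by rewrite natr1.
by rewrite [RHS]mulrDl mul1r; congr (_ + _); exact: mulr1.
Qed.

Variable N : nat.

Definition step (t : R) : R := tpow N.+1 t / (tpow N.+1 t + tpow N.+1 (1 - t)).

Lemma step_eq0 t : t <= 0 -> step t = 0.
Proof. by move=> t0; rewrite /step /tpow (max_idPr t0) expr0n mul0r. Qed.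

Lemma step_eq1 t : 1 <= t -> step t = 1.
Proof.
move=> t1; rewrite /step /tpow.
rewrite [X in _ + X](_ : _ = 0); last by rewrite max_r ?subr_le0 // expr0n.
by rewrite addr0 divff // expf_neq0 // max_l ?gt_eqF //; lra.
Qed.

(** One of t and 1 - t is at least 1/2. *)
Lemma step_denominator t : 2 ^- N.+1 <= tpow N.+1 t + tpow N.+1 (1 - t).
Proof.
have h (u : R) : 2^-1 <= u -> 2 ^- N.+1 <= tpow N.+1 u.
  move=> u2; rewrite -exprVn /tpow lerXn2r ?nnegrE ?invr_ge0 ?le_max ?lexx ?orbT //.
  by rewrite u2.
have [t2|t2] := leP 2^-1 t.
  by apply: le_trans (h _ t2) _; rewrite lerDl tpow_ge0.
have /h h2 : 2^-1 <= 1 - t by lra.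
by apply: le_trans h2 _; rewrite lerDr tpow_ge0.
Qed.

End Step.

Section Bumps.
Variables (R : realType) (n N : nat).
Implicit Types (f g : 'rV[R]_n -> R) (Q : set 'rV[R]_n).
Local Notation e_ i := (delta_mx 0 i : 'rV[R]_n).

Lemma Cb_tpow k p (i : 'I_n) (a b B : R) Q : open Q -> (k < p)%N -> 0 <= B ->
  (forall y : 'rV[R]_n, Q y -> `|y 0 i| <= B) ->
  exists2 M, 0 <= M & Cb k M Q (fun y : 'rV[R]_n => tpow p (a * y 0 i + b)).
Proof.
move=> oQ + B0 QB; pose M q := (`|a| * B + `|b|) ^+ q.
have M0 q : 0 <= M q by rewrite exprn_ge0 // addr_ge0 // mulr_ge0.
have val q y : Q y -> {for y, continuous (fun y : 'rV[R]_n => tpow q (a * y 0 i + b))} /\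
    `|tpow q (a * y 0 i + b)| <= M q.
  move=> Qy; split.
    apply: (@continuous_comp _ _ _ (fun y : 'rV[R]_n => a * y 0 i + b) (tpow q)); last exact: continuous_tpow.
    apply: continuousD; last exact: cst_continuous.
    by apply: continuousM; [exact: cst_continuous|exact: coord_continuous].
  rewrite ger0_norm ?tpow_ge0 // /tpow /M lerXn2r ?nnegrE ?le_max ?lexx ?orbT //.
    by rewrite addr_ge0 // mulr_ge0.
  rewrite ge_max addr_ge0 ?mulr_ge0 // andbT; apply: le_trans (ler_norm _) _.
  by apply: le_trans (ler_normD _ _) _; rewrite lerD2r normrM ler_wpM2l // QB.
elim: k p => [|k IH] p kp; first by exists (M p) => //; split=> // y; exact: val.
case: p kp => // -[//|p] kp.
have [M' M'0 hM'] := IH p.+1 kp.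
pose c := `|p.+2%:R * a|.
have c0 : 0 <= c by exact: normr_ge0.
exists (M p.+2 + c * M'); first by apply: addr_ge0 => //; exact: mulr_ge0.
split=> [y Qy|j].
  by have [cy ly] := val p.+2 y Qy; split=> //; apply: le_trans ly _; rewrite lerDl; exact: mulr_ge0.
have D y : is_derive y (e_ j) (fun y : 'rV[R]_n => tpow p.+2 (a * y 0 i + b))
    ((p.+2%:R * a * (j == i)%:R) * tpow p.+1 (a * y 0 i + b)).
  have d1 : is_derive y (e_ j) (fun y : 'rV[R]_n => a * y 0 i + b) (a * (j == i)%:R).
    have := is_deriveD (is_deriveZ a (is_derive_coord j i y)) (is_derive_cst b y (e_ j)).
    by rewrite addr0.
  have := @is_derive_comp1 R _ (tpow p.+2) (fun y : 'rV[R]_n => a * y 0 i + b) y (e_ j) _ _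
    (is_derive_tpow p _) d1.
  by move=> h; apply: is_derive_eq h _; ring.
split=> [y Qy|]; first by have [] := D y.
apply: (@Cb_ext _ _ k _ _ (fun y : 'rV[R]_n => (p.+2%:R * a * (j == i)%:R) * tpow p.+1 (a * y 0 i + b)) _ oQ).
  by move=> y _; have [_] := D y.
apply: (@Cb_le _ _ _ (`|p.+2%:R * a * (j == i)%:R| * M')); last exact: Cb_scale.
rewrite normrM -[leLHS]add0r; apply: lerD => //; rewrite ler_wpM2r //.
by case: (j == i); rewrite ?normr1 ?normr0 ?mulr1 ?mulr0.
Qed.

Lemma open_coord (i : 'I_n) (A : set R) : open A -> open [set y : 'rV[R]_n | A (y 0 i)].
Proof. by move=> oA; apply: (open_comp _ oA) => y _; exact: coord_continuous. Qed.

Definition Cbs f := exists2 A, 0 <= A & Cb N A setT f.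

(** Where |y_i| < 2 the quotient is controlled by [Cb_inv]; where y_i < 0 or y_i > 1 it is constant.
    These open sets cover the space, so the bounds glue. *)
Lemma Cbs_step_coord (i : 'I_n) : Cbs (fun y : 'rV[R]_n => step N (y 0 i)).
Proof.
pose Q := [set y : 'rV[R]_n | [set t | `|t| < 2] (y 0 i)].
pose Q0 := [set y : 'rV[R]_n | [set t | t < 0] (y 0 i)].
pose Q1 := [set y : 'rV[R]_n | [set t | t > 1] (y 0 i)].
have oQ : open Q.
  apply: open_coord; rewrite (_ : mkset _ = ball 0 2); first exact: ball_open.
  by apply/seteqP; split => t; rewrite -ball_normE /= sub0r normrN.
have oQ0 : open Q0 by apply: open_coord; exact: open_lt.
have oQ1 : open Q1 by apply: open_coord; exact: open_gt.
have QB y : Q y -> `|y 0 i| <= 2 by move=> /ltW.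
have [M1 M10 h1] := Cb_tpow 1 0 oQ (ltnSn N) (ler0n R 2) QB.
have [M2 M20 h2] := Cb_tpow (-1) 1 oQ (ltnSn N) (ler0n R 2) QB.
have p2 : 0 < 2 ^- N.+1 :> R by rewrite invr_gt0 exprn_gt0.
have [C C0 hC] := @Cb_inv R n N (M1 + M2) _ p2.
have E1 (y : 'rV[R]_n) : 1 * y 0 i + 0 = y 0 i by rewrite mul1r addr0.
have E2 (y : 'rV[R]_n) : -1 * y 0 i + 1 = 1 - y 0 i by rewrite mulN1r addrC.
have den (y : 'rV[R]_n) : Q y ->
    2 ^- N.+1 <= `|tpow N.+1 (1 * y 0 i + 0) + tpow N.+1 (-1 * y 0 i + 1)|.
  by move=> _; rewrite E1 E2; apply: le_trans (step_denominator _ _) (ler_norm _).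
have hQ : Cb N (2 ^+ N * (M1 * C)) Q (fun y : 'rV[R]_n => step N (y 0 i)).
  apply: Cb_ext (Cb_mul oQ h1 (hC _ _ oQ (Cb_add oQ h1 h2) den)) => // y _.
  by rewrite E1 E2.
exists (2 ^+ N * (M1 * C) + 1); first by rewrite addr_ge0 // !mulr_ge0.
have -> : setT = Q `|` (Q0 `|` Q1).
  apply/seteqP; split=> // y _; rewrite /Q /Q0 /Q1 /=.
  have [y0|y0] := ltP (y 0 i) 0; first by right; left.
  have [y1|y1] := ltP 1 (y 0 i); first by right; right.
  by left; rewrite ger0_norm //; lra.
apply: Cb_union; first by apply: Cb_le hQ; rewrite lerDl.
have b1 : 1 <= 2 ^+ N * (M1 * C) + 1 by rewrite lerDr !mulr_ge0.
apply: Cb_le b1 _; apply: Cb_union.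
  apply: (@Cb_ext _ _ _ _ _ (fun=> 0)) => // [y y0|]; first by rewrite step_eq0 // ltW.
  by apply: Cb_cst => //; rewrite normr0.
apply: (@Cb_ext _ _ _ _ _ (fun=> 1)) => // [y y0|]; first by rewrite step_eq1 // ltW.
by apply: Cb_cst => //; rewrite normr1.
Qed.

Lemma Cbs_dilate f r b : 0 <= r -> Cbs f -> Cbs (fun y => f (r *: y + b)).
Proof.
move=> r0 [A A0 hA]; exists (Num.max 1 r ^+ N * A).
  by rewrite mulr_ge0 // exprn_ge0 // le_max ler01.
exact: (Cb_dilate b openT A0 r0 hA).
Qed.

Lemma CbsM f g : Cbs f -> Cbs g -> Cbs (fun y => f y * g y).
Proof.
move=> [A A0 hA] [B B0 hB]; exists (2 ^+ N * (A * B)); first by rewrite !mulr_ge0.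
exact: Cb_mul openT hA hB.
Qed.

Lemma CbsB f g : Cbs f -> Cbs g -> Cbs (fun y => f y - g y).
Proof.
move=> [A A0 hA] [B B0 hB]; exists (A + `|-1 : R| * B); first by rewrite addr_ge0 // mulr_ge0.
have := Cb_add openT hA (Cb_scale (-1) openT hB).
by apply: Cb_ext => [|y _]; [exact: openT|rewrite mulN1r].
Qed.

Lemma Cbs_prod (I : Type) (s : seq I) (F : I -> 'rV[R]_n -> R) :
  (forall i, Cbs (F i)) -> Cbs (fun y => \prod_(i <- s) F i y).
Proof.
move=> hF; elim: s => [|i s IH].
  exists 1 => //; apply: Cb_ext (Cb_cst N _ _) => [|y _||]; try exact: openT.
    by rewrite big_nil.
  by rewrite normr1.
have [A A0 hA] := CbsM (hF i) IH; exists A => //.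
by apply: Cb_ext hA => [|y _]; [exact: openT|rewrite big_cons].
Qed.

Lemma Cbs_step (i : 'I_n) (a b : R) : 0 <= a -> Cbs (fun y : 'rV[R]_n => step N (a * y 0 i + b)).
Proof.
move=> a0; have [A A0 hA] := Cbs_dilate (const_mx b) a0 (Cbs_step_coord i).
by exists A => //; apply: Cb_ext hA => [|y _]; [exact: openT|rewrite !mxE].
Qed.

Definition chi (y : 'rV[R]_n) : R := \prod_i (step N (y 0 i + 2) - step N (y 0 i - 1)).

Lemma Cbs_chi : Cbs chi.
Proof.
apply: Cbs_prod => i; apply: CbsB.
  by have := @Cbs_step i 1 2 ler01; under eq_fun do rewrite mul1r.
by have := @Cbs_step i 1 (-1) ler01; under eq_fun do rewrite mul1r.
Qed.

Lemma chi_eq1 (y : 'rV[R]_n) : `|y| <= 1 -> chi y = 1.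
Proof.
move=> y1; apply: big1 => i _; have := le_trans (coord_le_norm y i) y1.
rewrite ler_norml => /andP[h1 h2].
by rewrite step_eq1 ?step_eq0 ?subr0 //; lra.
Qed.

Lemma chi_eq0 (y : 'rV[R]_n) : 2 <= `|y| -> (0 < n)%N -> chi y = 0.
Proof.
move=> y2 n0; have [i yi] : exists i, 2 <= `|y 0 i|.
  apply: contrapT => /forallNP h; have : `|y| < 2; last by rewrite ltNge y2.
  by apply/norm_rV_lt => // i; rewrite ltNge; apply/negP; exact: h.
rewrite /chi (bigD1 i) //= [X in X * _](_ : _ = 0) ?mul0r //.
have [yi0|yi0] := leP 0 (y 0 i); move: yi.
  by rewrite ger0_norm // => yi; rewrite !step_eq1 ?subrr //; lra.
by rewrite ltr0_norm // => yi; rewrite !step_eq0 ?subrr //; lra.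
Qed.

Definition annulus (y : 'rV[R]_n) : R := chi y - chi (2 *: y).

Lemma Cbs_annulus : Cbs annulus.
Proof.
apply: CbsB; first exact: Cbs_chi.
have := Cbs_dilate 0 (ler0n R 2) Cbs_chi.
by under eq_fun do rewrite addr0.
Qed.

Lemma annulus_neq0 (y : 'rV[R]_n) : (0 < n)%N -> annulus y != 0 -> 2^-1 <= `|y| <= 2.
Proof.
move=> n0 h; apply/andP; split; rewrite leNgt; apply: contra h => yn; rewrite /annulus.
  rewrite !chi_eq1 ?subrr // ?normrZ ?ger0_norm //; last by lra.
  by move: yn; set u := `|y|; lra.
rewrite !chi_eq0 ?subrr // ?normrZ ?ger0_norm //; last by lra.
by move: yn; set u := `|y|; lra.
Qed.

(** Each factor is a difference of consecutive translates of one step: it vanishes outside an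
    interval of length 2 d centred at d (k_i + 1 - K), whence [cell_center]. Its sum over k_i
    telescopes to 1 on |y_i| <= d (K - 1). *)
Definition cell (d : R) K (k : {ffun 'I_n -> 'I_(2 * K)}) (y : 'rV[R]_n) : R :=
  \prod_i (step N (d^-1 * y 0 i + (K%:R - (k i)%:R)) - step N (d^-1 * y 0 i + (K%:R - (k i).+1%:R))).

Definition cell_center (d : R) K (k : {ffun 'I_n -> 'I_(2 * K)}) : 'rV[R]_n :=
  \row_i (d * ((k i).+1%:R - K%:R)).

Lemma Cbs_cell d K (k : {ffun 'I_n -> 'I_(2 * K)}) : 0 < d -> Cbs (cell d k).
Proof.
move=> d0; have d1 : 0 <= d^-1 by rewrite invr_ge0 ltW.
by apply: Cbs_prod => i; apply: CbsB; exact: Cbs_step.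
Qed.

Lemma zero_off_cell d K (k : {ffun 'I_n -> 'I_(2 * K)}) : 0 < d ->
  zero_off (cell_center d k) d (cell d k).
Proof.
move=> d0 y yd; have [i yi] : exists i, d < `|(y - cell_center d k) 0 i|.
  apply: contrapT => /forallNP h; have : `|y - cell_center d k| <= d; last by rewrite leNgt yd.
  by apply/norm_rV_le => [|i]; [exact: ltW|rewrite leNgt; apply/negP; exact: h].
rewrite /cell (bigD1 i) //= [X in X * _](_ : _ = 0) ?mul0r //.
move: yi; rewrite !mxE; set u := d^-1 * y 0 i.
have -> : y 0 i = d * u by rewrite /u mulVKf // gt_eqF.
rewrite -mulrBr normrM gtr0_norm // ltr_pMr // -natr1; set w := (k i : nat)%:R; set KK := K%:R.
have [h|h] := leP 0 (u - (w + 1 - KK)).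
  by rewrite ger0_norm // => h1; rewrite !step_eq1 ?subrr //; lra.
by rewrite ltr0_norm // => h1; rewrite !step_eq0 ?subrr //; lra.
Qed.

Lemma sum_cell d K (y : 'rV[R]_n) : 0 < d -> `|y| <= d * (K%:R - 1) ->
  \sum_(k : {ffun 'I_n -> 'I_(2 * K)}) cell d k y = 1.
Proof.
move=> d0 yK.
pose G i (k : 'I_(2 * K)) := step N (d^-1 * y 0 i + (K%:R - (k : nat)%:R)) - step N (d^-1 * y 0 i + (K%:R - (k : nat).+1%:R)).
have -> : \sum_(k : {ffun 'I_n -> 'I_(2 * K)}) cell d k y =
    \sum_(k : {ffun 'I_n -> 'I_(2 * K)}) \prod_i G i (k i) by [].
rewrite -(bigA_distr_bigA G); apply: big1 => i _.
pose f k := - step N (d^-1 * y 0 i + (K%:R - k%:R)).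
have -> : \sum_(k < 2 * K) G i k = \sum_(0 <= k < 2 * K) (f k.+1 - f k).
  by rewrite big_mkord; apply: eq_bigr => k _; rewrite /f opprK addrC.
rewrite telescope_sumr // /f opprK addrC subr0.
have : `|d^-1 * y 0 i| <= K%:R - 1.
  rewrite normrM gtr0_norm ?invr_gt0 // ler_pdivrMl //; apply: le_trans yK; exact: coord_le_norm.
rewrite ler_norml => /andP[h1 h2].
rewrite natrM (@step_eq1 _ _ (_ + K%:R)) ?(@step_eq0 _ _ (_ + (K%:R - _))) ?subr0 //; lra.
Qed.

End Bumps.

(** * Dyadic decomposition *)

Section Pieces.
Variables (R : realType) (n m : nat) (V : set 'rV[R]_n) (Phi : 'rV[R]_n -> R).
Variables (p : cubic_form R n) (c : R).
Hypotheses (n0 : (0 < n)%N) (m0 : (0 < m)%N) (oV : open V) (V0 : V 0) (sPhi : smooth_on V Phi).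
Hypothesis van : vanishes_to_fourth_order (fun x => Phi x - cubic_eval p x).
Hypotheses (c0 : 0 < c) (nd : forall x, nondeg m (c * `|x|) (hessp (p : dhomog n R 3) x)).
Local Notation e_ i := (delta_mx 0 i : 'rV[R]_n).

Lemma integral_rV_eq0 (f : 'rV[R]_n -> R) : (forall x, f x = 0) -> integral_rV f = 0.
Proof.
move=> f0; apply/eqP; rewrite -normr_le0.
have -> : 0 = 0 * integral_rV (bump (0 : 'rV[R]_n) 0) by rewrite mul0r.
apply: (@norm_integral_off _ _ 0) => [|x _|x]; rewrite ?f0 ?normr0 //.
by rewrite (_ : f = cst 0); [exact: cst_continuous|apply/funext].
Qed.

(** The annulus is cut into cells so small that on each of them the Hessian of the rescaled phase
    stays close to that of p at the centre. The number of cells depends on none of xi, theta, r and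
    L, so the bounds of [cell_estimate] can simply be added. *)
Lemma piece_estimate : exists2 rho, 0 < rho & (forall x : 'rV[R]_n, `|x| < rho -> V x) /\
  forall psi A, 0 <= A -> Cb (2 * m) A setT psi -> exists2 C, 0 <= C &
    forall (xi : 'rV[R]_n) theta r (L : nat), 0 < r -> r <= 1 -> r * 4 <= rho -> (0 < L)%N ->
    `|integral_rV (fun y : 'rV[R]_n => cos (L%:R * phase Phi xi r y + theta) * (psi (r *: y) * annulus (2 * m) y))|
      <= C * Num.sqrt (L%:R ^- m).
Proof.
have hom := @homog_dhomog R n 3 p.
pose hp := hessp (p : dhomog n R 3).
have hp0 j i : hp 0 j i = 0 by rewrite /hp -(scale0r (0 : 'rV[R]_n)) hesspZ // scale0r mxE.
have [K K0 lip] := hessp_lipschitz hom.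
pose nm : R := 2 * n%:R * m%:R.
have nm0 : 0 < nm by rewrite !mulr_gt0 // ltr0n.
(* Two errors of at most c / 8 each, from replacing Phi by p on |x| < 4 and from moving by less than
   4 d away from the centre, add up to c / 4, the nondegeneracy available at |z| >= 1/4. *)
pose eps := c / (32 * nm).
have eps0 : 0 < eps by rewrite divr_gt0 // mulr_gt0.
have [rho1 rho10 hrho1] := hessian_at_origin oV V0 sPhi van eps0.
pose rho := rho1 / 2.
have rho0 : 0 < rho by rewrite divr_gt0.
have rho01 : rho < rho1 by rewrite /rho; lra.
have VB (x : 'rV[R]_n) : `|x| < rho -> V x by move=> xr; have [] := hrho1 x (lt_trans xr rho01).
have [M M0 hM] : exists2 M : R, 0 <= M & Cb (2 * m).+3 M (box 0 rho) Phi.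
  apply: (@smooth_on_Cb R n _ V Phi _ _ (@compact_norm_ball R n 0 rho)) => // x.
    by rewrite /= subr0 => xr; have [] := hrho1 x (le_lt_trans xr rho01).
  by move=> /ltW.
have hM2 i j : Cb (2 * m).+1 M (box 0 rho) (partial j (partial i Phi)).
  by have [_ /(_ i)[_ [_ /(_ j)[]]]] := hM.
have hM3 i j l : Cb (2 * m) M (box 0 rho) (partial l (partial j (partial i Phi))).
  by have [_ /(_ l)[]] := hM2 i j.
have hPhi2 i j (x : 'rV[R]_n) : `|x| < rho -> `|partial j (partial i Phi) x| <= (eps + K) * `|x|.
  move=> xr; have [_ /(_ i j) h] := hrho1 x (lt_trans xr rho01).
  have hh := lip x 0 j i; rewrite -/hp hp0 !subr0 in hh.
  rewrite mulrDl -(subrK (hp x j i) (partial j _ x)); apply: le_trans (ler_normD _ _) _.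
  exact: lerD.
(* With d <= 1/4, a cell that meets the annulus has its centre at |z| >= 1/4, and the box of radius
   4 d around it lies in |x| < 4. The second bound limits the variation of the Hessian on that
   box. *)
pose d := Num.min 4^-1 (c / (32 * (K + 1) * nm)).
have K1 : 0 < K + 1 by rewrite ltr_wpDl.
have D0 : 0 < 32 * (K + 1) * nm by apply: mulr_gt0 => //; exact: mulr_gt0.
have d0 : 0 < d by rewrite lt_min invr_gt0 ltr0n divr_gt0.
have d4 : d <= 4^-1 by rewrite ge_min lexx.
have dK : K * (4 * d) * nm <= c / 8.
  have h : d * (32 * (K + 1) * nm) <= c.
    by rewrite -ler_pdivlMr // ge_min lexx orbT.
  have : K * d * nm <= (K + 1) * d * nm by rewrite !ler_wpM2r ?(ltW nm0) ?(ltW d0) // lerDl.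
  by lra.
have e4 : eps * 4 * nm <= c / 8.
  by have : eps * (32 * nm) = c; [rewrite /eps divfK // gt_eqF // mulr_gt0|lra].
pose N := (2 * m)%N.
have [P hP] : exists P : nat, 2 <= d * (P%:R - 1).
  exists (Num.bound (2 / d)).+1.
  have -> : (Num.bound (2 / d)).+1%:R - 1 = (Num.bound (2 / d))%:R :> R by rewrite -natr1 addrK.
  rewrite mulrC -ler_pdivrMr //; by apply/ltW; apply: le_lt_trans (archi_boundP _); rewrite ?divr_ge0 // ?ltW.
pose T : finType := {ffun 'I_n -> 'I_(2 * P)}.
have /choice[B hB] : forall k : T, exists B, 0 <= B /\ Cb N B setT (fun y : 'rV[R]_n => annulus N y * cell N d k y).
  move=> k; have [B B0 h] := CbsM (Cbs_annulus R n N) (Cbs_cell N k d0).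
  by exists B.
exists rho => //; split=> // psi A A0 hpsi.
have B0 : 0 <= \sum_k B k by apply: sumr_ge0 => k _; have [] := hB k.
pose M' := M + (eps + K) * 4.
have M'0 : 0 <= M' by rewrite addr_ge0 // mulr_ge0 // addr_ge0 // ltW.
pose A' := 2 ^+ N * (A * \sum_k B k).
have A'0 : 0 <= A' by rewrite mulr_ge0 ?exprn_ge0 // mulr_ge0.
have c4 : 0 < c / 4 by rewrite divr_gt0.
have [C C0 hC] := @cell_estimate R n m M' A' (c / 4) d m0 M'0 c4 A'0 d0.
exists (#|T|%:R * Num.sqrt C); first by rewrite mulr_ge0 // sqrtr_ge0.
move=> xi theta r L r0 r1 r4 L0.
pose a (k : T) (y : 'rV[R]_n) := psi (r *: y) * (annulus N y * cell N d k y).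
have ha k : Cb N A' setT (a k).
  have hr : Cb N A setT (fun y : 'rV[R]_n => psi (r *: y)).
    have r01 : 0 <= r <= 1 by rewrite ltW.
    apply: Cb_ext (Cb_affine 0 openT A0 r01 hpsi); first exact: openT.
    by move=> y _; rewrite addr0.
  apply: Cb_le (Cb_mul openT hr (hB k).2).
  rewrite ler_wpM2l ?exprn_ge0 // ler_wpM2l // (bigD1 k) //= lerDl sumr_ge0 // => j _.
  by have [] := hB j.
have Qlt (y : 'rV[R]_n) : `|y| < 4 -> `|r *: y| < rho.
  move=> y4; rewrite normrZ gtr0_norm //; apply: lt_le_trans r4.
  by rewrite ltr_pM2l.
have oa k : zero_off 0 2 (a k).
  move=> y; rewrite subr0 => y2; rewrite /a; have [->|h] := eqVneq (annulus N y) 0.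
    by rewrite mul0r mulr0.
  by have := annulus_neq0 n0 h; rewrite [_ <= 2]leNgt y2 andbF.
pose F k (y : 'rV[R]_n) := cos (L%:R * phase Phi xi r y + theta) * a k y.
have ccF k : cc (F k).
  apply: (@cc_off _ _ 0 2) => [|y y2]; last by rewrite /F oa // mulr0.
  apply: (@continuous_mul_off _ _ 0 2 [set y : 'rV[R]_n | `|r *: y| < rho]) => //.
  - by move=> y; rewrite subr0 => y2; apply: Qlt; apply: le_lt_trans y2 _; rewrite ltr_nat.
  - by move=> y Qy; apply: continuous_cos_phase; exact: (continuous_phase sPhi VB).
  - by move=> y; apply: (Cb_cts (ha k)).
have -> : (fun y : 'rV[R]_n => cos (L%:R * phase Phi xi r y + theta) * (psi (r *: y) * annulus N y)) =
    (fun y => \sum_k F k y).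
  apply/funext => y; rewrite -mulr_sumr; congr (_ * _); rewrite -mulr_sumr -mulr_sumr.
  have [->|h] := eqVneq (annulus N y) 0; first by rewrite mul0r.
  have /andP[_ y2] := annulus_neq0 n0 h.
  by rewrite sum_cell ?mulr1 //; apply: le_trans y2 hP.
rewrite integral_rV_sum //; apply: le_trans (ler_norm_sum _ _ _) _.
have -> : #|T|%:R * Num.sqrt C * Num.sqrt (L%:R ^- m) = \sum_(k : T) Num.sqrt (C / L%:R ^+ m).
  rewrite sumr_const sqrtrM // -mulrA -[RHS]mulr_natl.
  by congr (_%:R * _).
apply: ler_sum => k _; rewrite -sqrtr_sqr ler_wsqrtr //.
(* A cell that misses the annulus contributes 0. It must be set aside because its centre may be
   close to the origin, where the Hessian degenerates. *)
have [/existsNP[y yk]|h] := pselect (~ forall y : 'rV[R]_n, annulus N y * cell N d k y = 0); last first.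
  rewrite integral_rV_eq0 => [|y]; first by rewrite expr0n /= divr_ge0 // exprn_ge0.
  by rewrite /F /a (contrapT h) !mulr0.
move/eqP: yk; rewrite mulf_eq0 negb_or => /andP[ya yc].
pose z := cell_center d k.
have yz : `|y - z| <= d by rewrite leNgt; apply: contra yc => /(zero_off_cell N d0) ->.
have /andP[y2 y2'] := annulus_neq0 n0 ya.
have z4 : 4^-1 <= `|z|.
  have := ler_normD (y - z) z; rewrite subrK => h.
  by move: y2 yz h d4; move: `|y| `|y - z| `|z| => u v w; lra.
have box4 (x : 'rV[R]_n) : box z (4 * d) x -> `|x| < 4.
  rewrite /box /= => xz; have h1 := ler_normD (x - z) z; rewrite subrK in h1.
  have h2 := ler_normD (z - y) y; rewrite subrK distrC in h2.
  by move: xz h1 h2 y2' yz d4; move: `|x| `|x - z| `|z| `|y - z| `|y| => u v w s t; lra.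
have [E E1 HE] : nondeg m (c / 4) (hp z).
  by apply: nondeg_le (nd z); rewrite ler_pM2l.
apply: (hC z (phase Phi xi r) (a k) (hp z) E L theta); [exact: L0| | |exact: E1|exact: HE|exact: ha|].
- move=> x xz; have Qx := Qlt x (box4 x xz).
  split; first exact: (continuous_phase sPhi VB).
  move=> i; split.
  + by have [] := is_derive_phase sPhi VB xi r0 i Qx.
  + exact: (continuous_partial_phase sPhi VB r0 Qx).
  + move=> j; split; first by have [] := is_derive_partial_phase sPhi VB xi r0 i j Qx.
    rewrite (partial2_phase sPhi VB xi r0 i j Qx).
    have [_ /(_ i j) h1] := hrho1 (r *: x) (lt_trans Qx rho01).
    have h2 := lip x z j i.
    have h3 : `|r^-1 * partial j (partial i Phi) (r *: x) - hp x j i| <= eps * 4.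
      have -> : r^-1 * partial j (partial i Phi) (r *: x) - hp x j i =
          r^-1 * (partial j (partial i Phi) (r *: x) - hp (r *: x) j i).
        have -> : hp (r *: x) j i = r * hp x j i by rewrite /hp (hesspZ _ _ hom) [LHS]mxE.
        by rewrite mulrBr mulKf // gt_eqF.
      rewrite normrM gtr0_norm ?invr_gt0 // ler_pdivrMl //; apply: le_trans h1 _.
      rewrite normrZ gtr0_norm // mulrCA ler_pM2l // ler_pM2l //; exact/ltW/box4.
    have h4 : `|hp x j i - hp z j i| <= K * (4 * d).
      by apply: le_trans h2 _; rewrite ler_wpM2l //; exact: ltW.
    rewrite -/nm; apply: (@le_trans _ _ ((eps * 4 + K * (4 * d)) * nm)).
      rewrite ler_pM2r //; apply: le_trans (lerD h3 h4).
      exact: ler_distD.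
    by rewrite mulrDl; apply: le_trans (lerD e4 dK) _; lra.
- move=> i j; apply: (@Cb_partial2_phase _ _ _ _ _ sPhi VB xi _ r0 _ M (eps + K) 4) => //.
  + by rewrite addr_ge0 // ltW.
  + exact: open_box.
  + by move=> y' /box4/Qlt.
  + by move=> y' /box4/ltW.
  + exact: CbS (hM2 i j).
  + exact: hPhi2.
- by move=> x xz; rewrite /a (zero_off_cell N d0 xz) !mulr0.
Qed.

End Pieces.

(** * Summation over the dyadic scales *)

Section Dyadic.
Variables (R : realType) (n m : nat) (V : set 'rV[R]_n) (Phi : 'rV[R]_n -> R).
Variables (p : cubic_form R n) (c : R).
Hypotheses (n0 : (0 < n)%N) (m0 : (0 < m)%N) (oV : open V) (V0 : V 0) (sPhi : smooth_on V Phi).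
Hypothesis van : vanishes_to_fourth_order (fun x => Phi x - cubic_eval p x).
Hypotheses (c0 : 0 < c) (nd : forall x, nondeg m (c * `|x|) (hessp (p : dhomog n R 3) x)).
Hypothesis nm : (2 * n < 3 * m)%N.

Lemma integral_rV_rescale (f : 'rV[R]_n -> R) r : 0 < r -> cc f ->
  integral_rV f = r ^+ n * integral_rV (fun y => f (r *: y)).
Proof.
move=> r0 cf; have := integral_rV_affine 0 r0 cf; rewrite integral_rVZ //.
have -> : (fun x : 'rV[R]_n => f (r *: x + 0)) = (fun x => f (r *: x)).
  by apply/funext => x; rewrite addr0.
by move=> ->; rewrite mulrA mulfV ?mul1r // expf_neq0 // gt_eqF.
Qed.

Lemma cc_chi N : cc (@chi R n N).
Proof.
split=> [x|]; last by exists 2 => x /ltW x2; exact: chi_eq0.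
by have [A _ h] := Cbs_chi R n N; exact: (Cb_cts h).
Qed.

Lemma cc_rescale (f : 'rV[R]_n -> R) r : 0 < r -> cc f -> cc (fun x => f (r *: x)).
Proof.
move=> r0 cf; have := affine_rV 0 r0 cf.
have -> // : (fun x : 'rV[R]_n => f (r *: x + 0)) = (fun x => f (r *: x)).
by apply/funext => x; rewrite addr0.
Qed.

Lemma cc_annulus N : cc (@annulus R n N).
Proof.
split=> [x|]; last first.
  exists 2 => x x2; apply/eqP; apply: contraTT x2 => /(annulus_neq0 n0)/andP[_].
  by rewrite -leNgt.
by have [A _ h] := Cbs_annulus R n N; exact: (Cb_cts h).
Qed.

Lemma chi_dyadic N (s : R) K (x : 'rV[R]_n) : chi N ((2 ^+ K * s)^-1 *: x) =
  chi N (s^-1 *: x) + \sum_(j < K) annulus N ((2 ^+ j.+1 * s)^-1 *: x).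
Proof.
elim: K => [|K IH]; first by rewrite big_ord0 addr0 mul1r.
rewrite big_ord_recr /= addrA -IH /annulus scalerA exprS -mulrA.
have -> : 2 * (2 * (2 ^+ K * s))^-1 = (2 ^+ K * s)^-1 :> R by rewrite invfM mulVKf ?pnatr_eq0.
by rewrite addrC subrK.
Qed.

Lemma geometric_le (q : R) K : 0 <= q -> q < 1 -> \sum_(j < K) q ^+ j.+1 <= (1 - q)^-1.
Proof.
move=> q0 q1; have q1' : 0 < 1 - q by rewrite subr_gt0.
have h : (1 - q) * \sum_(j < K) q ^+ j.+1 = q - q ^+ K.+1.
  elim: K => [|K IH]; first by rewrite big_ord0 mulr0 subrr.
  by rewrite big_ord_recr /= mulrDr IH [q ^+ K.+2]exprS; ring.
rewrite -(ler_pM2l q1') h mulfV ?gt_eqF // lerBlDr.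
by apply: le_trans (ltW q1) _; rewrite lerDl exprn_ge0.
Qed.

Lemma compact_support_eq0 (psi : 'rV[R]_n -> R) w x :
  compactly_supported_in (box 0 w) psi -> w <= `|x| -> psi x = 0.
Proof.
move=> [_ sub] wx; apply/eqP/negPn/negP => px.
have : box 0 w x by apply: sub; apply: subset_closure.
by rewrite /box /= subr0 ltNge wx.
Qed.

(** As s^3 lambda = 1 holds exactly, the large parameter r^3 lambda at the scale r = 2^(j+1) s is
    the integer 8^(j+1), which [piece_estimate] takes as its L. *)
Lemma real_oscillatory_estimate : exists2 w, 0 < w & (forall x : 'rV[R]_n, `|x| < w -> V x) /\
  forall psi, smooth_on setT psi -> compactly_supported_in (box 0 w) psi ->
  exists2 C, 0 <= C & forall (xi : 'rV[R]_n) theta lambda s, 0 < s -> s ^+ 3 * lambda = 1 ->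
    `|integral_rV (fun x : 'rV[R]_n => cos (lambda * (Phi x + dotp xi x) + theta) * psi x)| <= C * s ^+ n.
Proof.
have [rho rho0 [VB piece]] := piece_estimate n0 m0 oV V0 sPhi van c0 nd.
(* All scales that occur satisfy r < 2 w, hence r <= 1 and 4 r <= rho. *)
pose w := Num.min 2^-1 (rho / 8).
have w0 : 0 < w by rewrite lt_min invr_gt0 ltr0n divr_gt0.
have w2 : w <= 2^-1 by rewrite ge_min lexx.
have w8 : w * 8 <= rho by rewrite -ler_pdivlMr // ge_min lexx orbT.
have wrho : w < rho by lra.
exists w => //; split=> [x xw|psi spsi supp]; first exact/VB/(lt_trans xw).
pose N := (2 * m)%N.
have psi0 x : w <= `|x| -> psi x = 0 by exact: compact_support_eq0 supp.
have [A A0 hA] : exists2 A : R, 0 <= A & Cb N A setT psi.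
  have [A A0 hA] : exists2 A : R, 0 <= A & Cb N A (box 0 (2 * w)) psi.
    by apply: (@smooth_on_Cb R n _ setT psi _ _ (@compact_norm_ball R n 0 (2 * w))) => // x /ltW.
  exists A => //; pose Q' := [set x : 'rV[R]_n | w < `|x - 0|].
  have -> : setT = box 0 (2 * w) `|` Q'.
    apply/seteqP; split=> // x _; rewrite /box /Q' /= subr0.
    by have [|h] := ltP w `|x|; [right|left; apply: le_lt_trans h _; lra].
  apply: Cb_union => //; apply: (@Cb_ext _ _ _ _ _ (fun=> 0)); first exact: open_off.
    by move=> x; rewrite /Q' /= subr0 => /ltW/psi0.
  by apply: Cb_cst; [exact: open_off|rewrite normr0].
have [C1 C10 hC1] := piece psi A A0 hA.
have [X X0 hX] := Cbs_chi R n N.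
pose C0 := A * X * integral_rV (bump (0 : 'rV[R]_n) 2).
have C00 : 0 <= C0.
  rewrite !mulr_ge0 //; have := @norm_integral_off R n 0 2 (fun=> 0) 1.
  rewrite mul1r => h; apply: le_trans (normr_ge0 _) (h _ _ _) => [x|//|x]; last by rewrite normr0.
  exact: cst_continuous.
pose B : R := Num.sqrt (8 ^- m).
(* The ratio of the geometric series; its square is 2^(2n) / 2^(3m), below 1 by [nm]. *)
pose q := 2 ^+ n * B.
have q0 : 0 <= q by rewrite mulr_ge0 ?exprn_ge0 // sqrtr_ge0.
have q1 : q < 1.
  rewrite -(@ltr_pXn2r _ 2) // ?nnegrE // expr1n exprMn sqr_sqrtr ?invr_ge0 ?exprn_ge0 //.
  rewrite ltr_pdivrMr ?exprn_gt0 // mul1r -exprM.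
  have -> : 8 = 2 ^+ 3 :> R by rewrite !exprS expr0; ring.
  by rewrite -exprM ltr_eXn2l ?ltr1n // mulnC.
exists (C0 + C1 / (1 - q)); first by rewrite addr_ge0 // divr_ge0 // subr_ge0 ltW.
move=> xi theta lambda s s0 sl.
pose g (x : 'rV[R]_n) := cos (lambda * (Phi x + dotp xi x) + theta) * psi x.
have ccg : cc g.
  have zpsi : zero_off 0 w psi by move=> x; rewrite subr0 => /ltW/psi0.
  apply: (@cc_off _ _ 0 w) => [|x xw]; last by rewrite /g zpsi // mulr0.
  apply: (@continuous_mul_off _ _ 0 w (box 0 rho)) => //.
  - by move=> x /= xw; rewrite /box /=; apply: le_lt_trans xw _.
  - move=> x; rewrite /box /= subr0 => xr; apply: (@continuous_cos_phase _ _ (fun x => Phi x + dotp xi x)).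
    by apply: continuousD; [have [] := sPhi [::] (VB _ xr)|exact: continuous_dotp].
  - by move=> x; exact: (Cb_cts hA).
(* At the scale 2^K s the cut-off [chi] is 1 on the support of psi, and minimality of K keeps the
   scales of the annuli below 2 w. If s >= w, which is the case of small lambda, then K = 0 and only
   the central piece is left. *)
have [K wK Kmin] : exists2 K, w <= 2 ^+ K * s & forall j, (j < K)%N -> 2 ^+ j * s < w.
  have ex : exists k, w <= 2 ^+ k * s.
    exists (Num.bound (w / s)); rewrite -ler_pdivrMr //; apply/ltW.
    apply: lt_le_trans (archi_boundP _) _; first by rewrite divr_ge0 // ltW.
    by rewrite -natrX ler_nat ltnW // ltn_expl.
  case: (ex_minnP ex) => K wK Kmin; exists K => // j jK; rewrite ltNge; apply/negP => h.
  by have := Kmin j h; rewrite leqNgt jK.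
pose rr j : R := 2 ^+ j * s.
have rr0 j : 0 < rr j by rewrite mulr_gt0 // exprn_gt0.
have gE x : g x = g x * chi N (s^-1 *: x) + \sum_(j < K) g x * annulus N ((rr j.+1)^-1 *: x).
  rewrite -mulr_sumr -mulrDr -chi_dyadic.
  have [xw|xw] := leP w `|x|; first by rewrite /g psi0 // mulr0 !mul0r.
  have rK : 0 < (2 ^+ K * s)^-1 by rewrite invr_gt0; exact: rr0.
  rewrite chi_eq1 ?mulr1 // normrZ (gtr0_norm rK) ler_pdivrMl ?mulr1; last exact: rr0.
  by apply: le_trans (ltW xw) wK.
have cchi : cc (fun x : 'rV[R]_n => g x * chi N (s^-1 *: x)).
  by apply: ccM => //; apply: cc_rescale; [rewrite invr_gt0|exact: cc_chi].
have cann j : cc (fun x : 'rV[R]_n => g x * annulus N ((rr j)^-1 *: x)).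
  by apply: ccM => //; apply: cc_rescale; [rewrite invr_gt0|exact: cc_annulus].
rewrite -/g (_ : integral_rV g = integral_rV (fun x => g x * chi N (s^-1 *: x)) +
    \sum_(j < K) integral_rV (fun x => g x * annulus N ((rr j.+1)^-1 *: x))); last first.
  rewrite -integral_rV_sum // -integral_rVD //; last exact: cc_sum.
  by congr integral_rV; apply/funext => x; exact: gE.
apply: le_trans (ler_normD _ _) _; rewrite mulrDl; apply: lerD.
  rewrite (integral_rV_rescale s0 cchi) normrM ger0_norm ?exprn_ge0 ?(ltW s0) //.
  rewrite mulrC ler_wpM2r ?exprn_ge0 ?(ltW s0) //.
  have E : (fun y : 'rV[R]_n => g (s *: y) * chi N (s^-1 *: (s *: y))) =
      (fun y => g (s *: y) * chi N y).
    by apply/funext => y; rewrite scalerA mulVf ?scale1r // gt_eqF.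
  rewrite E; apply: norm_integral_off (0 : 'rV[R]_n) _ _ _ _ _ _.
  - by rewrite -E; exact: (cc_rescale s0 cchi).1.
  - by move=> y; rewrite subr0 => /ltW y2; rewrite chi_eq0 // mulr0.
  - move=> y; rewrite normrM; apply: ler_pM => //; last exact: (Cb_norm hX).
    rewrite /g normrM -[leRHS]mul1r; apply: ler_pM => //; last exact: (Cb_norm hA).
    by rewrite ler_norml cos_le1 cos_geN1.
apply: le_trans (ler_norm_sum _ _ _) _.
apply: (@le_trans _ _ (\sum_(j < K) C1 * s ^+ n * q ^+ j.+1)); last first.
  rewrite -mulr_sumr mulrAC ler_wpM2r ?exprn_ge0 ?(ltW s0) // ler_wpM2l //.
  exact: geometric_le.
apply: ler_sum => j _; set r := rr j.+1.
have r0 : 0 < r by exact: rr0.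
have r2w : r < 2 * w.
  rewrite /r /rr exprS -mulrA ltr_pM2l //; exact: Kmin.
rewrite (integral_rV_rescale r0 (cann j.+1)) normrM ger0_norm ?exprn_ge0 ?(ltW r0) //.
have E : (fun y : 'rV[R]_n => g (r *: y) * annulus N ((rr j.+1)^-1 *: (r *: y))) =
    (fun y => cos ((8 ^ j.+1)%:R * phase Phi xi r y + theta) * (psi (r *: y) * annulus N y)).
  apply/funext => y; rewrite -/r scalerA mulVf ?scale1r ?gt_eqF // mulrA; congr (cos (_ + _) * _ * _).
  rewrite /phase mulrA; congr (_ * _).
  have r3 : r ^+ 3 * lambda = (8 ^ j.+1)%:R.
    rewrite /r /rr exprMn -mulrA sl mulr1 natrX -exprM mulnC exprM; congr (_ ^+ _).
    by rewrite !exprS expr0; ring.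
  by rewrite -r3 mulrAC mulfV ?mul1r // expf_neq0 // gt_eqF.
rewrite E; apply: (@le_trans _ _ (r ^+ n * (C1 * Num.sqrt ((8 ^ j.+1)%:R ^- m)))).
  rewrite ler_wpM2l ?exprn_ge0 ?(ltW r0) //; apply: hC1 => //; last by rewrite expn_gt0.
    by apply: ltW; apply: lt_le_trans r2w _; lra.
  by lra.
have -> : Num.sqrt ((8 ^ j.+1)%:R ^- m) = B ^+ j.+1.
  rewrite natrX -exprM mulnC exprM -exprVn /B.
  elim: j.+1 => [|k IH]; first by rewrite !expr0 sqrtr1.
  by rewrite !exprS sqrtrM ?IH // invr_ge0 exprn_ge0.
rewrite /r /rr /q !exprMn -!exprM mulnC le_eqVlt; apply/orP; left; apply/eqP; ring.
Qed.

End Dyadic.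

(** * From cosine integrals to the theorem *)

Section Main.
Variable R : realType.
Import complex.

Lemma normc_le (a b : R) : ComplexField.Normc.normc (a +i* b)%C <= `|a| + `|b|.
Proof.
rewrite /ComplexField.Normc.normc.
rewrite -[leRHS]ger0_norm ?addr_ge0 // -sqrtr_sqr ler_wsqrtr // sqrrD !real_normK ?num_real //.
by rewrite lerD2r lerDl mulrn_wge0 // mulr_ge0.
Qed.

(** The cosine is even, and the sine of the phase, with its sign when lambda < 0, is a cosine
    shifted by pi / 2 one way or the other. Only |lambda| and cosines remain. *)
Lemma normc_oscillatory_integral n lambda (Phi psi : 'rV[R]_n -> R) xi :
  exists theta, ComplexField.Normc.normc (oscillatory_integral lambda Phi psi xi) <=
  `|integral_rV (fun x => cos (`|lambda| * (Phi x + dotp xi x) + 0) * psi x)| +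
  `|integral_rV (fun x => cos (`|lambda| * (Phi x + dotp xi x) + theta) * psi x)|.
Proof.
have hcos : integral_rV (fun x => Re (expi (lambda * (Phi x + dotp xi x)) * (psi x)%:C)%C) =
    integral_rV (fun x => cos (`|lambda| * (Phi x + dotp xi x) + 0) * psi x).
  congr integral_rV; apply/funext => x /=; rewrite mulr0 subr0 addr0; congr (_ * _).
  by have [|] := ger0P lambda => // _; rewrite mulNr cosN.
have [theta hsin] : exists theta,
    integral_rV (fun x => Im (expi (lambda * (Phi x + dotp xi x)) * (psi x)%:C)%C) =
    integral_rV (fun x => cos (`|lambda| * (Phi x + dotp xi x) + theta) * psi x).
  have [l0|l0] := ger0P lambda.
    exists (- (pi / 2)); congr integral_rV; apply/funext => x /=; rewrite mulr0 add0r.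
    by congr (_ * _); exact: sin_cosB.
  exists (pi / 2); congr integral_rV; apply/funext => x /=; rewrite mulr0 add0r; congr (_ * _).
  by rewrite cosDpihalf mulNr sinN opprK.
exists theta; rewrite -hcos -hsin; exact: normc_le.
Qed.

End Main.

Theorem theorem2 (R : realType) (n : nat) (hn : (18 <= n)%N) :
  exists U : set (cubic_form R n), [/\ open U, dense U &
    forall (p : cubic_form R n) (V : set 'rV[R]_n) (Phi : 'rV[R]_n -> R),
      U p -> open V -> V 0 -> smooth_on V Phi ->
      vanishes_to_fourth_order (fun x => Phi x - cubic_eval p x) ->
      exists (W : set 'rV[R]_n) (eps : R),
        [/\ nbhs (0 : 'rV[R]_n) W, W `<=` V, 0 < eps &
          forall psi : 'rV[R]_n -> R,
            smooth_on setT psi -> compactly_supported_in W psi ->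
            exists C : R, forall (xi : 'rV[R]_n) (lambda : R),
              euclidean_norm xi <= eps -> lambda != 0 ->
              complex.ComplexField.Normc.normc
                (oscillatory_integral lambda Phi psi xi)
              <= C * `|lambda| `^ (- (n%:R / 3))]].
Proof.
pose r := (2 * n %/ 3)%N.
have r3 := divn_eq (2 * n) 3; have r3' := ltn_pmod (2 * n) (isT : (0 < 3)%N).
have nrc : n = (r + (n - r))%N by rewrite subnKC // /r; lia.
(* With k = n - r, n <= 3 k and k >= 6 give 2 n <= 6 k <= k (k + 1). *)
have nc : (n <= 'C((n - r).+1, 2))%N.
  have : (2 * 'C((n - r).+1, 2) = (n - r).+1 * (n - r))%N by rewrite -mul_bin_diag bin1.
  have : (n <= 3 * (n - r))%N by rewrite /r; lia.
  have : (6 <= n - r)%N by rewrite /r; lia.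
  by move: (n - r)%N => k; nia.
have [oU dU] := open_dense_bigcap (fun i : 'I_n => @open_slice_nondeg R n r.+1 i)
  (fun i => dense_slice_nondeg i nrc nc).
exists (@nondeg_forms R n r.+1); split=> // p V Phi Up oV V0 sPhi van.
have [c c0 nd] := nondeg_formsP Up.
have n0 : (0 < n)%N by lia.
have nm : (2 * n < 3 * r.+1)%N by rewrite /r; lia.
have [w w0 [wV est]] := real_oscillatory_estimate n0 (ltn0Sn r) oV V0 sPhi van c0 nd nm.
exists (box 0 w), 1; split=> //.
- by apply: open_nbhs_nbhs; split; [exact: open_box|rewrite /box /= subrr normr0].
- by move=> x; rewrite /box /= subr0 => /wV.
move=> psi spsi supp; have [C C0 hC] := est psi spsi supp.
(* One C for the real part and one for the imaginary part. *)
exists (C + C) => xi lambda _ l0.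
have l0' : 0 < `|lambda| by rewrite normr_gt0.
pose s := `|lambda| `^ (- 3^-1).
have s0 : 0 < s by exact: powR_gt0.
have sX k : s ^+ k = `|lambda| `^ (- (k%:R / 3)).
  by rewrite -powR_mulrn ?powR_ge0 // -powRrM; congr (_ `^ _); rewrite mulNr mulrC.
have s3 : s ^+ 3 * `|lambda| = 1.
  by rewrite sX divff ?pnatr_eq0 // powR_inv1 ?normr_ge0 // mulVf // gt_eqF.
have [theta h] := normc_oscillatory_integral lambda Phi psi xi.
apply: le_trans h _; rewrite -sX mulrDl.
by apply: lerD; apply: hC.
Qed.
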